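(* Let $\delta$ be an even integer with $0\le\delta\le 2g-2$ and let $E\in\mathcal{N}$. Then $E\in\mathcal{W}_\delta^T$ if and only if $E=p_*\left(p^*F_0(R)\right)$ for some $F_0\in\mathrm{Jac}^{1-g+\delta/2}(X)$ and some $R\in\mathrm{Sym}^{2g-2-\delta}(X_T)$ such that $R\cap\sigma^*R=\emptyset$ and moreover $KT(-\mathrm{Nm}(R))\cong\mathcal{O}_X(D)$ for some effective divisor $D\in\mathrm{Sym}^\delta(X)$. In particular, $\mathcal{W}_\delta^T$ is non-empty for all possible values $0\le\delta\le 2g-2$ (with $\delta$ even).
   Context: $X$ is a smooth projective complex curve of genus $g>1$ with canonical line bundle $K$. $\mathcal{N}$ is the moduli space of semistable vector bundles of rank $2$ and degree $0$ on $X$, and $\mathcal{M}$ is the moduli space of semistable Higgs bundles $(E,\varphi)$, $\varphi:E\to E\otimes K$, of rank $2$ and degree $0$; $\mathcal{N}\subset\mathcal{M}$ via $E\mapsto(E,0)$. $T$ is a fixed non-trivial line bundle on $X$ with $T^2\cong\mathcal{O}_X$; $p:X_T\to X$ is the étale double cover defined by $T$ (so $p_*\mathcal{O}_{X_T}\cong\mathcal{O}_X\oplus T$), and $\sigma:X_T\to X_T$ is the involution exchanging the sheets. $\mathcal{M}^T=\{(E,\varphi)\in\mathcal{M} : (E,\varphi)\cong(E\otimes T,\varphi)\}$. $\mathrm{Jac}^{k}(X)$ denotes the variety of degree $k$ line bundles on $X$, and $\mathrm{Sym}^k$ of a curve is the variety of effective divisors of degree $k$. For a divisor $R=\sum a_ix_i$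 on $X_T$, $\mathrm{Nm}(R)=\sum a_i\,p(x_i)$ is the norm divisor on $X$. $R\cap\sigma^*R=\emptyset$ means that $R$ and $\sigma^*R$ have disjoint supports. A semistable vector bundle $E\in\mathcal{N}$ is wobbly if it admits a non-zero nilpotent Higgs field $E\to E\otimes K$; $\mathcal{W}\subset\mathcal{N}$ denotes the wobbly locus. For $\delta$ even with $0\le\delta\le 2g-2$, $\mathcal{W}_\delta\subset\mathcal{N}$ is the locus of semistable bundles $E$ of rank $2$ and degree $0$ fitting in an exact sequence $0\to F_0\to E\to F_1\to 0$ of line bundles with $F_1=F_0K(-D)$ for some effective divisor $D$ of degree $\delta$ and $\deg(F_0)=1-g+\delta/2$. One has $\mathcal{W}=\mathcal{W}_0\cup\dots\cup\mathcal{W}_{2g-2}$. Finally $\mathcal{W}_\delta^T:=\mathcal{M}^T\cap\mathcal{W}_\delta$. *)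

(* Defs.v *)
From HB Require Import structures.
From mathcomp Require Import all_boot all_order all_algebra.
From mathcomp Require Import complex.
From mathcomp Require Import boolp classical_sets cardinality fsbigop reals.

Set Implicit Arguments.
Unset Strict Implicit.
Unset Printing Implicit Defensive.

Import Order.TTheory GRing.Theory Num.Theory.
Local Open Scope classical_set_scope.
Local Open Scope ring_scope.

(** * Curves

   A smooth projective (irreducible) complex curve is presented as in
   Hartshorne, I.6: by its function field, a finitely generated extension of
   the complex numbers [R[i]] of transcendence degree 1.  Its closed points are
   the discrete valuation rings of the function field that contain the
   constants, the closed subsets other than the whole curve are the finite sets
   of points, and the local ring at a point is its valuation ring. *)

Definition is_function_field (R : realType) (K : fieldType)
    (iota : {rmorphism R[i] -> K}) : Prop :=
  exists t : K,
    (forall q : {poly R[i]}, q != 0 -> (map_poly iota q).[t] != 0) /\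
    exists (n : nat) (b : 'I_n -> K), forall f : K,
      exists (q : {poly R[i]}) (a : 'I_n -> {poly R[i]}),
        q != 0 /\
        (map_poly iota q).[t] * f = \sum_i (map_poly iota (a i)).[t] * b i.

Record curve (R : realType) := Curve {
  funfield : fieldType;
  cst : {rmorphism R[i] -> funfield};
  curveP : is_function_field cst }.

(* [ord x f] is the order of vanishing of [f] at [x].  The value [ord x 0 = 0]
   is a convention, which makes a point determined by its valuation ring; the
   order of 0 should be read as infinite. *)
Record closed_point (R : realType) (X : curve R) := ClosedPoint {
  ord : funfield X -> int;
  ord_zero : ord 0 = 0;
  ordM : forall f h, f != 0 -> h != 0 -> ord (f * h) = ord f + ord h;
  ordD : forall f h, f + h != 0 -> Num.min (ord f) (ord h) <= ord (f + h);
  ord_cst : forall c, ord (cst X c) = 0;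
  ord_onto : exists t, ord t = 1 }.

HB.instance Definition _ (R : realType) (X : curve R) :=
  gen_eqMixin (closed_point X).
HB.instance Definition _ (R : realType) (X : curve R) :=
  gen_choiceMixin (closed_point X).

(* The local ring at [x]; it contains 0 because [ord x 0 = 0]. *)
Definition regular (R : realType) (X : curve R) (x : closed_point X)
    (f : funfield X) : Prop := 0 <= ord x f.

(** * Sheaves and vector bundles

   The generic stalk of a locally free sheaf [E] of rank [r] is an
   [r]-dimensional vector space over the function field; after the choice of a
   basis it is the space of row vectors ['rV_r], and [E] is determined by its
   stalks [E_x], which are submodules of the generic stalk: the sections over
   an open set [U] are the intersection of the [E_x] with [x] in [U]. *)

Definition sheaf (R : realType) (X : curve R) (r : nat) : Type :=
  closed_point X -> set 'rV[funfield X]_r.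

Definition trivial_bundle (R : realType) (X : curve R) (r : nat) : sheaf X r :=
  fun x => [set v | forall j, regular x (v 0 j)].
Arguments trivial_bundle {R} X r.

Definition OX (R : realType) (X : curve R) : sheaf X 1 := trivial_bundle X 1.
Arguments OX {R} X.

(* The rows of [A] form a basis of the stalk at [x] over the local ring. *)
Definition is_frame (R : realType) (X : curve R) (r : nat) (E : sheaf X r)
    (x : closed_point X) (A : 'M[funfield X]_r) : Prop :=
  A \in unitmx /\ E x = [set u *m A | u in trivial_bundle X r x].

Definition vector_bundle (R : realType) (X : curve R) (r : nat)
    (E : sheaf X r) : Prop :=
  forall x, exists U : set (closed_point X),
    [/\ finite_set (~` U), U x &
        exists A, forall y, U y -> is_frame E y A].

Definition line_bundle (R : realType) (X : curve R) (L : sheaf X 1) : Prop :=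
  vector_bundle L.

(* A morphism of sheaves is determined by the linear map it induces on generic
   stalks; matrices act on row vectors from the right. *)
Definition hom (R : realType) (X : curve R) (r s : nat)
    (E : sheaf X r) (F : sheaf X s) (A : 'M[funfield X]_(r, s)) : Prop :=
  forall x v, E x v -> F x (v *m A).

Definition iso_by (R : realType) (X : curve R) (r : nat) (E F : sheaf X r)
    (A : 'M[funfield X]_r) : Prop :=
  A \in unitmx /\ forall x v, E x v <-> F x (v *m A).

Definition iso (R : realType) (X : curve R) (r : nat) (E F : sheaf X r) :
    Prop := exists A, iso_by E F A.

(* Exactness of 0 -> E' -> E -> E'' -> 0, tested on stalks. *)
Definition short_exact (R : realType) (X : curve R) (r s t : nat)
    (E' : sheaf X r) (E : sheaf X s) (E'' : sheaf X t)
    (A : 'M[funfield X]_(r, s)) (B : 'M[funfield X]_(s, t)) : Prop :=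
  [/\ hom E' E A,
      hom E E'' B,
      forall x u, E' x u -> u *m A = 0 -> u = 0,
      forall x v, E x v -> (v *m B = 0 <-> exists2 u, E' x u & v = u *m A) &
      forall x w, E'' x w -> exists2 v, E x v & w = v *m B].

(* The submodule generated by [S] over the local ring at [x]. *)
Definition local_span (R : realType) (X : curve R) (r : nat)
    (x : closed_point X) (S : set 'rV[funfield X]_r) : set 'rV[funfield X]_r :=
  [set v | exists (n : nat) (c : 'I_n -> funfield X)
             (s : 'I_n -> 'rV[funfield X]_r),
     [/\ forall i, regular x (c i), forall i, S (s i) &
         v = \sum_i c i *: s i]].

(* [E] tensored with a rank 1 sheaf [L]: the generic stalk K^r (x) K is
   identified with K^r. *)
Definition tensor (R : realType) (X : curve R) (r : nat)
    (E : sheaf X r) (L : sheaf X 1) : sheaf X r :=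
  fun x => local_span x [set v | exists2 l, L x l &
                                 exists2 e, E x e & v = l 0 0 *: e].

Definition direct_sum (R : realType) (X : curve R) (r s : nat)
    (E : sheaf X r) (F : sheaf X s) : sheaf X (r + s) :=
  fun x => [set v | E x (lsubmx v) /\ F x (rsubmx v)].

(* If the rows of [A] are a frame of [E] at [x], then the rational section of
   the determinant of [E] given by the standard basis of the generic stalk has
   order [- ord x (\det A)] at [x], whichever frame is chosen; the degree is
   the sum of these orders, almost all of which are zero. *)
Definition degree (R : realType) (X : curve R) (r : nat) (E : sheaf X r) :
    int :=
  \sum_(x \in [set: closed_point X])
     - ord x (\det (xget 1%:M [set A | is_frame E x A])).

(** * Effective divisors

   An effective divisor of degree [k] is a sum of [k] points; an element of
   Sym^k is represented by a [k]-tuple of points, and everything below depends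
   on the tuple only up to permutation. *)

Definition mult (R : realType) (X : curve R) (k : nat)
    (D : k.-tuple (closed_point X)) (x : closed_point X) : int :=
  (count_mem x D)%:Z.

(* The line bundle of a divisor, given by its multiplicities. *)
Definition O_of (R : realType) (X : curve R) (D : closed_point X -> int) :
    sheaf X 1 :=
  fun x => [set v | v 0 0 = 0 \/ - D x <= ord x (v 0 0)].

Definition O_plus (R : realType) (X : curve R) (k : nat)
    (D : k.-tuple (closed_point X)) : sheaf X 1 := O_of (mult D).

Definition O_minus (R : realType) (X : curve R) (k : nat)
    (D : k.-tuple (closed_point X)) : sheaf X 1 := O_of (fun x => - mult D x).

(** * The canonical bundle and the genus *)

Definition derivation (R : realType) (X : curve R)
    (d : funfield X -> funfield X) : Prop :=
  [/\ forall f h, d (f + h) = d f + d h,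
      forall f h, d (f * h) = d f * h + f * d h &
      forall c, d (cst X c) = 0].

(* A non-zero derivation [d] over the constants identifies the
   one-dimensional space of Kaehler differentials of the function field with
   the function field itself, the differential of [f] going to [d f].  The
   stalk at [x] of the sheaf of differentials is generated by the differentials
   of the regular functions at [x].  Another [d] gives an isomorphic sheaf. *)
Definition canonical_bundle (R : realType) (X : curve R) (K : sheaf X 1) :
    Prop :=
  exists d : funfield X -> funfield X,
    [/\ derivation d, exists f, d f <> 0 &
        forall x, K x = local_span x [set const_mx (d f) | f in regular x]].

(* [g] is the dimension of the space of global sections of [K], that is, this
   space has a basis with [g] elements. *)
Definition genus (R : realType) (X : curve R) (K : sheaf X 1) (g : nat) :
    Prop :=
  exists e : 'I_g -> 'rV[funfield X]_1, forall s,
    (forall x, K x s) <->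
    exists! c : {ffun 'I_g -> R[i]}, s = \sum_i cst X (c i) *: e i.

(** * Semistability and Higgs bundles *)

(* The slope inequality deg F / s <= deg E / r, for all locally free subsheaves
   [F] of rank 0 < s < r. *)
Definition semistable (R : realType) (X : curve R) (r : nat)
    (E : sheaf X r) : Prop :=
  forall (s : nat) (F : sheaf X s) (A : 'M[funfield X]_(s, r)),
    (0 < s < r)%N -> vector_bundle F -> hom F E A -> row_free A ->
    degree F * r%:Z <= degree E * s%:Z.

Definition higgs_field (R : realType) (X : curve R) (K : sheaf X 1) (r : nat)
    (E : sheaf X r) (phi : 'M[funfield X]_r) : Prop :=
  hom E (tensor E K) phi.

(* As [semistable], for the subsheaves preserved by the Higgs field. *)
Definition higgs_semistable (R : realType) (X : curve R) (K : sheaf X 1)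
    (r : nat) (E : sheaf X r) (phi : 'M[funfield X]_r) : Prop :=
  forall (s : nat) (F : sheaf X s) (A : 'M[funfield X]_(s, r))
         (psi : 'M[funfield X]_s),
    (0 < s < r)%N -> vector_bundle F -> hom F E A -> row_free A ->
    higgs_field K F psi -> psi *m A = A *m phi ->
    degree F * r%:Z <= degree E * s%:Z.

Definition higgs_iso (R : realType) (X : curve R) (r : nat)
    (E : sheaf X r) (phi : 'M[funfield X]_r)
    (F : sheaf X r) (psi : 'M[funfield X]_r) : Prop :=
  exists2 A, iso_by E F A & phi *m A = A *m psi.

(* The bundles, resp. Higgs bundles, parametrized by the two moduli spaces. *)
Definition in_N (R : realType) (X : curve R) (E : sheaf X 2) : Prop :=
  [/\ vector_bundle E, degree E = 0 & semistable E].

Definition in_M (R : realType) (X : curve R) (K : sheaf X 1)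
    (E : sheaf X 2) (phi : 'M[funfield X]_2) : Prop :=
  [/\ vector_bundle E, degree E = 0, higgs_field K E phi &
      higgs_semistable K E phi].

(* On generic stalks the Higgs field of [tensor E T] is again [phi]. *)
Definition in_MT (R : realType) (X : curve R) (K T : sheaf X 1)
    (E : sheaf X 2) (phi : 'M[funfield X]_2) : Prop :=
  in_M K E phi /\ higgs_iso E phi (tensor E T) phi.

Definition in_W (R : realType) (X : curve R) (K : sheaf X 1) (g delta : nat)
    (E : sheaf X 2) : Prop :=
  in_N E /\
  exists (F0 F1 : sheaf X 1) (A : 'M[funfield X]_(1, 2))
         (B : 'M[funfield X]_(2, 1)) (D : delta.-tuple (closed_point X)),
    [/\ line_bundle F0, line_bundle F1, short_exact F0 E F1 A B,
        iso F1 (tensor (tensor F0 K) (O_minus D)) &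
        degree F0 = 1 - g%:Z + (delta./2)%:Z].

Definition in_WT (R : realType) (X : curve R) (K T : sheaf X 1)
    (g delta : nat) (E : sheaf X 2) : Prop :=
  in_MT K T E 0 /\ in_W K g delta E.

(** * Coverings *)

(* A non-constant morphism of curves. *)
Record morphism (R : realType) (Y X : curve R) := Morphism {
  comorph : {rmorphism funfield X -> funfield Y};
  on_points : closed_point Y -> closed_point X;
  comorph_cst : forall c, comorph (cst X c) = cst Y c;
  comorph_regular :
    forall y f, regular (on_points y) f -> regular y (comorph f);
  comorph_local :
    forall y f, 0 < ord (on_points y) f -> 0 < ord y (comorph f) }.

(* Unramified: uniformizers pull back to uniformizers.  Morphisms of curves
   as above are flat, and residue fields are the complex numbers. *)
Definition etale (R : realType) (Y X : curve R) (p : morphism Y X) : Prop :=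
  forall y f, ord (on_points p y) f = 1 -> ord y (comorph p f) = 1.

(* [b] is a basis of the function field of [Y] over that of [X]; in
   particular [p] has degree [n]. *)
Definition is_basis (R : realType) (Y X : curve R) (p : morphism Y X) (n : nat)
    (b : 'rV[funfield Y]_n) : Prop :=
  forall l, exists! v : 'rV[funfield X]_n,
    l = \sum_j comorph p (v 0 j) * b 0 j.

Definition pullback (R : realType) (Y X : curve R) (p : morphism Y X)
    (r : nat) (E : sheaf X r) : sheaf Y r :=
  fun y => local_span y [set map_mx (comorph p) v | v in E (on_points p y)].

(* The direct image of a rank 1 sheaf: its generic stalk, the function field of
   [Y], is identified by means of [b] with the row vectors over that of [X],
   and a section near [x] is a section near all points above [x]. *)
Definition pushforward (R : realType) (Y X : curve R) (p : morphism Y X)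
    (n : nat) (b : 'rV[funfield Y]_n) (L : sheaf Y 1) : sheaf X n :=
  fun x => [set v | forall y, on_points p y = x ->
                    L y (const_mx (\sum_j comorph p (v 0 j) * b 0 j))].

(* [p] is the etale double cover defined by [T]: the direct image of the
   structure sheaf is the sum of the structure sheaf and [T]. *)
Definition etale_double_cover (R : realType) (Y X : curve R)
    (T : sheaf X 1) (p : morphism Y X) (b : 'rV[funfield Y]_2) : Prop :=
  [/\ etale p, is_basis p b &
      iso (pushforward p b (OX Y)) (direct_sum (OX X) T)].

(* The non-trivial involution of [Y] over [X]. *)
Definition exchanges_sheets (R : realType) (Y X : curve R)
    (p : morphism Y X) (sigma : morphism Y Y) : Prop :=
  [/\ forall f, comorph sigma (comorph p f) = comorph p f,
      forall f, comorph sigma (comorph sigma f) = f &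
      exists f, comorph sigma f <> f].

Definition Nm (R : realType) (Y X : curve R) (p : morphism Y X) (k : nat)
    (D : k.-tuple (closed_point Y)) : k.-tuple (closed_point X) :=
  [tuple of map (on_points p) D].

(* The support of [sigma^* D] is the preimage of the support of [D]. *)
Definition disjoint_from_pullback (R : realType) (Y : curve R)
    (sigma : morphism Y Y) (k : nat) (D : k.-tuple (closed_point Y)) : Prop :=
  forall y, ~ (y \in D /\ on_points sigma y \in D).

(* Main.v *)
Require Import Defs.
From mathcomp Require Import all_boot all_order all_algebra.
From mathcomp Require Import complex.
From mathcomp Require Import boolp classical_sets cardinality fsbigop reals.
From mathcomp Require Import zify ring.

Set Implicit Arguments.
Unset Strict Implicit.
Unset Printing Implicit Defensive.

Import Order.TTheory GRing.Theory Num.Theory.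
Local Open Scope ring_scope.

(** Everything is done at the level of function fields.  A rank 1 sheaf is a system of
lower bounds for orders of vanishing ([is_lb]), and [vge x n f] says that [f] vanishes
to order [n] at [x], the function 0 being included.

Let [tau] be the orders of [T].  Since the square of [T] is trivial there is a function
[q] with [ord x q = 2 * tau x] ([twist_root]), and [q] is not a square since [T] is
non-trivial.  It can be chosen as the square of a function [w] on the double cover that
the involution changes into its opposite ([cover_root]); functions on the cover are the [u + v w] with
[u] and [v] on the base.  A bundle [E] isomorphic to its twist by [T] carries an
isomorphism [Psi] with [E (x) T].  Its trace is a section of [T], hence 0, and its
determinant is a constant multiple of [q], so that [Psi] becomes a square root of [q]
after rescaling ([root_of_twist]).  In this way the generic stalk of [E] becomes the
function field of the cover; the whole theorem is about which lattices in it occur.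

If [F0] is a line subbundle of [E], with orders [a], and [A] generates it generically,
then [A] and [A Psi] are a basis in which [E] takes the normal form [extension a c r]:
the vectors [(v0, v1)] with [v1] of order at least [c x] and [v0 - r x * v1] of order at
least [a x] ([untwist]).  Stability under [Psi] says precisely that
[m := a - c - tau] is effective and that [r x] is a square root of [q] modulo [m]
([sqrt_mod], [ext_iso_tensor]).  On the other hand, above [x] lie two points of the
cover, at which [w] takes opposite values, and the local square root [r x] agrees with
[w] to the order [m x] at one of them ([mod_root]); call it [pt x].  The condition on
[(v0, v1)] then says that the function [v0 + v1 w] has order at least [a x - m x] at
[pt x] and at least [a x] at the other point ([coord_lattice]).  This is the direct
image of the pullback of [F0] twisted by the divisor [R] that has multiplicity [m x] at
[pt x] ([direct_image_extension]): the norm of [R] is [m], the supports of [R] and of its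
conjugate are disjoint, and every such divisor arises.  The quotient [F1] of [E] by [F0]
has orders [c = a - m - tau], so that [F1 = F0 K(-D)] means [KT(-m) = O(D)], and
the degree of [R] is forced by [deg E = 0].

The existence statement is proved on [X] itself.  It suffices to find an effective
divisor in the class of [KT], to split it as [m + D] into parts of the required degrees
and to choose local square roots of [q] modulo [m], which exist by Hensel's lemma
([sqrt_mod_exists]).  The bundle so obtained is semistable because the norm
[v0 ^+ 2 - q * v1 ^+ 2] of a section of a line subbundle has order at least [2 a - m],
a divisor of degree zero ([ext_semistable]).  The divisor exists because
[deg KT + 1 - g = g - 1] is positive, by the inequality of Riemann.

This uses the inequality of Riemann with the genus [g] of the statement, the dimension
of the space of sections of [K], and the degree [2 g - 2] of [K]
([canonical_riemann_roch]).  Points are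
constructed from valuation rings by Chevalley's lemma ([exists_pole]); finiteness of the
degree over a rational function field gives finiteness of zeros and poles, degree zero of
principal divisors ([deg_principal]) and the inequality of Riemann ([riemann]).  For the
canonical divisor, let [t] be a function with a single pole [o].  The functions regular
away from [o] are a free module over the polynomials in [t], with a basis adapted to the
orders at [o], and the dual basis for the trace form is one of the differentials regular
away from [o].  Reading off orders at [o], the orders of these differentials are exactly
those not excluded by the residue theorem ([regular_forms_gap],
[regular_forms_exists]); counting the gaps of the semigroup of pole orders gives the
dimension and the degree ([canonical_divisor]). *)

(** * Orders of vanishing *)

Section Valuations.
Variables (R : realType) (X : curve R).
Local Notation F := (funfield X).
Local Notation C := R[i].
Implicit Types (x y : closed_point X) (f h u : F) (m n : int).

Lemma ord_one x : ord x 1 = 0.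
Proof.
have := ordM x (oner_neq0 F) (oner_neq0 F); rewrite mulr1.
by move: (ord x 1) => a; lia.
Qed.

Lemma ordV x f : ord x f^-1 = - ord x f.
Proof.
have [->|f0] := eqVneq f 0; first by rewrite invr0 ord_zero oppr0.
have := ordM x f0 (invr_neq0 f0); rewrite divff // ord_one; lia.
Qed.

Lemma ordN x f : ord x (- f) = ord x f.
Proof.
have [->|f0] := eqVneq f 0; first by rewrite oppr0.
rewrite -mulN1r ordM ?oppr_eq0 ?oner_neq0 //.
by rewrite -[-1](rmorphN1 (cst X)) ord_cst add0r.
Qed.

Lemma ordX x f k : ord x (f ^+ k) = ord x f *+ k.
Proof.
have [->|f0] := eqVneq f 0.
  by rewrite expr0n; case: k => [|k]; rewrite ?ord_one ?ord_zero ?mul0rn.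
elim: k => [|k IH]; first by rewrite ord_one.
by rewrite exprS ordM ?expf_neq0 // IH mulrS.
Qed.

Lemma ordXz x f m : ord x (f ^ m) = ord x f * m.
Proof.
case: m => k; first by rewrite ordX -mulrzz -pmulrn.
rewrite NegzE -exprnN ordV ordX mulrN; congr (- _).
by rewrite -mulrzz -pmulrn.
Qed.

(** The function 0 has infinite order, which [ord] cannot express. *)
Definition vge x m f : bool := (f == 0) || (m <= ord x f).

Lemma vgeE x m f : f != 0 -> vge x m f = (m <= ord x f).
Proof. by rewrite /vge => /negbTE ->. Qed.

Lemma vge0 x m : vge x m 0. Proof. by rewrite /vge eqxx. Qed.

Lemma vge_ord x f : vge x (ord x f) f. Proof. by rewrite /vge lexx orbT. Qed.

Lemma vgeW x m n f : n <= m -> vge x m f -> vge x n f.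
Proof. by rewrite /vge => nm /orP[->//|h]; rewrite (le_trans nm h) orbT. Qed.

Lemma vgeN x m f : vge x m (- f) = vge x m f.
Proof. by rewrite /vge oppr_eq0 ordN. Qed.

Lemma ord_ge_add x m f h : f + h != 0 -> m <= ord x f -> m <= ord x h ->
  m <= ord x (f + h).
Proof. by move=> s0 a b; apply: le_trans (ordD x s0); rewrite le_min a. Qed.

Lemma vgeD x m f h : vge x m f -> vge x m h -> vge x m (f + h).
Proof.
have [->|f0] := eqVneq f 0; first by rewrite add0r.
have [->|h0] := eqVneq h 0; first by rewrite addr0.
have [e|s0] := eqVneq (f + h) 0; first by rewrite e vge0.
by rewrite !vgeE // => a b; apply: ord_ge_add.
Qed.

Lemma vgeB x m f h : vge x m f -> vge x m h -> vge x m (f - h).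
Proof. by move=> a b; apply: vgeD; rewrite ?vgeN. Qed.

Lemma vgeM x m n f h : vge x m f -> vge x n h -> vge x (m + n) (f * h).
Proof.
have [->|f0] := eqVneq f 0; first by move=> _ _; rewrite mul0r vge0.
have [->|h0] := eqVneq h 0; first by move=> _ _; rewrite mulr0 vge0.
by rewrite !vgeE ?mulf_neq0 // ordM // => a b; lia.
Qed.

Lemma vge_sum x m (I : Type) (r : seq I) (P : pred I) (G : I -> F) :
  (forall i, P i -> vge x m (G i)) -> vge x m (\sum_(i <- r | P i) G i).
Proof.
move=> hG; apply: (big_ind (fun z => vge x m z)) => //; first exact: vge0.
by move=> a b; apply: vgeD.
Qed.

Lemma vge_cst x c : vge x 0 (cst X c).
Proof. by rewrite /vge ord_cst lexx orbT. Qed.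

Lemma vge_exp x f k : vge x 0 f -> vge x 0 (f ^+ k).
Proof.
move=> h; elim: k => [|k IH]; first by rewrite /vge ord_one lexx orbT.
by rewrite exprS -[0]addr0 vgeM.
Qed.

Lemma vgeZ x m c f : vge x m f -> vge x m (cst X c * f).
Proof. by move=> h; rewrite -[m]add0r vgeM ?vge_cst. Qed.

Lemma vgeMl x m f h : h != 0 -> vge x (m + ord x h) (f * h) = vge x m f.
Proof.
move=> h0; have [->|f0] := eqVneq f 0; first by rewrite mul0r !vge0.
by rewrite !vgeE ?mulf_neq0 // ordM // lerD2r.
Qed.

Lemma vge_div x m f h : h != 0 -> vge x (m + ord x h) f = vge x m (f / h).
Proof. by move=> h0; rewrite -(vgeMl x m (f / h) h0) divfK. Qed.

Lemma regularE x f : regular x f <-> vge x 0 f.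
Proof.
rewrite /regular /vge; split => [->|/orP[/eqP->|//]]; first by rewrite orbT.
by rewrite ord_zero.
Qed.

Lemma ord_addl x f h : f != 0 -> vge x (ord x f + 1) h ->
  f + h != 0 /\ ord x (f + h) = ord x f.
Proof.
move=> f0 hh.
have s0 : f + h != 0.
  apply: contraL hh => /eqP e; have -> : h = - f.
    by apply/eqP; rewrite -subr_eq0 opprK addrC e.
  by rewrite vgeN vgeE //; lia.
split=> //; have [->|h0] := eqVneq h 0; first by rewrite addr0.
move: hh; rewrite vgeE // => hh.
have a : ord x f <= ord x (f + h) by apply: ord_ge_add => //; lia.
have b : f + h - h != 0 by rewrite addrK.
have := ordD x b; rewrite ordN addrK; case: leP; lia.
Qed.

(** In a sum of terms whose non-zero members have pairwise different orders the
term of least order cannot be cancelled. *)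
Lemma ord_sum_distinct x (I : finType) (G : I -> F) (i0 : I) :
  G i0 != 0 ->
  (forall i j, G i != 0 -> G j != 0 -> ord x (G i) = ord x (G j) -> i = j) ->
  exists i, [/\ G i != 0, \sum_j G j != 0, ord x (\sum_j G j) = ord x (G i) &
                forall j, vge x (ord x (G i)) (G j)].
Proof.
move=> h0 inj.
have [i Gi imin] := @Order.TotalTheory.arg_minP _ int I i0
  (fun i => G i != 0) (fun i => ord x (G i)) h0.
exists i.
have imin' j : vge x (ord x (G i)) (G j).
  by have [->|Gj] := eqVneq (G j) 0; rewrite ?vge0 // vgeE // imin.
rewrite (bigD1 i) //=.
have [|? ?] := @ord_addl x (G i) (\sum_(j | j != i) G j) Gi; last by split.
apply: vge_sum => j ji; have [->|Gj] := eqVneq (G j) 0; rewrite ?vge0 // vgeE //.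
have := imin _ Gj; rewrite le_eqVlt => /orP[/eqP/esym e|]; last by lia.
by rewrite (inj _ _ Gj Gi e) eqxx in ji.
Qed.

Lemma uniformizer x : exists s : F, [/\ s != 0 & ord x s = 1].
Proof.
have [s hs] := ord_onto x; exists s; split=> //.
by apply: contra_eq_neq hs => ->; rewrite ord_zero.
Qed.

Lemma point_ext x y : (forall f, ord x f = ord y f) -> x = y.
Proof.
case: x y => [o1 a1 b1 c1 d1 e1] [o2 a2 b2 c2 d2 e2] /= h.
have e : o1 = o2 by apply/funext.
subst o2; congr ClosedPoint; exact: Prop_irrelevance.
Qed.

(** Discrete valuation rings are maximal subrings, hence not properly contained
in each other. *)
Lemma regular_subset_eq x y : (forall f, vge x 0 f -> vge y 0 f) -> x = y.
Proof.
move=> sub.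
have unit f : f != 0 -> ord x f = 0 -> ord y f = 0.
  move=> f0 e; have := sub f; have := sub f^-1.
  rewrite !vgeE ?invr_eq0 // !ordV e => a b.
  have {}a := a isT; have {}b := b isT; lia.
have [s [s0 os]] := uniformizer x.
have key f : f != 0 -> ord y f = ord y s * ord x f.
  move=> f0; have := unit (f / s ^ (ord x f)).
  rewrite mulf_neq0 ?invr_eq0 ?expfz_neq0 // !ordM ?invr_eq0 ?expfz_neq0 //.
  rewrite !ordV !ordXz os; move=> /(_ isT); lia.
have [s' [s0' os']] := uniformizer y.
have e1 : ord y s = 1.
  have := key _ s0'; rewrite os'; have := sub s; rewrite !vgeE // os => /(_ isT).
  move: (ord y s) (ord x s') => a b a0 e.
  have a1 : 0 < a by case: (ltgtP a 0) a0 e => // ->; rewrite mul0r; lia.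
  have b1 : 0 < b by nia.
  nia.
apply: point_ext => f; have [->|f0] := eqVneq f 0; first by rewrite !ord_zero.
by rewrite key // e1 mul1r.
Qed.

(** * Algebraic dependence *)

Definition ev u (q : {poly C}) : F := (map_poly (cst X) q).[u].

Lemma evC u c : ev u c%:P = cst X c.
Proof. by rewrite /ev map_polyC /= hornerC. Qed.
Lemma evX u : ev u 'X = u.
Proof. by rewrite /ev map_polyX hornerX. Qed.
Lemma ev0 u : ev u 0 = 0.
Proof. by rewrite /ev rmorph0 horner0. Qed.
Lemma ev1 u : ev u 1 = 1.
Proof. by rewrite /ev rmorph1 hornerC. Qed.
Lemma evD u p q : ev u (p + q) = ev u p + ev u q.
Proof. by rewrite /ev rmorphD hornerD. Qed.
Lemma evN u p : ev u (- p) = - ev u p.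
Proof. by rewrite /ev rmorphN hornerN. Qed.
Lemma evB u p q : ev u (p - q) = ev u p - ev u q.
Proof. by rewrite evD evN. Qed.
Lemma evM u p q : ev u (p * q) = ev u p * ev u q.
Proof. by rewrite /ev rmorphM hornerM. Qed.
Lemma ev_sum u (I : Type) (r : seq I) (P : pred I) (G : I -> {poly C}) :
  ev u (\sum_(i <- r | P i) G i) = \sum_(i <- r | P i) ev u (G i).
Proof. by rewrite /ev rmorph_sum horner_sum. Qed.
Lemma evXn u p k : ev u (p ^+ k) = ev u p ^+ k.
Proof. by rewrite /ev rmorphXn horner_exp. Qed.
Lemma ev_prod u (I : Type) (r : seq I) (P : pred I) (G : I -> {poly C}) :
  ev u (\prod_(i <- r | P i) G i) = \prod_(i <- r | P i) ev u (G i).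
Proof. by rewrite /ev rmorph_prod horner_prod. Qed.
Lemma ev_comp u p q : ev u (p \Po q) = ev (ev u q) p.
Proof. by rewrite /ev map_comp_poly horner_comp. Qed.
Lemma evXsubC u a : ev u ('X - a%:P) = u - cst X a.
Proof. by rewrite evB evX evC. Qed.

(** The degree of the function field over [C(u)] is at most [n]; stating it with polynomial
coefficients avoids the field of fractions. *)
Definition dep u (n : nat) := forall f : 'I_n.+1 -> F,
  exists q : 'I_n.+1 -> {poly C},
    (exists i, q i != 0) /\ \sum_i ev u (q i) * f i = 0.

Definition transcendental u := forall q : {poly C}, q != 0 -> ev u q != 0.

(** By definition the functions are combinations of [n] fixed ones over the rational
functions in one of them, so that any [n.+1] of them are dependent. *)
Lemma function_field_dep : exists u (n : nat), transcendental u /\ dep u n.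
Proof.
have [t [tr [n [b hb]]]] := curveP X.
exists t, n; split=> [//|f].
have [Q hQ] := choice (fun i => hb (f i)).
have [a ha] := choice hQ.
pose d (i : 'I_n.+1) := Q i.
(* the coefficients of the [f i], bordered by a zero column to make a determinant *)
pose M : 'M[{poly C}]_n.+1 :=
  \matrix_(i, j) (if unlift ord_max j is Some k then a i k else 0).
have : \det M == 0.
  by rewrite (expand_det_col _ ord_max) big1 // => i _; rewrite mxE unlift_none mul0r.
case/det0P => v v0 vM; exists (fun i => v 0 i * d i); split.
  have [i vi] : exists i, v 0 i != 0.
    apply/existsP; rewrite -negb_forall; apply: contra v0 => /forallP h.
    by apply/eqP/rowP => i; rewrite (eqP (h i)) mxE.
  by exists i; rewrite mulf_neq0 // /d; case: (ha i).
under eq_bigr => i _.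
  have [_ e] := ha i; rewrite evM -mulrA /d e mulr_sumr; over.
rewrite exchange_big big1 //= => k _.
under eq_bigr => i _ do rewrite mulrA -evM.
rewrite -mulr_suml -ev_sum.
have := congr1 (fun N : 'rV_n.+1 => N 0 (lift ord_max k)) vM.
rewrite !mxE => e.
suff -> : ev t (\sum_i v 0 i * a i k) = 0 by rewrite mul0r.
have := congr1 (ev t) e; rewrite ev0 => <-; congr (ev _ _).
by apply: eq_bigr => i _; rewrite mxE liftK.
Qed.

Lemma evE u (q : {poly C}) (k : nat) : (size q <= k)%N -> ev u q = \sum_(j < k) cst X q`_j * u ^+ j.
Proof.
move=> hq; rewrite /ev (@horner_coef_wide _ k) ?size_map_poly //.
by apply: eq_bigr => j _; rewrite coef_map.
Qed.

Lemma dep_shift u (n : nat) a : dep u n -> dep (u - cst X a) n.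
Proof.
move=> h f; have [q [[i qi] e]] := h f.
exists (fun i => q i \Po ('X + a%:P)); split.
  by exists i; rewrite comp_poly2_eq0 ?size_XaddC.
by rewrite -[RHS]e; apply: eq_bigr => j _; rewrite ev_comp evD evX evC subrK.
Qed.

(** Multiply a relation by a power of [u^-1] to reverse its coefficients. *)
Lemma dep_inv u (n : nat) : u != 0 -> dep u n -> dep u^-1 n.
Proof.
move=> u0 h f; have [q [[i qi] e]] := h f.
pose N := (\max_j size (q j)).
have hN j : (size (q j) <= N)%N by apply: (leq_bigmax j).
have N0 : (0 < N)%N by apply: leq_trans (hN i); rewrite size_poly_gt0.
have revN k : (N.-1 - k < N)%N by lia.
exists (fun j => \poly_(k < N) (q j)`_(N.-1 - k)); split.
  exists i; apply/eqP => /polyP z.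
  have := z (N.-1 - (size (q i)).-1)%N; rewrite coef_poly coef0 revN.
  have -> : (N.-1 - (N.-1 - (size (q i)).-1) = (size (q i)).-1)%N.
    by have := hN i; lia.
  by move/eqP; rewrite -/(lead_coef _) lead_coef_eq0 (negbTE qi).
rewrite -[RHS](mulr0 (u ^- N.-1)) -[in RHS]e mulr_sumr.
apply: eq_bigr => j _; rewrite mulrA; congr (_ * _).
rewrite (@evE _ _ N) ?size_poly // (@evE _ _ N) // mulr_sumr.
rewrite (reindex_inj rev_ord_inj) /=; apply: eq_bigr => k _.
rewrite coef_poly ifT; last by lia.
have -> : (N.-1 - (N - k.+1) = k)%N by have := ltn_ord k; lia.
rewrite mulrCA; congr (_ * _).
have {1}-> : N.-1 = ((N - k.+1) + k)%N by have := ltn_ord k; lia.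
by rewrite exprD invfM exprVn -mulrA mulVf ?mulr1 // expf_neq0.
Qed.

(** Dividing a relation by the largest common power of [u] makes its reduction modulo [u]
non-trivial. *)
Lemma dep_normalize u (I : finType) (z : I -> F) (q : I -> {poly C}) :
  u != 0 -> (exists i, q i != 0) -> \sum_i ev u (q i) * z i = 0 ->
  exists q' : I -> {poly C},
    (exists i, (q' i).[0] != 0) /\ \sum_i ev u (q' i) * z i = 0.
Proof.
move=> u0; have [k hk] := ubnP (\sum_i size (q i)).
elim: k q hk => // k IH q hk [i qi] e.
have [[j hj]|h] := pselect (exists j, (q j).[0] != 0).
  by exists q; split=> //; exists j.
have r j : root (q j) 0 by apply: contra_notT h => hj; exists j.
have [q' hq'] := choice (fun j => factor_theorem (q j) 0 (r j)).
have q'i : q' i != 0 by apply: contraNneq qi => z0; rewrite hq' z0 mul0r.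
apply: (IH q'); last 1 first.
- apply/eqP; rewrite -(mulrI_eq0 _ (mulfI u0)) mulr_sumr; apply/eqP.
  rewrite -[RHS]e; apply: eq_bigr => j _.
  by rewrite hq' evM subr0 evX mulrA [u * _]mulrC.
- rewrite -ltnS; apply: leq_trans hk; rewrite ltnS (bigD1 i) // [X in (_ < X)%N](bigD1 i) //=.
  rewrite -addSn leq_add //.
    by rewrite hq' subr0 size_mulX.
  apply: leq_sum => j _; have [->|q'j] := eqVneq (q' j) 0; first by rewrite size_poly0.
  by rewrite [in X in (_ <= X)%N]hq' subr0 size_mulX // leqnSn.
- by exists i.
Qed.

Lemma ev_vge0 x u (q : {poly C}) : vge x 0 u -> vge x 0 (ev u q).
Proof.
move=> hu; rewrite (evE u (leqnn _)); apply: vge_sum => i _.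
by apply: vgeZ; apply: vge_exp.
Qed.

Lemma ev_vge_root0 x u (q : {poly C}) : vge x 0 u -> q.[0] = 0 ->
  vge x (ord x u) (ev u q).
Proof.
move=> hu q0; have : root q 0 by apply/eqP.
case/factor_theorem => p ->; rewrite evM subr0 evX -[ord x u]add0r.
by rewrite vgeM ?vge_ord // ev_vge0.
Qed.

Lemma ev_val0 x u (q : {poly C}) : 0 < ord x u -> vge x 1 (ev u q - cst X q.[0]).
Proof.
move=> hu; have : root (q - q.[0]%:P) 0 by rewrite /root !hornerE subrr.
case/factor_theorem => p hp; rewrite -(evC u) -evB hp evM subr0 evX -[1]add0r.
have hu1 : vge x 1 u by rewrite /vge; apply/orP; right; lia.
apply: vgeM => //; rewrite (evE u (leqnn _)); apply: vge_sum => i _.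
by apply: vgeZ; apply: vge_exp; apply: vgeW hu1.
Qed.

(** The constants are algebraically closed, so a function that is congruent to
no constant has polynomial expressions of order 0 only. *)
Lemma ord_ev_unit x f : vge x 0 f -> (forall c, ~~ vge x 1 (f - cst X c)) ->
  forall q, q != 0 -> ev f q != 0 /\ ord x (ev f q) = 0.
Proof.
move=> f0 hf q q0; have [r ->] := closed_field_poly_normal q.
rewrite -mul_polyC evM evC ev_prod.
have lq : cst X (lead_coef q) != 0 by rewrite fmorph_eq0 lead_coef_eq0.
rewrite mulf_eq0 (negbTE lq) /=.
elim: r => [|a r [IH1 IH2]].
  by rewrite big_nil oner_eq0 mulr1 ord_cst.
have ha : f - cst X a != 0 by apply: contraNneq (hf a) => ->; rewrite vge0.
have oa : ord x (f - cst X a) = 0.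
  have := vgeB f0 (vge_cst x a); have := hf a.
  by rewrite !vgeE //; lia.
rewrite big_cons evXsubC; split; first by rewrite mulf_neq0.
by rewrite mulrCA ordM // ?oa ?IH2 // mulf_neq0.
Qed.

(** A function [u] whose values at [x] avoid infinity and all constants has only polynomial
expressions of order 0; then the powers of a uniformizer have different orders over
[C[u]] and are independent, which contradicts [dep]. *)
Lemma local_parameter_cases u (n : nat) x : transcendental u -> dep u n ->
  (u != 0 /\ 0 < ord x u^-1) \/
  (exists a, u - cst X a != 0 /\ 0 < ord x (u - cst X a)).
Proof.
move=> tr hd.
have u0 : u != 0 by rewrite -(evX u) tr ?polyX_eq0.
have [hu|hu] := ltP (ord x u) 0; first by left; rewrite ordV; split=> //; lia.
right; apply: contrapT => /forallNP na.
have ua a : u - cst X a != 0 by rewrite -evXsubC tr // polyXsubC_eq0.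
have hu0 : vge x 0 u by rewrite vgeE.
have hun a : ~~ vge x 1 (u - cst X a).
  by rewrite vgeE //; apply/negP => h; apply: (na a); split=> //; lia.
have key := ord_ev_unit hu0 hun.
have [s [s0 os]] := uniformizer x.
have [q [[i qi] e]] := hd (fun i => s ^+ i).
have G0 j : (ev u (q j) * s ^+ j != 0) = (q j != 0).
  have [->|qj] := eqVneq (q j) 0; first by rewrite ev0 mul0r eqxx.
  by rewrite mulf_neq0 ?expf_neq0 //; case: (key _ qj).
have oG j : q j != 0 -> ord x (ev u (q j) * s ^+ j) = j.
  move=> qj; have [a b] := key _ qj.
  by rewrite ordM ?expf_neq0 // b ordX os add0r natz.
have [||j] := @ord_sum_distinct x _ (fun j : 'I_n.+1 => ev u (q j) * s ^+ j) i.
- by rewrite G0.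
- by move=> j k; rewrite !G0 => /oG -> /oG -> [] /ord_inj.
- by rewrite e eqxx; case.
Qed.

Lemma small_dep x : exists (s : F) (n : nat), [/\ s != 0, 0 < ord x s & dep s n].
Proof.
have [t [n [tr hd]]] := function_field_dep.
have [[t0 h]|[a [t0 h]]] := local_parameter_cases x tr hd.
  by exists t^-1, n; rewrite invr_eq0; split=> //; apply: dep_inv.
by exists (t - cst X a), n; split=> //; apply: dep_shift.
Qed.

(** In a relation between the powers of [f] over [C[s]] with [s] vanishing at [x], put
[s = 0]: the result is an algebraic equation for the residue of [f] over the constants,
which are algebraically closed. *)
Lemma residue x f : vge x 0 f -> exists c, vge x 1 (f - cst X c).
Proof.
move=> f0; apply: contrapT => /forallNP hf.
have hf' c : ~~ vge x 1 (f - cst X c) by apply/negP.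
have [s [n [s0 os hd]]] := small_dep x.
have [q0 [nz0 e0]] := hd (fun i => f ^+ i).
have [q [[i qi] e]] := dep_normalize s0 nz0 e0.
pose Q := \poly_(j < n.+1) (q (inord j)).[0].
have Q0 : Q != 0.
  apply: contraNneq qi => /polyP/(_ i); rewrite coef_poly ltn_ord coef0 inord_val.
  by move=> ->.
have [nQ oQ] := ord_ev_unit f0 hf' Q0.
suff : vge x 1 (ev f Q) by rewrite vgeE // oQ.
rewrite (@evE _ _ n.+1) ?size_poly // -[X in vge _ _ X]subr0 -[X in _ - X]e.
rewrite -sumrB; apply: vge_sum => j _.
rewrite coef_poly ltn_ord inord_val -mulrBl -[1]addr0; apply: vgeM.
  by rewrite -opprB vgeN ev_val0.
exact: vge_exp.
Qed.

Lemma leading_coef x f m : vge x m f -> forall s, ord x s = 1 -> s != 0 ->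
  exists c, vge x (m + 1) (f - cst X c * s ^ m).
Proof.
move=> hf s os s0.
have sm : s ^ m != 0 by rewrite expfz_neq0.
have om : ord x (s ^ m) = m by rewrite ordXz os mul1r.
have : vge x 0 (f / s ^ m) by rewrite -vge_div // om add0r.
case/residue => c hc; exists c.
by rewrite -(divfK sm f) -mulrBl addrC -om; rewrite om -{1}om vgeMl.
Qed.

(** * Weak approximation *)

Lemma separate2 x y : x != y -> exists z : F, [/\ z != 0, 0 < ord x z & ord y z < 0].
Proof.
move=> xy.
have nsub a b : a != b -> exists f, vge a 0 f /\ ~~ vge b 0 f.
  move=> ab; apply: contrapT => /forallNP h; move/eqP: ab; apply.
  apply: regular_subset_eq => f fa; apply: contrapT => /negP fb.
  by apply: (h f); split.
have nz b f : ~~ vge b 0 f -> f != 0 by apply: contraNneq => ->; rewrite vge0.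
have [f [fx fy]] := nsub _ _ xy; rewrite eq_sym in xy.
have [h [hy hx]] := nsub _ _ xy.
have [f0 h0] := (nz _ _ fy, nz _ _ hx).
exists (f / h); rewrite mulf_neq0 ?invr_eq0 // !ordM ?invr_eq0 // !ordV.
by move: fx fy hx hy; rewrite !vgeE //; split=> //; lia.
Qed.

(** To a function with a pole at the new point add a power of [z] that dominates it at the
old ones. *)
Lemma separate x (ys : seq (closed_point X)) : x \notin ys ->
  exists z : F, [/\ z != 0, 0 < ord x z & forall y, y \in ys -> ord y z < 0].
Proof.
elim: ys => [_|y ys IH].
  by have [s [s0 os]] := uniformizer x; exists s; rewrite os.
rewrite inE negb_or => /andP[xy /IH [z [z0 xz hz]]].
have [yz|yz] := ltP (ord y z) 0.
  by exists z; split=> // y'; rewrite inE => /orP[/eqP->|/hz].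
have [w [w0 xw yw]] := separate2 xy.
pose M := (\sum_(y' <- ys) `|ord y' w|%N).+1.
have hM y' : y' \in ys -> (`|ord y' w| < M)%N.
  by move=> hy; rewrite ltnS (big_rem _ hy) leq_addr.
have zM : z ^+ M != 0 by rewrite expf_neq0.
have at_y : z ^+ M + w != 0 /\ ord y (z ^+ M + w) < 0.
  rewrite addrC; have [|a ->] := @ord_addl y w (z ^+ M) w0; last by split.
  by rewrite vgeE // ordX; move: (ord y z) (ord y w) yz yw => a b; nia.
exists (z ^+ M + w); split; first by case: at_y.
  have : vge x 1 (z ^+ M + w).
    apply: vgeD; rewrite vgeE ?ordX //; last by lia.
  by case: at_y => n0 _; rewrite vgeE // gtz0_ge1.
move=> y'; rewrite inE => /orP[/eqP->|hy]; first by case: at_y.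
have [|_ ->] := @ord_addl y' (z ^+ M) w zM.
  rewrite vgeE // ordX; move: (hM _ hy) (hz _ hy); move: (ord y' z) (ord y' w) => a b.
  by nia.
by rewrite ordX; move: (hz _ hy); move: (ord y' z) => a; rewrite /M; nia.
Qed.

(** [1 / (1 + z ^+ M)] is close to 1 at a zero of [z] and close to 0 at its poles. *)
Lemma weak_approx x (ys : seq (closed_point X)) (k m : int) : x \notin ys ->
  exists z : F, [/\ z != 0, ord x z = k & forall y, y \in ys -> vge y m z].
Proof.
move=> /separate [z [z0 xz hz]]; have [s [s0 os]] := uniformizer x.
pose M := (absz m + \sum_(y' <- ys) absz (ord y' s * k)%R).+1.
have hM y' : y' \in ys -> (absz m + absz (ord y' s * k)%R < M)%N.
  by move=> hy; rewrite ltnS (big_rem _ hy) leq_add2l leq_addr.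
have zM : z ^+ M != 0 by rewrite expf_neq0.
have [d0 dx] : 1 + z ^+ M != 0 /\ ord x (1 + z ^+ M) = 0.
  have [|//] := @ord_addl x 1 (z ^+ M) (oner_neq0 _); last by rewrite ord_one.
  rewrite ord_one vgeE // ordX; move: (ord x z) xz => a; rewrite /M; nia.
have dy y : y \in ys -> ord y (1 + z ^+ M) = ord y z *+ M.
  move=> hy; rewrite addrC; have [|_ ->] := @ord_addl y (z ^+ M) 1 zM; last by rewrite ordX.
  rewrite vgeE ?oner_eq0 // ord_one ordX; move: (hz _ hy); move: (ord y z) => a; rewrite /M; nia.
have sk : s ^ k != 0 by rewrite expfz_neq0.
exists (s ^ k / (1 + z ^+ M)); split; first by rewrite mulf_neq0 ?invr_eq0.
  by rewrite ordM ?invr_eq0 // ordV dx ordXz os; lia.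
move=> y hy; rewrite vgeE ?mulf_neq0 ?invr_eq0 // ordM ?invr_eq0 // ordV ordXz dy //.
move: (hM _ hy) (hz _ hy); move: (ord y z) (ord y s * k) => a b.
by nia.
Qed.

(** * Zeros and poles *)

Definition indep_over u (I : finType) (z : I -> F) := forall q : I -> {poly C},
  \sum_i ev u (q i) * z i = 0 -> forall i, q i = 0.

(** The number of zeros of [u] is at most the degree of the function field over [C(u)]: at a
zero [y] of order [e] take functions of the orders [0, .., e - 1] at [y] that vanish to
high order at the other zeros.  In a relation over [C[u]] that is non-trivial modulo [u],
the terms belonging to one [y] have different orders less than [e], whereas everything
else has order at least [e]. *)
Lemma zeros_indep u (ys : seq (closed_point X)) : u != 0 -> uniq ys ->
  {in ys, forall y, 0 < ord y u} ->
  exists z : 'I_(\sum_(y <- ys) `|ord y u|%N) -> F, indep_over u z.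
Proof.
move=> u0 uys pos.
pose r := size ys; pose e (i : 'I_r) := `|ord (tnth (in_tuple ys) i) u|%N.
pose I := {i : 'I_r & 'I_(e i)}.
have yin i : tnth (in_tuple ys) i \in ys by apply: mem_tnth.
have cI : #|{: I}| = (\sum_(y <- ys) `|ord y u|)%N.
  rewrite card_tagged sumnE big_map big_enum /= [RHS]big_tnth.
  by apply: eq_bigr => i _; rewrite card_ord.
pose m := \sum_(y <- ys) `|ord y u|%N.
have /choice[z hz] : forall i : I, exists w : F,
    [/\ w != 0, ord (tnth (in_tuple ys) (tag i)) w = tagged i &
        forall j, j != tag i -> vge (tnth (in_tuple ys) j) m w].
  move=> i; have [|w [w0 ow hw]] :=
    @weak_approx (tnth (in_tuple ys) (tag i))
      [seq y <- ys | y != tnth (in_tuple ys) (tag i)] (tagged i) m.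
    by rewrite mem_filter eqxx.
  exists w; split=> // j ji; apply: hw; rewrite mem_filter yin andbT.
  by apply: contra ji => /eqP/tuple_uniqP e'; apply/eqP; apply: e'.
have em i : (e i)%:Z <= m by rewrite /m (big_rem _ (yin i)) /e /=; lia.
exists (fun k => z (enum_val (cast_ord (esym cI) k))) => q0 s0.
pose q1 (i : I) := q0 (cast_ord cI (enum_rank i)).
have s1 : \sum_i ev u (q1 i) * z i = 0.
  rewrite -[RHS]s0 (reindex (fun k => enum_val (cast_ord (esym cI) k))) /=.
    by apply: eq_bigr => k _; rewrite /q1 enum_valK cast_ordKV.
  exists (fun i => cast_ord cI (enum_rank i)) => k _.
    by rewrite enum_valK cast_ordKV.
  by rewrite cast_ordK enum_rankK.
suff q10 i : q1 i = 0.
  by move=> k; rewrite -(q10 (enum_val (cast_ord (esym cI) k))) /q1 enum_valK cast_ordKV.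
apply/eqP; apply/negP => /negP qi.
have [q [[[i0 j0] qi0] s2]] := dep_normalize u0 (ex_intro _ i qi) s1.
pose y := tnth (in_tuple ys) i0.
pose P (k : I) := (tag k == i0) && ((q k).[0] != 0).
pose G k := if P k then ev u (q k) * z k else 0.
have uy : 0 < ord y u by apply/pos/yin.
have evq k : P k -> ev u (q k) != 0 /\ ord y (ev u (q k)) = 0.
  case/andP=> _ hk; have c0 : cst X (q k).[0] != 0 by rewrite fmorph_eq0.
  have := @ord_addl y _ (ev u (q k) - cst X (q k).[0]) c0.
  by rewrite ord_cst add0r ev_val0 // addrC subrK => /(_ isT).
have Gn k : G k != 0 -> P k by rewrite /G; case: ifP => //; rewrite eqxx.
have oG k : P k -> ord y (G k) = tagged k.
  move=> Pk; have [n1 o1] := evq k Pk; have [n2 o2 _] := hz k.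
  rewrite /G Pk ordM // o1 add0r; case/andP: Pk => /eqP k0 _.
  by rewrite /y -k0.
have Pi0 : P (existT _ i0 j0) by rewrite /P /= eqxx.
have [||k [Gk sG oS _]] := @ord_sum_distinct y _ G (existT _ i0 j0).
- by rewrite /G Pi0 mulf_neq0 //; [case: (evq _ Pi0)|case: (hz (existT _ i0 j0))].
- move=> [k kk] [l ll] /Gn Pk /Gn Pl; rewrite !oG //=.
  case/andP: Pk => /eqP /= k0 _; case/andP: Pl => /eqP /= l0 _.
  by subst k l => -[] /ord_inj ->.
suff : vge y (e i0)%:Z (\sum_j G j).
  rewrite vgeE // oS oG ?Gn //.
  case: {Gk oS} k (Gn _ Gk) => k kk /andP[/eqP /= k0 _]; subst k.
  by have := ltn_ord kk; lia.
have -> : \sum_j G j = - (\sum_(j | ~~ P j) ev u (q j) * z j).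
  have -> : \sum_j G j = \sum_(j | P j) ev u (q j) * z j by rewrite [RHS]big_mkcond.
  by move/eqP: s2; rewrite (bigID P) /= addr_eq0 => /eqP.
rewrite vgeN; clear k Gk sG oS.
apply: vge_sum => k; rewrite negb_and negbK.
have hu0 : vge y 0 u by rewrite /vge; apply/orP; right; lia.
have [_ _ hk] := hz k; have [ki /= qk|ki _] := eqVneq (tag k) i0; last first.
  rewrite -[(e i0)%:Z]add0r; apply: vgeM; first exact: ev_vge0.
  by apply: vgeW (em i0) _; apply: hk; rewrite eq_sym.
have [n2 o2 _] := hz k; rewrite -[(e i0)%:Z]addr0; apply: vgeM.
  by rewrite /e gez0_abs ?ltW //; apply: ev_vge_root0 => //; apply/eqP.
by rewrite vgeE // /y -ki o2.
Qed.

Lemma dep_zeros_size u (n : nat) (ys : seq (closed_point X)) : u != 0 -> dep u n ->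
  uniq ys -> {in ys, forall y, 0 < ord y u} ->
  (\sum_(y <- ys) `|ord y u| <= n)%N.
Proof.
move=> u0 hd uys pos; have [z hz] := zeros_indep u0 uys pos.
rewrite leqNgt; apply/negP => lt.
have [q [[i qi] e]] := hd (fun i => z (widen_ord lt i)).
pose q' (j : 'I_(\sum_(y <- ys) `|ord y u|%N)) := oapp q 0 (insub (val j) : option 'I_n.+1).
have q'w k : q' (widen_ord lt k) = q k by rewrite /q' /= valK.
case/eqP: qi; rewrite -q'w; apply: hz.
rewrite -[RHS]e (bigID (fun j : 'I__ => (j < n.+1)%N)) /= [X in _ + X]big1 ?addr0; last first.
  by move=> j hj; rewrite /q' insubN // ev0 mul0r.
rewrite (big_ord_narrow lt) /=.
by apply: eq_bigr => k _; rewrite q'w.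
Qed.

Lemma bounded_finite_set (A : set (closed_point X)) (n : nat) :
  (forall s, uniq s -> {in s, forall y, A y} -> (size s <= n)%N) -> finite_set A.
Proof.
move=> h; apply: contrapT => /(infinite_set_fset n.+1) [B sB].
rewrite leqNgt ltnS => /negP; apply; rewrite -/(size _).
by apply: h => [|y yB]; [exact: finmap.fset_uniq | apply: sB].
Qed.

Lemma dep_finite_zeros u (n : nat) : u != 0 -> dep u n ->
  finite_set [set x | 0 < ord x u]%classic.
Proof.
move=> u0 hd; apply: (@bounded_finite_set _ n) => s us hs.
apply: leq_trans (dep_zeros_size u0 hd us hs).
rewrite -sum1_size big_seq [in X in (_ <= X)%N]big_seq.
by apply: leq_sum => y /hs /=; lia.
Qed.

(** In a relation between the powers of [u] over [C[t]], the lowest coefficient vanishes where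
[u] does; hence the zeros of [u] are among the poles of [t] and the points where [t] takes
one of finitely many values. *)
Lemma finite_zeros u : u != 0 -> finite_set [set x | 0 < ord x u]%classic.
Proof.
move=> u0; have [t [n [tr hd]]] := function_field_dep.
have t0 : t != 0 by rewrite -(evX t) tr ?polyX_eq0.
have ta a : t - cst X a != 0 by rewrite -evXsubC tr // polyXsubC_eq0.
have [q [[i qi] e]] := hd (fun i => u ^+ i).
have [j hj jmin] : exists2 j : 'I_n.+1, q j != 0 & forall k, q k != 0 -> (j <= k)%N.
  by case: (@arg_minnP _ i (fun k => q k != 0) (fun k => k) qi) => j hj jmin; exists j.
have [r hr] := closed_field_poly_normal (q j).
pose Z (w : F) := [set x | 0 < ord x w]%classic.
apply: (@sub_finite_set _ _ (Z t^-1 `|` \bigcup_(a in [set a | a \in r]) Z (t - cst X a))%classic); last first.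
  rewrite finite_setU; split; first by apply: (@dep_finite_zeros _ n); rewrite ?invr_eq0 //; apply: dep_inv.
  apply: bigcup_finite => [|a _]; first exact: finite_seq.
  by apply: (@dep_finite_zeros _ n) => //; apply: dep_shift.
move=> x /= hx; have [tx|tx] := ltP (ord x t) 0; [left|right].
  by rewrite /Z /= ordV; lia.
have tx0 : vge x 0 t by rewrite vgeE.
have ux1 : vge x 1 u by rewrite vgeE // -gtz0_ge1.
have qx : vge x 1 (ev t (q j)).
  have uj : u ^+ j != 0 by rewrite expf_neq0.
  have : ev t (q j) * u ^+ j = - \sum_(k | k != j) ev t (q k) * u ^+ k.
    by move/eqP: e; rewrite (bigD1 j) //= addr_eq0 => /eqP.
  move/(congr1 (fun z => z / u ^+ j)); rewrite mulfK // => ->.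
  rewrite mulNr vgeN mulr_suml; apply: vge_sum => k kj.
  have [->|qk] := eqVneq (q k) 0; first by rewrite ev0 !mul0r vge0.
  have lt : (j < k)%N by rewrite ltn_neqAle jmin // andbT eq_sym.
  have -> : ev t (q k) * u ^+ k / u ^+ j = ev t (q k) * (u ^+ (k - j).-1 * u).
    by rewrite -mulrA -exprSr prednK ?subn_gt0 // expfB.
  by rewrite -[1]add0r vgeM ?ev_vge0 // -[1]add0r vgeM // vge_exp // (vgeW _ ux1).
apply: contrapT => nx.
suff : ev t (q j) != 0 /\ ord x (ev t (q j)) = 0.
  by case=> n0 o0; rewrite vgeE ?o0 in qx.
rewrite hr -mul_polyC evM evC ev_prod.
have lq : cst X (lead_coef (q j)) != 0 by rewrite fmorph_eq0 lead_coef_eq0.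
rewrite mulf_eq0 (negbTE lq) /= ordM // ?ord_cst; last first.
  by rewrite prodf_seq_neq0; apply/allP => a _ /=; rewrite evXsubC.
rewrite add0r big_seq; apply: (big_ind (fun w => w != 0 /\ ord x w = 0)).
- by rewrite oner_eq0 ord_one.
- by move=> a b [a0 oa] [b0 ob]; rewrite mulf_neq0 // ordM // oa ob.
- move=> a ar; rewrite evXsubC; split=> //.
  have := vgeB tx0 (vge_cst x a); rewrite vgeE // => h.
  by apply/eqP; rewrite eq_le h andbT leNgt; apply/negP => h'; apply: nx; exists a.
Qed.

Lemma ord_finite_support u : finite_set [set x | ord x u != 0]%classic.
Proof.
have [->|u0] := eqVneq u 0.
  apply: (@sub_finite_set _ _ set0) => // x /=.
  by rewrite ord_zero eqxx.
apply: (@sub_finite_set _ _ ([set x | 0 < ord x u] `|` [set x | 0 < ord x u^-1])%classic).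
  by move=> x /=; rewrite ordV oppr_gt0 neq_lt => /orP[h|h]; [right|left].
by rewrite finite_setU; split; apply: finite_zeros; rewrite ?invr_eq0.
Qed.

End Valuations.

(** * Existence of points *)

Section Places.
Variables (R : realType) (X : curve R).
Local Notation F := (funfield X).
Local Notation C := R[i].
Implicit Types (u s z : F).

Definition const_subring (S : set F) : Prop :=
  [/\ forall c, S (cst X c), forall a b, S a -> S b -> S (a - b) &
      forall a b, S a -> S b -> S (a * b)].

Section SubringTheory.
Variable S : set F.
Hypothesis hS : const_subring S.

Lemma sr0 : S 0. Proof. by case: hS => h _ _; rewrite -(rmorph0 (cst X)). Qed.
Lemma sr1 : S 1. Proof. by case: hS => h _ _; rewrite -(rmorph1 (cst X)). Qed.
Lemma srB a b : S a -> S b -> S (a - b).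
Proof. by case: hS => _ h _; apply: h. Qed.
Lemma srM a b : S a -> S b -> S (a * b).
Proof. by case: hS => _ _ h; apply: h. Qed.
Lemma srN a : S a -> S (- a).
Proof. by move=> h; rewrite -sub0r; apply: srB => //; apply: sr0. Qed.
Lemma srD a b : S a -> S b -> S (a + b).
Proof. by move=> ha hb; rewrite -[b]opprK; apply: srB => //; apply: srN. Qed.
Lemma srX a k : S a -> S (a ^+ k).
Proof.
by move=> h; elim: k => [|k IH]; [apply: sr1 | rewrite exprS; apply: srM].
Qed.
Lemma sr_sum (I : Type) (r : seq I) (P : pred I) (G : I -> F) :
  (forall i, P i -> S (G i)) -> S (\sum_(i <- r | P i) G i).
Proof. by move=> h; apply: big_ind => //; [apply: sr0 | apply: srD]. Qed.
Lemma sr_ev s q : S s -> S (ev s q).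
Proof.
move=> hs; rewrite (evE s (leqnn _)); apply: sr_sum => i _.
by apply: srM; [case: hS | apply: srX].
Qed.

Definition adjoin z : set F :=
  [set w | exists p : {poly F}, (forall i, S p`_i) /\ w = p.[z]]%classic.

Lemma adjoin_subring z : const_subring (adjoin z).
Proof.
split=> [c|a b [p [hp ->]] [q [hq ->]]|a b [p [hp ->]] [q [hq ->]]].
- exists (cst X c)%:P; rewrite hornerC; split=> // i; rewrite coefC.
  by case: ifP => _; [case: hS | apply: sr0].
- exists (p - q); rewrite hornerD hornerN; split=> // i.
  by rewrite coefB; apply: srB.
- exists (p * q); rewrite hornerM; split=> // i; rewrite coefM.
  by apply: sr_sum => j _; apply: srM.
Qed.

Lemma sub_adjoin z w : S w -> adjoin z w.
Proof.
move=> hw; exists w%:P; rewrite hornerC; split=> // i; rewrite coefC.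
by case: ifP => _ //; apply: sr0.
Qed.

Lemma mem_adjoin z : adjoin z z.
Proof.
exists 'X; rewrite hornerX; split=> // i; rewrite coefX.
by case: eqP => _; [apply: sr1 | apply: sr0].
Qed.

(** An ideal that becomes the whole ring in both extensions contains 1 already.  By induction
on the degrees: after multiplication by [1 - s * b0], with [b0] the constant term of [r],
the leading term of [p] can be replaced by terms of lower degree by means of [r]. *)
Lemma chevalley s z m l (p r : {poly F}) : S s -> ~ S s^-1 -> z != 0 -> s != 0 ->
  (forall i, S p`_i) -> (forall i, S r`_i) ->
  (size p <= m)%N -> (size r <= l)%N -> s * p.[z] = 1 -> s * r.[z^-1] = 1 -> False.
Proof.
move=> Ss ns + s0; have [k] := ubnP (m + l); elim: k => // k IH in z m l p r *.
wlog lm : z m l p r / (l <= m)%N => [th|] hk z0 hp hr zp zr ep er.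
  case/orP: (leq_total l m) => lm; first exact: (th z m l p r).
  apply: (th z^-1 l m r p) => //; rewrite ?invrK ?invr_eq0 //.
  by rewrite addnC.
case: m lm hk zp => [|m] lm hk zp.
  move: zp; rewrite leqn0 size_poly_eq0 => /eqP p0.
  by move: ep; rewrite p0 horner0 mulr0 => /esym/eqP; rewrite oner_eq0.
case: l lm hk zr => [|l] lm hk zr.
  move: zr; rewrite leqn0 size_poly_eq0 => /eqP r0.
  by move: er; rewrite r0 horner0 mulr0 => /esym/eqP; rewrite oner_eq0.
pose b0 := r`_0; pose am := p`_m.
pose q := \poly_(k < m) r`_(m - k).
have eq_q : q.[z] = z ^+ m * (r.[z^-1] - b0).
  rewrite horner_poly (@horner_coef_wide _ m.+1 r) ?(leq_trans zr) //.
  rewrite big_ord_recl /= expr0 mulr1 addrAC subrr add0r mulr_sumr.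
  rewrite (reindex_inj rev_ord_inj) /=; apply: eq_bigr => i _.
  rewrite /bump /= add1n.
  have -> : (m - (m - i.+1) = i.+1)%N by have := ltn_ord i; lia.
  rewrite mulrCA; congr (_ * _).
  rewrite -[in z ^+ m](subnK (ltn_ord i)) exprD exprVn -mulrA.
  by rewrite mulfV ?mulr1 // expf_neq0.
case: (posnP m) => [m0|m0].
  apply: ns; suff -> : s^-1 = p`_0 by [].
  have zp1 : (size p <= 1)%N by rewrite -[1%N]/(0.+1)%N -m0.
  by apply: (mulfI s0); rewrite mulfV // -ep {1}(size1_polyC zp1) hornerC.
pose p' := (1 - s * b0)%:P * (p - am%:P * 'X^m) + (am * s)%:P * q + b0%:P.
have sp' : (size p' <= m)%N.
  have h1 : (size ((1 - s * b0)%:P * (p - am%:P * 'X^m))%R <= m)%N.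
    rewrite mul_polyC (leq_trans (size_scale_leq _ _)) //.
    apply/leq_sizeP => j hj; rewrite coefB mul_polyC coefZ coefXn.
    move: hj; rewrite leq_eqVlt => /orP[/eqP<-|hj]; first by rewrite eqxx mulr1 subrr.
    by rewrite gtn_eqF // mulr0 subr0 nth_default // (leq_trans zp).
  rewrite /p' (leq_trans (size_polyD _ _)) // geq_max (leq_trans (size_polyD _ _)) ?geq_max ?h1 /=.
    by rewrite (leq_trans (size_polyC_leq1 _)).
  by rewrite mul_polyC (leq_trans (size_scale_leq _ _)) // size_poly.
have Sb0 : S b0 by apply: hr.
have Sam : S am by apply: hp.
have cp' i : S p'`_i.
  have Sc c j : S c -> S (c%:P`_j) by move=> ?; rewrite coefC; case: ifP => _ //; apply: sr0.
  rewrite /p' coefD; apply: srD; last by apply: Sc; apply: hr.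
  rewrite coefD; apply: srD.
    rewrite coefCM; apply: srM.
      by apply: srB; [apply: sr1 | apply: srM].
    rewrite coefB coefCM coefXn; apply: srB => //; apply: srM => //.
    by case: eqP => _; [apply: sr1 | apply: sr0].
  rewrite coefCM coef_poly; apply: srM; first by apply: srM.
  by case: ifP => _ //; apply: sr0.
have e' : s * p'.[z] = 1.
  rewrite /p' !(hornerD, hornerN, hornerM, hornerC, hornerXn) eq_q.
  have -> : s * ((1 - s * b0) * (p.[z] - am * z ^+ m) +
            am * s * (z ^+ m * (r.[z^-1] - b0)) + b0) =
     (1 - s * b0) * (s * p.[z]) + am * s * z ^+ m * (s * r.[z^-1] - 1) + s * b0 by ring.
  by rewrite ep er; ring.
by apply: (IH z m l.+1 p' r) => //; lia.
Qed.
End SubringTheory.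

Lemma transcendental_not_cst u : transcendental u <-> forall c, u <> cst X c.
Proof.
split=> [tr c uc|nc q q0].
  by have := tr ('X - c%:P); rewrite polyXsubC_eq0 evXsubC uc subrr eqxx => /(_ isT).
have [r ->] := closed_field_poly_normal q.
rewrite -mul_polyC evM evC ev_prod mulf_neq0 ?fmorph_eq0 ?lead_coef_eq0 //.
rewrite prodf_seq_neq0; apply/allP => a _ /=; rewrite evXsubC subr_eq0.
exact/eqP.
Qed.

Definition valuation_ring (S : set F) : Prop :=
  const_subring S /\ forall z, z != 0 -> S z \/ S z^-1.

(** By the lemma of Zorn there is a subring that is maximal among those that avoid [u] and
contain [u^-1]; by that of Chevalley it contains [z] or [z^-1]. *)
Lemma exists_valuation_ring u : transcendental u ->
  exists S, [/\ valuation_ring S, S u^-1 & ~ S u].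
Proof.
move=> tr; have u0 : u != 0 by rewrite -(evX u) tr ?polyX_eq0.
pose good (S : set F) := [/\ const_subring S, S u^-1 & ~ S u].
have [S0 gS0] : exists S0, good S0.
  exists [set w | exists q, w = ev u^-1 q]%classic; split.
  - split=> [c|a b [p ->] [q ->]|a b [p ->] [q ->]].
    + by exists c%:P; rewrite evC.
    + by exists (p - q); rewrite evB.
    + by exists (p * q); rewrite evM.
  - by exists 'X; rewrite evX.
  move=> [q hq].
  have tr' : transcendental u^-1.
    apply/transcendental_not_cst => c e; move/transcendental_not_cst: tr => /(_ c^-1).
    by rewrite fmorphV -e invrK.
  have : ev u^-1 ('X * q - 1) = 0 by rewrite evB evM evX ev1 -hq mulVf // subrr.
  apply/eqP/tr'; apply/eqP => /(congr1 (fun p : {poly C} => p.[0])).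
  rewrite !hornerE; apply/eqP; by rewrite oppr_eq0 oner_eq0.
have [|S [PS maxS]] := @Zorn_bigcup F (fun S => S = set0 \/ good S).
  move=> G GP tot.
  have [[A GA gA]|nG] := pselect (exists2 A, G A & good A); last first.
    left; apply/seteqP; split=> // w [A GA Aw]; case: (GP A GA) => [e|gA].
      by rewrite e in Aw.
    by apply: nG; exists A.
  right; have mem2 a b : (\bigcup_(A in G) A)%classic a -> (\bigcup_(A in G) A)%classic b ->
      exists B, [/\ G B, good B, B a & B b].
    move=> [A1 GA1 ha] [A2 GA2 hb].
    have [l|l] := tot _ _ GA1 GA2.
      exists A2; split=> //; last by apply: l.
      by case: (GP _ GA2) => // e; rewrite e in hb.
    exists A1; split=> //; last by apply: l.
    by case: (GP _ GA1) => // e; rewrite e in ha.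
  case: (gA) => hA1 hA2 hA3; split.
  - split=> [c|a b ha hb|a b ha hb].
    + by exists A => //; case: hA1.
    + have [B [GB [[_ h _] _ _] Ba Bb]] := mem2 _ _ ha hb.
      by exists B => //; apply: h.
    + have [B [GB [[_ _ h] _ _] Ba Bb]] := mem2 _ _ ha hb.
      by exists B => //; apply: h.
  - by exists A.
  - by move=> h; have [B [GB [_ _ hn] Ba _]] := mem2 _ _ h h.
have gS : good S.
  case: PS => // e; case: (gS0) => _ hS0 _.
  exfalso; apply: (maxS S0); last by right.
  by rewrite e; split=> // /(_ _ hS0).
have [hS Su Sn] := gS; exists S; split=> //; split=> // z z0.
have escape y : ~ S y -> adjoin S y u.
  move=> Sy; apply: contrapT => nu; apply: (maxS (adjoin S y)).
    split; first by move=> w; apply: sub_adjoin.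
    by move=> h; apply: Sy; apply: h; apply: mem_adjoin.
  by right; split=> //; [apply: adjoin_subring | apply: sub_adjoin].
have [|nz] := pselect (S z); first by left.
have [|nz'] := pselect (S z^-1); first by right.
have [p [hp ep]] := escape _ nz; have [r [hr er]] := escape _ nz'.
exfalso; apply: (@chevalley S hS u^-1 z _ _ p r) => //.
- by rewrite invrK.
- by rewrite invr_eq0.
- by rewrite -ep mulVf.
- by rewrite -er mulVf.
Qed.

Section ValuationRing.
Variables (S : set F).
Hypothesis vS : valuation_ring S.
Let hS : const_subring S. Proof. by case: vS. Qed.
Let dich z : z != 0 -> S z \/ S z^-1. Proof. by case: vS => _; apply. Qed.

Definition vunit z := [/\ z != 0, S z & S z^-1].

Lemma vunitM a b : vunit a -> vunit b -> vunit (a * b).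
Proof.
move=> [a0 a1 a2] [b0 b1 b2]; split; first by rewrite mulf_neq0.
  exact: srM.
by rewrite invfM; apply: srM.
Qed.
Lemma vunitV a : vunit a -> vunit a^-1.
Proof. by move=> [a0 a1 a2]; split; rewrite ?invrK ?invr_eq0. Qed.
Lemma vunitX a k : vunit a -> vunit (a ^+ k).
Proof.
move=> [a0 a1 a2]; split; first by rewrite expf_neq0.
  exact: srX.
by rewrite -exprVn; apply: srX.
Qed.
Lemma vunitN a : vunit a -> vunit (- a).
Proof.
move=> [a0 a1 a2]; split; first by rewrite oppr_eq0.
  exact: srN.
by rewrite invrN; apply: srN.
Qed.
Lemma vunit_cst c : c != 0 -> vunit (cst X c).
Proof.
by move=> c0; split; rewrite ?fmorph_eq0 // -?fmorphV; case: hS.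
Qed.
Lemma vunit1 : vunit 1.
Proof. by rewrite -(rmorph1 (cst X)); apply: vunit_cst; rewrite oner_eq0. Qed.

(** The ring is local. *)
Lemma vunitD a b : vunit a -> S b -> ~ vunit b -> vunit (a + b).
Proof.
move=> ua Sb nb; have [a0 Sa Sa'] := ua.
have [->|b0] := eqVneq b 0; first by rewrite addr0.
have [s0|s0] := eqVneq (a + b) 0.
  exfalso; apply: nb; have -> : b = - a by apply/eqP; rewrite -addr_eq0 addrC s0.
  exact: vunitN.
split=> //; first exact: srD.
have [h|h] := dich s0; last by [].
have [//|h'] := pselect (S (a + b)^-1).
exfalso; apply: nb; split=> //.
have Sab : S (a^-1 * (a + b)) by apply: srM.
(* compare the non-units [a + b] and [b], whose difference is the unit [a] *)
have q0 : (a + b) / b != 0 by rewrite mulf_neq0 ?invr_eq0.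
have [k|k] := dich q0.
  suff -> : b^-1 = a^-1 * ((a + b) / b - 1) by apply: srM => //; apply: srB => //; apply: sr1.
  by field; rewrite a0 b0.
exfalso; apply: h'.
suff -> : (a + b)^-1 = a^-1 * (1 - (((a + b) / b)^-1)).
  by apply: srM => //; apply: srB => //; apply: sr1.
by field; rewrite a0 b0 s0.
Qed.

(** The analogue of [ord_sum_distinct] while the values are only known to lie in the ordered
group of functions modulo units. *)
Lemma dominant_term (I : eqType) (r : seq I) (G : I -> F) : r != [::] -> uniq r ->
  {in r, forall i, G i != 0} ->
  {in r &, forall i j, i != j -> ~ vunit (G i / G j)} ->
  exists2 i, i \in r & vunit ((\sum_(j <- r) G j) / G i).
Proof.
elim: r => // i [|j r] IH _ /andP[ni un] nz np.
  exists i; rewrite ?inE // big_seq1 divff ?nz ?inE //; exact: vunit1.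
have [||||k kr uk] := IH.
- by [].
- by [].
- by move=> l lr; apply: nz; rewrite inE lr orbT.
- by move=> l l' lr lr'; apply: np; rewrite inE ?lr ?lr' orbT.
have kr' : k \in i :: j :: r by rewrite inE kr orbT.
have ir : i \in i :: j :: r by rewrite inE eqxx.
have ik : i != k by apply: contraNneq ni => ->.
rewrite big_cons; set T := \sum_(_ <- _) _ in uk *.
have [Gi Gk] := (nz _ ir, nz _ kr').
have := dich (_ : G i / G k != 0); rewrite mulf_neq0 ?invr_eq0 // => /(_ isT)[h|h].
  exists k => //; rewrite mulrDl addrC; apply: vunitD => //; exact: np.
exists i => //; rewrite mulrDl divff //; apply: vunitD; first exact: vunit1.
  have -> : T / G i = (T / G k) * (G i / G k)^-1 by field; rewrite Gi Gk.
  by apply: srM => //; case: uk.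
move=> h'; apply: (np i k) => //.
have -> : G i / G k = (T / G i)^-1 * (T / G k).
  have T0 : T != 0 by case: h' => + _ _; apply: contraNneq => ->; rewrite mul0r.
  by field; rewrite Gi Gk T0.
by apply: vunitM => //; apply: vunitV.
Qed.

Section Discrete.
Variables (s : F) (n : nat).
Hypotheses (Ss : S s) (ns : ~ S s^-1) (s0 : s != 0) (hd : dep s n).

Lemma vunit_ev0 q : q.[0] != 0 -> vunit (ev s q).
Proof.
move=> q0; have : root (q - q.[0]%:P) 0 by rewrite /root !hornerE subrr.
case/factor_theorem => p /eqP; rewrite subr_eq addrC => /eqP ->.
rewrite evD evC evM subr0 evX; apply: vunitD; first exact: vunit_cst.
  by apply: srM => //; apply: sr_ev.
case=> p0 _; rewrite invfM => h; apply: ns.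
have e0 : ev s p != 0 by apply: contraNneq p0 => ->; rewrite mul0r.
by rewrite -(mulVKf e0 s^-1); apply: (srM hS) => //; apply: (sr_ev hS).
Qed.

Lemma vunit_ev q : q != 0 -> exists k : nat, vunit (ev s q / s ^+ k).
Proof.
have [m] := ubnP (size q); elim: m q => // m IH q hq q0.
have [r|r] := boolP (root q 0); last first.
  by exists 0%N; rewrite expr0 divr1; apply: vunit_ev0.
case/factor_theorem: r => p; rewrite subr0 => ep.
have p0 : p != 0 by apply: contraNneq q0 => e; rewrite ep e mul0r.
have [|k hk] := IH p _ p0; first by move: hq; rewrite ep size_mulX.
exists k.+1; rewrite ep evM evX exprS invfM.
by rewrite -mulrA [s * _]mulrA mulfV // mul1r.
Qed.

Lemma vunit_sz (k : int) : vunit (s ^ k) -> k = 0.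
Proof.
case: k => [[//|k]|k] [_ h1 h2]; exfalso; apply: ns.
  move: h2; rewrite -exprnP exprS invfM mulrC => h2.
  by rewrite -(mulVKf (expf_neq0 k s0) s^-1); apply: (srM hS) => //; apply: (srX hS).
move: h1; rewrite NegzE -exprnN exprS invfM mulrC => h1.
by rewrite -(mulVKf (expf_neq0 k s0) s^-1); apply: (srM hS) => //; apply: (srX hS).
Qed.

(** In a relation between the powers of [z] over [C[s]] two terms have the same value, so
that [z ^+ k] and a power of [s] have, with [k <= n]; the exponent [n`!] serves all [z]. *)
Lemma value_power z : z != 0 -> exists k : int, vunit (z ^+ n`! * s ^ k).
Proof.
move=> z0; have [q [[i qi] e]] := hd (fun i => z ^+ i).
pose r := [seq j <- enum 'I_n.+1 | q j != 0].
pose G (j : 'I_n.+1) := ev s (q j) * z ^+ j.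
have mr j : (j \in r) = (q j != 0) by rewrite mem_filter mem_enum andbT.
have Gu j : q j != 0 -> exists k : nat, vunit (ev s (q j) / s ^+ k) by move=> ?; apply: vunit_ev.
have ev0' j : q j != 0 -> ev s (q j) != 0.
  by move=> /Gu[k [+ _ _]]; apply: contraNneq => ->; rewrite mul0r.
have [j [l [[jl qj ql] u]]] : exists j l : 'I_n.+1, [/\ (j < l)%N, q j != 0 & q l != 0] /\ vunit (G j / G l).
  apply: contrapT => no.
  have [||||j jr] := @dominant_term _ r G.
  - by apply/eqP => r0; have := mr i; rewrite r0 qi.
  - by rewrite filter_uniq ?enum_uniq.
  - by move=> j; rewrite mr => qj; rewrite mulf_neq0 ?ev0' ?expf_neq0.
  - move=> j l; rewrite !mr => qj ql jl u; apply: no.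
    have [lt|lt] : (j < l)%N \/ (l < j)%N by apply/orP; rewrite -neq_ltn.
      by exists j, l.
    exists l, j; split=> //; rewrite -[_ / _]invrK invf_div; exact: vunitV.
  have -> : \sum_(j <- r) G j = 0.
    rewrite -[RHS]e big_filter big_enum_cond /= [RHS](bigID (fun j => q j != 0)) /=.
    rewrite [X in _ + X]big1 ?addr0 //.
    by move=> k; rewrite negbK => /eqP ->; rewrite ev0 mul0r.
  by rewrite mul0r => -[]; rewrite eqxx.
have [k hk] := Gu _ qj; have [k' hk'] := Gu _ ql.
pose m := (l - j)%N.
have um : vunit (z ^+ m * s ^ (k'%:Z - k%:Z)).
  have -> : z ^+ m * s ^ (k'%:Z - k%:Z) =
    (G j / G l)^-1 * (ev s (q j) / s ^+ k) * (ev s (q l) / s ^+ k')^-1.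
    rewrite /G expfzDr // -exprnN -exprnP /m expfB //.
    by field; rewrite !expf_neq0 ?ev0'.
  by apply: vunitM; [apply: vunitM => //; apply: vunitV | apply: vunitV].
have /dvdnP[d hd'] : (m %| n`!)%N by apply: dvdn_fact; rewrite /m; have := ltn_ord l; lia.
exists ((k'%:Z - k%:Z) * d%:Z).
have -> : z ^+ n`! * s ^ ((k'%:Z - k%:Z) * d%:Z) = (z ^+ m * s ^ (k'%:Z - k%:Z)) ^+ d.
  by rewrite exprMn -exprM mulnC -hd' exprnP -exprz_exp.
exact: vunitX.
Qed.

(** By [value_power] the value group is embedded into the integers by
[w z = k] if [z ^+ n`!] has the value of [s ^ k]; it is non-trivial, hence infinite cyclic. *)
Lemma valuation_point u : S u^-1 -> ~ S u -> exists x, ord x u < 0.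
Proof.
move=> Su Snu; pose N := n`!.
have N0 : (0 < N)%N by apply: fact_gt0.
have /choice[w hw] z : exists k : int, z != 0 -> vunit (z ^+ N / s ^ k).
  have [->|z0] := eqVneq z 0; first by exists 0.
  by have [k hk] := value_power z0; exists (- k); rewrite invr_expz opprK.
have uniq_w z k : z != 0 -> vunit (z ^+ N / s ^ k) -> w z = k.
  move=> z0 hk; have h := vunitM (hw z z0) (vunitV hk).
  apply/eqP; rewrite -subr_eq0 -oppr_eq0; apply/eqP; apply: vunit_sz.
  suff -> : s ^ (- (w z - k)) = z ^+ N / s ^ w z / (z ^+ N / s ^ k) by [].
  rewrite opprB expfzDr // -invr_expz; have := expfz_neq0 k s0; have := expfz_neq0 (w z) s0.
  by move=> a b; field; rewrite a b expf_neq0.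
have wM a b : a != 0 -> b != 0 -> w (a * b) = w a + w b.
  move=> a0 b0; apply: uniq_w; first by rewrite mulf_neq0.
  have -> : (a * b) ^+ N / s ^ (w a + w b) = (a ^+ N / s ^ w a) * (b ^+ N / s ^ w b).
    by rewrite exprMn expfzDr // invfM mulrACA.
  exact: vunitM (hw _ a0) (hw _ b0).
have wpos z : z != 0 -> S z -> 0 <= w z.
  move=> z0 Sz; rewrite leNgt; apply/negP => wz; apply: ns.
  have Ssw : S (s ^ w z).
    have [h0 _ h] := vunitV (hw z z0).
    have -> : s ^ w z = (z ^+ N / s ^ w z)^-1 * z ^+ N.
      by have a := expfz_neq0 (w z) s0; field; rewrite a expf_neq0.
    by apply: (srM hS); [case: (vunitV (hw z z0)) | apply: (srX hS)].
  have -> : s^-1 = s ^ w z * s ^+ `|(w z + 1)%R|%N.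
    rewrite exprnP -expfzDr // -exprN1; congr (_ ^ _); lia.
  by apply: (srM hS) => //; apply: (srX hS).
have wnn z : z != 0 -> 0 <= w z -> S z.
  move=> z0 wz; have [//|Sz'] := dich z0.
  have [_ h _] := hw z z0.
  have SzN : S (z ^+ N).
    have -> : z ^+ N = z ^+ N / s ^ w z * s ^+ `|w z|%N.
      by rewrite [s ^+ _]exprnP gez0_abs // divfK // expfz_neq0.
    by apply: (srM hS) => //; apply: (srX hS).
  have -> : z = z ^+ N * z^-1 ^+ N.-1.
    by rewrite -[in X in X * _](prednK N0) exprS exprVn mulfK // expf_neq0.
  by apply: (srM hS) => //; apply: (srX hS).
have w1 : w 1 = 0 by have := wM 1 1 (oner_neq0 _) (oner_neq0 _); rewrite mulr1; lia.
have wV a : a != 0 -> w a^-1 = - w a.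
  by move=> a0; have := wM a a^-1 a0; rewrite invr_eq0 divff // w1 => /(_ a0); lia.
have wD a b : a != 0 -> b != 0 -> a + b != 0 -> w a <= w b -> w a <= w (a + b).
  move=> a0 b0 ab0 le.
  have d0 : 1 + b / a != 0.
    by apply: contraNneq ab0 => e; rewrite -(mulr0 a) -e; apply/eqP; field.
  have -> : a + b = a * (1 + b / a) by field.
  rewrite wM // lerDl; apply: wpos => //; apply: (srD hS); first exact: (sr1 hS).
  by apply: wnn; rewrite ?mulf_neq0 ?invr_eq0 // wM ?invr_eq0 // wV //; lia.
have ws : w s = N%:Z.
  apply: uniq_w => //; rewrite -exprnP divff ?expf_neq0 //; exact: vunit1.
(* the least positive value generates the value group *)
have exP : exists m : nat, [exists b : bool, `[< exists2 z, z != 0 & w z = m.+1 >]].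
  by exists N.-1; apply/existsP; exists true; apply/asboolP; exists s; rewrite ?prednK.
case: (ex_minnP exP) => m /existsP[_ /asboolP[z1 z10 wz1]] mmin.
pose d : int := m.+1.
have wXn z (k : nat) : z != 0 -> w (z ^+ k) = w z * k%:Z.
  move=> z0; elim: k => [|k IH]; first by rewrite expr0 w1 mulr0.
  by rewrite exprS wM ?expf_neq0 // IH; lia.
have wX z (k : int) : z != 0 -> w (z ^ k) = w z * k.
  move=> z0; case: k => k; rewrite ?NegzE; last first.
    by rewrite -exprnN wV ?expf_neq0 // wXn //; lia.
  by rewrite -exprnP wXn.
have dvd z : z != 0 -> (d %| w z)%Z.
  move=> z0; apply/dvdz_mod0P; apply/eqP; rewrite eq_le modz_ge0 // andbT leNgt.
  apply/negP => h.
  pose z2 := z / z1 ^ (w z %/ d)%Z.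
  have z20 : z2 != 0 by rewrite mulf_neq0 ?invr_eq0 ?expfz_neq0.
  have wz2 : w z2 = (w z %% d)%Z.
    rewrite wM ?invr_eq0 ?expfz_neq0 // wV ?expfz_neq0 // wX // wz1 -/d.
    by have := divz_eq (w z) d; lia.
  have lt : (w z %% d < d)%Z by rewrite ltz_pmod.
  have : (m <= `|(w z %% d)%Z|.-1)%N.
    apply: mmin; apply/existsP; exists true; apply/asboolP; exists z2 => //.
    by rewrite wz2 prednK ?gez0_abs ?ltW // absz_gt0 gt_eqF.
  by move: h lt; rewrite /d; lia.
pose o z : int := if z == 0 then 0 else (w z %/ d)%Z.
have oE z : z != 0 -> w z = o z * d.
  by move=> z0; rewrite /o (negbTE z0) divzK // dvd.
have dpos : 0 < d by [].
have o0 : o 0 = 0 by rewrite /o eqxx.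
have oM a b : a != 0 -> b != 0 -> o (a * b) = o a + o b.
  move=> a0 b0; have := wM a b a0 b0; rewrite !oE ?mulf_neq0 // -mulrDl.
  by move/(mulIf _); apply.
have oD a b : a + b != 0 -> Num.min (o a) (o b) <= o (a + b).
  move=> ab0; have [a0|a0] := eqVneq a 0; first by rewrite a0 add0r ge_min lexx orbT.
  have [b0|b0] := eqVneq b 0; first by rewrite b0 addr0 ge_min lexx.
  have [le|le] := leP (w a) (w b).
    by have := wD _ _ a0 b0 ab0 le; rewrite !oE // ler_pM2r // => h; rewrite ge_min h.
  rewrite addrC in ab0 *; have := wD _ _ b0 a0 ab0 (ltW le).
  by rewrite !oE // ler_pM2r // => h; rewrite ge_min h orbT.
have oC c : o (cst X c) = 0.
  have [->|c0] := eqVneq c 0; first by rewrite rmorph0.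
  have [k0 k1 k2] := vunit_cst c0.
  have := wpos _ k0 k1; have := wpos _ _ k2; rewrite invr_eq0 wV // => /(_ k0) h1 h2.
  have : w (cst X c) = 0 by lia.
  by rewrite oE // => /eqP; rewrite mulf_eq0 orbF => /eqP.
have o1 : exists t, o t = 1.
  have d0 : d != 0 by [].
  by exists z1; apply: (mulIf d0); rewrite -oE // wz1 mul1r.
exists (@ClosedPoint R X o o0 oM oD oC o1) => /=.
have u0 : u != 0 by apply/eqP => u0; apply: Snu; rewrite u0; apply: (sr0 hS).
rewrite -(pmulr_llt0 _ dpos) -oE // ltNge; apply/negP => h; apply: Snu; exact: wnn.
Qed.

End Discrete.
End ValuationRing.

(** A valuation ring that avoids [u] is the local ring of a pole of [u], because over it the
function field has finite degree over [C(s)] for some non-unit [s]. *)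
Theorem exists_pole u : (forall c, u <> cst X c) -> exists x : closed_point X, ord x u < 0.
Proof.
move=> /transcendental_not_cst tr.
have u0 : u != 0 by rewrite -(evX u) tr ?polyX_eq0.
have [S [vS Su nSu]] := exists_valuation_ring tr.
have [hS dich] := vS.
have [t [n [trt hd]]] := function_field_dep X.
have t0 : t != 0 by rewrite -(evX t) trt ?polyX_eq0.
have ta a : t - cst X a != 0 by rewrite -evXsubC trt // polyXsubC_eq0.
suff [s [Ss ns s0 hs]] : exists s, [/\ S s, ~ S s^-1, s != 0 & dep s n].
  exact: (valuation_point vS Ss ns s0 hs).
have [St|nSt] := pselect (S t); last first.
  exists t^-1; rewrite invrK invr_eq0; split=> //; last exact: dep_inv.
  by have [|] := dich _ t0.
(* otherwise the ring contains [C(t)], over which [u] is integral *)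
apply: contrapT => no.
have Sta a : S (t - cst X a) by apply: (srB hS) => //; case: hS.
have uta a : vunit S (t - cst X a).
  split=> //; apply: contrapT => ns; apply: no; exists (t - cst X a); split=> //.
  exact: dep_shift.
have uev q : q != 0 -> vunit S (ev t q).
  move=> q0; have [r ->] := closed_field_poly_normal q.
  rewrite -mul_polyC evM evC ev_prod; apply: (vunitM vS).
    by apply: (vunit_cst vS); rewrite lead_coef_eq0.
  by apply: big_ind => [||a _]; [exact: (vunit1 vS) | exact: (vunitM vS) | rewrite evXsubC].
have [q [[i qi] e]] := hd (fun i => u ^+ i).
case: (@arg_maxnP _ i (fun k => q k != 0) (fun k => k) qi) => j qj jmax.
have [e0 Se Se'] := uev _ qj.
have ej : ev t (q j) * u ^+ j = - \sum_(k | k != j) ev t (q k) * u ^+ k.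
  by move/eqP: e; rewrite (bigD1 j) //= addr_eq0 => /eqP.
have j0 : (0 < j)%N.
  rewrite lt0n; apply/eqP => j0; move: ej; rewrite j0 expr0 mulr1 big1 ?oppr0; last first.
    move=> k kj; have [->|qk] := eqVneq (q k) 0; first by rewrite ev0 mul0r.
    have : (k <= j)%N := jmax _ qk; rewrite j0 leqn0 => /eqP k0; case/eqP: kj; by apply: ord_inj; rewrite k0 j0.
  by move/eqP; rewrite (negbTE e0).
apply: nSu.
have -> : u = (ev t (q j))^-1 * (ev t (q j) * u ^+ j * u^-1 ^+ j.-1).
  rewrite -[in u ^+ j](prednK j0) exprS exprVn.
  by have := expf_neq0 j.-1 u0 => h; field; rewrite h e0.
rewrite ej; apply: (srM hS) => //; rewrite mulNr; apply: (srN hS).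
rewrite mulr_suml; apply: (sr_sum hS) => k kj.
have [->|qk] := eqVneq (q k) 0; first by rewrite ev0 !mul0r; exact: (sr0 hS).
have lt : (k <= j.-1)%N.
  by rewrite -ltnS prednK // ltn_neqAle [X in _ && X](jmax _ qk) andbT.
have -> : ev t (q k) * u ^+ k * u^-1 ^+ j.-1 = ev t (q k) * u^-1 ^+ (j.-1 - k).
  rewrite -mulrA; congr (_ * _).
  by rewrite -[in u^-1 ^+ j.-1](subnKC lt) exprD exprVn mulVKf // expf_neq0.
by apply: (srM hS); [case: (uev _ qk) | apply: (srX hS)].
Qed.

End Places.

(** * Divisors *)

Section Divisors.
Variables (R : realType) (X : curve R).
Local Notation F := (funfield X).
Local Notation C := R[i].
Local Notation point := (closed_point X).
Local Notation divisor := (point -> int).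
Implicit Types (D E : divisor) (u : F).

Definition fin D := finite_set [set x | D x != 0]%classic.

Definition deg D : int := (\sum_(x \in [set: point]%classic) D x)%R.

Definition pts (s : seq point) : divisor := fun x => (count_mem x s)%:Z.

Lemma finP D : fin D <-> exists s, uniq s /\ forall x, x \notin s -> D x = 0.
Proof.
split=> [/finite_seqP[s hs]|[s [us hs]]].
  exists (undup s); split=> [|x]; first exact: undup_uniq.
  rewrite mem_undup => xs; apply/eqP; apply: contraNT xs => Dx.
  by have : [set x | D x != 0]%classic x by []; rewrite hs.
apply: (@sub_finite_set _ _ [set` s]); last exact: finite_seq.
by move=> x /=; apply: contraNT => /hs ->.
Qed.

Lemma fin_seq2 D E : fin D -> fin E -> exists s, uniq s /\
  forall x, x \notin s -> D x = 0 /\ E x = 0.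
Proof.
move=> /finP[s [_ hs]] /finP[r [_ hr]]; exists (undup (s ++ r)).
rewrite undup_uniq; split=> // x; rewrite mem_undup mem_cat negb_or => /andP[a b].
by rewrite hs // hr.
Qed.

Lemma deg_seq D (s : seq point) : uniq s -> (forall x, x \notin s -> D x = 0) ->
  deg D = \sum_(x <- s) D x.
Proof.
move=> us hs; rewrite /deg (fsbigE s) //; last by move=> i _; apply: hs.
by apply: eq_bigl => x; rewrite in_setT.
Qed.

Lemma finD D E : fin D -> fin E -> fin (fun x => D x + E x).
Proof.
move=> fD fE; have [s [us hs]] := fin_seq2 fD fE.
by apply/finP; exists s; split=> // x /hs[-> ->].
Qed.

Lemma finN D : fin D -> fin (fun x => - D x).
Proof. by move=> /finP[s [us hs]]; apply/finP; exists s; split=> // x /hs ->. Qed.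

Lemma finB D E : fin D -> fin E -> fin (fun x => D x - E x).
Proof. by move=> fD fE; apply: finD => //; apply: finN. Qed.

Lemma finMn D (k : int) : fin D -> fin (fun x => k * D x).
Proof.
by move=> /finP[s [us hs]]; apply/finP; exists s; split=> // x /hs ->; rewrite mulr0.
Qed.

Lemma fin_pts (s : seq point) : fin (pts s).
Proof.
apply/finP; exists (undup s); rewrite undup_uniq; split=> // x.
by rewrite mem_undup /pts => /count_memPn ->.
Qed.

Lemma fin_ord u : fin (fun x => ord x u).
Proof. exact: (ord_finite_support u). Qed.

Lemma degD D E : fin D -> fin E -> deg (fun x => D x + E x) = deg D + deg E.
Proof.
move=> fD fE; have [s [us hs]] := fin_seq2 fD fE.
rewrite !(deg_seq us) ?big_split // => x /hs[] //; by move=> -> ->.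
Qed.

Lemma degN D : fin D -> deg (fun x => - D x) = - deg D.
Proof.
move=> /finP[s [us hs]]; rewrite !(deg_seq us) ?sumrN // => x /hs -> //.
Qed.

Lemma degB D E : fin D -> fin E -> deg (fun x => D x - E x) = deg D - deg E.
Proof. by move=> fD fE; rewrite degD ?degN //; apply: finN. Qed.

Lemma degM D k : fin D -> deg (fun x => k * D x) = k * deg D.
Proof.
by move=> /finP[s [us hs]]; rewrite !(deg_seq us) ?mulr_sumr // => x /hs -> //; rewrite mulr0.
Qed.

Lemma deg0 : deg (fun=> 0) = 0.
Proof. by rewrite (@deg_seq _ [::]) ?big_nil. Qed.

Lemma deg_ge0 D : (forall x, 0 <= D x) -> 0 <= deg D.
Proof. by move=> h; apply: fsumr_ge0. Qed.

Lemma deg_le D E : fin D -> fin E -> (forall x, D x <= E x) -> deg D <= deg E.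
Proof.
move=> fD fE h; rewrite -subr_ge0 -degB //; apply: deg_ge0 => x.
by rewrite subr_ge0.
Qed.

Lemma pts_cons y (s : seq point) x : pts (y :: s) x = pts s x + pts [:: y] x.
Proof. by rewrite /pts /= addn0 PoszD addrC. Qed.

Lemma pts1 y x : pts [:: y] x = (y == x)%:Z.
Proof. by rewrite /pts /= addn0. Qed.

Lemma deg_pts (s : seq point) : deg (pts s) = (size s)%:Z.
Proof.
elim: s => [|y s IH].
  by rewrite -[RHS]deg0; congr deg; apply/funext.
have -> : pts (y :: s) = (fun x => pts s x + pts [:: y] x).
  by apply/funext => x; rewrite pts_cons.
rewrite degD; try exact: fin_pts.
rewrite IH (@deg_seq _ [:: y]) // ?big_seq1 ?pts1 ?eqxx /=; first by lia.
by move=> x; rewrite inE pts1 eq_sym => /negbTE ->.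
Qed.

Lemma effective_pts D : fin D -> (forall x, 0 <= D x) -> exists s, D = pts s.
Proof.
move=> /finP[r [ur hr]] D0.
exists (flatten [seq nseq `|D y|%N y | y <- r]); apply/funext => x.
rewrite /pts count_flatten -map_comp sumnE big_map.
rewrite (eq_bigr (fun y => ((y == x) * `|D y|)%N)); last first.
  by move=> y _ /=; rewrite count_nseq /=.
have [xr|xr] := boolP (x \in r).
  rewrite (bigD1_seq x) //= eqxx mul1n big1 ?addn0 ?gez0_abs //.
  by move=> y /negbTE ->.
rewrite hr // big_seq big1 // => y yr.
by case: eqP => // e; rewrite -e yr in xr.
Qed.

Lemma le_pts D E : fin D -> fin E -> (forall x, D x <= E x) ->
  exists s, E = (fun x => D x + pts s x).
Proof.
move=> fD fE h; have [|s hs] := effective_pts (finB fE fD).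
  by move=> x; rewrite subr_ge0.
by exists s; apply/funext => x; rewrite -hs addrC subrK.
Qed.

(** * Finite-dimensional spaces of functions *)

Definition free (I : finType) (e : I -> F) := forall c : I -> C,
  \sum_i cst X (c i) * e i = 0 -> forall i, c i = 0.

(** A relation rather than a function, because a space need not have finite dimension. *)
Definition dim (V : F -> Prop) (n : nat) := exists e : 'I_n -> F, free e /\
  forall f, V f <-> exists c : 'I_n -> C, f = \sum_i cst X (c i) * e i.

Lemma free_size (V : F -> Prop) (n : nat) (I : finType) (e : I -> F) :
  dim V n -> free e -> (forall i, V (e i)) -> (#|I| <= n)%N.
Proof.
move=> [b [_ hb]] fe Ve; rewrite leqNgt; apply/negP => lt.
have /choice[M hM] i := (hb (e i)).1 (Ve i).
pose A : 'M[C]_(#|I|, n) := \matrix_(i, j) M (enum_val i) j.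
have : \rank (kermx A) != 0%N.
  by rewrite mxrank_ker -lt0n subn_gt0 (leq_ltn_trans (rank_leq_col A)).
rewrite mxrank_eq0 => /rowV0Pn[v /sub_kermxP vA v0].
case/negP: v0; apply/eqP/rowP => i; rewrite mxE.
have := fe (fun j => v 0 (enum_rank j)) _ (enum_val i); rewrite enum_valK; apply.
rewrite (reindex (@enum_val I predT)) /=; last first.
  by exists enum_rank => ? _; rewrite ?enum_valK ?enum_rankK.
under eq_bigr => j _ do rewrite enum_valK hM mulr_sumr.
rewrite exchange_big big1 //= => k _.
have := congr1 (fun N : 'rV_n => cst X (N 0 k) * b k) vA.
rewrite !mxE rmorph0 mul0r => e0; rewrite -[RHS]e0.
rewrite rmorph_sum mulr_suml; apply: eq_bigr => j _.
by rewrite mxE rmorphM mulrA.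
Qed.

Lemma dim_le (V W : F -> Prop) m n : dim V m -> dim W n ->
  (forall s, V s -> W s) -> (m <= n)%N.
Proof.
move=> [e [fe he]] hW VW; rewrite -[m]card_ord; apply: (free_size hW fe) => i.
apply/VW/he; exists (fun j => (j == i)%:R).
rewrite (bigD1 i) //= eqxx rmorph1 mul1r big1 ?addr0 // => j /negbTE ->.
by rewrite rmorph0 mul0r.
Qed.

Lemma dim_ext (V W : F -> Prop) n : (forall s, V s <-> W s) -> dim V n -> dim W n.
Proof.
by move=> VW [e [fe he]]; exists e; split=> // s; split=> [/VW/he|/he/VW].
Qed.

Lemma dim_uniq (V : F -> Prop) m n : dim V m -> dim V n -> m = n.
Proof.
by move=> hm hn; apply/eqP; rewrite eqn_leq (dim_le hm hn) ?(dim_le hn hm).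
Qed.

Lemma dim0 (V : F -> Prop) : (forall s, V s <-> s = 0) -> dim V 0.
Proof.
move=> h; exists (fun=> 0); split=> [c _ []//|s]; split=> [/h->|[c ->]].
  by exists (fun=> 0); rewrite big_ord0.
by apply/h; rewrite big_ord0.
Qed.

Lemma dim_gt0 (V : F -> Prop) n : dim V n -> (0 < n)%N -> exists2 f, V f & f != 0.
Proof.
case: n => // n [e [fe he]] _; exists (e ord0).
  apply/he; exists (fun j => (j == ord0)%:R).
  rewrite (bigD1 ord0) //= rmorph1 mul1r big1 ?addr0 // => j /negbTE ->.
  by rewrite rmorph0 mul0r.
apply/eqP => e0; have := fe (fun j => (j == ord0)%:R) _ ord0 => /=.
rewrite big1 => [/(_ erefl)/eqP|j _]; first by rewrite oner_eq0.
by case: eqP => [->|_]; rewrite ?e0 ?mulr0 // rmorph0 mul0r.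
Qed.

Lemma dim_scale (V : F -> Prop) n u : u != 0 -> dim V n ->
  dim (fun s => V (s / u)) n.
Proof.
move=> u0 [e [fe he]]; exists (fun i => e i * u); split.
  move=> c hc; apply: fe; apply: (mulIf u0); rewrite mul0r mulr_suml -[RHS]hc.
  by apply: eq_bigr => i _; rewrite mulrA.
move=> s; split=> [/he[c hc]|[c ->]].
  exists c; rewrite -(divfK u0 s) hc mulr_suml.
  by apply: eq_bigr => i _; rewrite mulrA.
apply/he; exists c; rewrite mulr_suml; apply: eq_bigr => i _.
by rewrite -mulrA mulfK.
Qed.

Definition subspace (V : F -> Prop) :=
  (forall f h, V f -> V h -> V (f + h)) /\ forall c f, V f -> V (cst X c * f).

(** The leading coefficient at [y] embeds the quotient of the functions with
order at least [m] by those with order at least [m + 1] into the constants. *)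
Lemma dim_step (V W : F -> Prop) y m n : subspace W ->
  (forall s, W s -> vge y m s) -> (forall s, V s <-> W s /\ vge y (m + 1) s) ->
  dim V n -> (exists f, W f /\ ~ V f) -> dim W n.+1.
Proof.
move=> [WD WZ] Wm VW [e [fe he]] [f [Wf nVf]].
have f0 : f != 0.
  by apply/eqP => f0; apply: nVf; apply/VW; rewrite f0 vge0 -f0.
have of_ : ord y f = m.
  have := Wm _ Wf; have : ~~ vge y (m + 1) f by apply/negP => h; apply: nVf; apply/VW.
  by rewrite !vgeE //; lia.
pose e' (i : 'I_n.+1) := if unlift ord_max i is Some j then e j else f.
have eS c : \sum_i cst X (c i) * e' i =
    \sum_(i < n) cst X (c (lift ord_max i)) * e i + cst X (c ord_max) * f.
  rewrite big_ord_recr /=; congr (_ + _); last by rewrite /e' unlift_none.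
  apply: eq_bigr => i _.
  have -> : widen_ord (leqnSn n) i = lift ord_max i.
    by apply: ord_inj; rewrite /= /bump leqNgt ltn_ord.
  by rewrite /e' liftK.
have V_e c : V (\sum_(i < n) cst X (c i) * e i) by apply/he; exists c.
have nVcf c : c != 0 -> ~ V (cst X c * f).
  move=> c0 /VW[_]; rewrite vgeE ?mulf_neq0 ?fmorph_eq0 // ordM ?fmorph_eq0 //.
  by rewrite ord_cst of_; lia.
exists e'; split.
  move=> c; rewrite eS => h.
  have cm : c ord_max = 0.
    apply: contrapT => /eqP cm; apply: (@nVcf (- c ord_max)); first by rewrite oppr_eq0.
    have -> : cst X (- c ord_max) * f =
        \sum_(i < n) cst X (c (lift ord_max i)) * e i.
      by rewrite rmorphN mulNr; apply/esym/eqP; rewrite -addr_eq0 h.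
    exact: V_e.
  move=> i; case: (unliftP ord_max i) => [j ->|->//].
  apply: (fe (fun j => c (lift ord_max j))).
  by move: h; rewrite cm rmorph0 mul0r addr0.
move=> s; split=> [Ws|[c ->]]; last first.
  by rewrite eS; apply: WD; [have /VW[] := V_e (fun i => c (lift ord_max i)) | apply: WZ].
have : vge y 0 (s / f) by rewrite -vge_div // add0r of_ Wm.
case/residue => a ha.
have Vr : V (s - cst X a * f).
  apply/VW; split; first by rewrite -mulNr -rmorphN; apply: WD => //; apply: WZ.
  by rewrite -(divfK f0 s) -mulrBl addrC -of_ vgeMl.
have [c hc] := (he _).1 Vr.
exists (fun i => if unlift ord_max i is Some j then c j else a).
rewrite eS unlift_none; under eq_bigr => i _ do rewrite liftK.
by rewrite -hc subrK.
Qed.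

(** * Riemann-Roch spaces *)

(** The Riemann-Roch space of [D]. *)
Definition L D (f : F) := forall x, vge x (- D x) f.

Lemma L_subspace D : subspace (L D).
Proof.
by split=> [f h hf hh x|c f hf x]; [apply: vgeD | apply: vgeZ].
Qed.

Lemma L_sub D E f : (forall x, D x <= E x) -> L D f -> L E f.
Proof. by move=> h Df x; apply: vgeW (Df x); rewrite lerN2. Qed.

Lemma L_addpt D y f : L D f <-> L (fun x => D x + pts [:: y] x) f /\ vge y (- D y) f.
Proof.
split=> [h|[h hy] x].
  by split=> //; apply: L_sub h => x; rewrite lerDl.
have [<-|yx] := eqVneq y x; first by [].
by have := h x; rewrite pts1 (negbTE yx) addr0.
Qed.

Lemma dim_addpt D y n : dim (L D) n ->
  dim (L (fun x => D x + pts [:: y] x)) n \/ dim (L (fun x => D x + pts [:: y] x)) n.+1.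
Proof.
move=> hn; have [h|h] := pselect (exists f, L (fun x => D x + pts [:: y] x) f /\ ~ L D f).
  right; apply: (@dim_step (L D) _ y (- (D y + 1)) _ _ _ _ hn h).
  - exact: L_subspace.
  - by move=> s /(_ y); rewrite pts1 eqxx.
  - by move=> s; rewrite opprD subrK; exact: L_addpt.
left; apply: dim_ext hn => s; split=> hs; first by case: ((L_addpt D y s).1 hs).
by apply: contrapT => nh; apply: h; exists s.
Qed.

Lemma dim_pts D n s : dim (L D) n ->
  exists m, dim (L (fun x => D x + pts s x)) m /\ (n <= m <= n + size s)%N.
Proof.
move=> hn; elim: s => [|y s [m [hm /andP[nm mn]]]].
  exists n; rewrite addn0 leqnn; split=> //.
  have -> : (fun x => D x + pts [::] x) = D by apply/funext => x; rewrite /pts addr0.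
  by [].
have -> : (fun x => D x + pts (y :: s) x) = (fun x => D x + pts s x + pts [:: y] x).
  by apply/funext => x; rewrite pts_cons addrA.
have [h|h] := dim_addpt y hm; [exists m | exists m.+1]; split=> //=; lia.
Qed.

Lemma L0_cst f : (forall x, vge x 0 f) -> exists c, f = cst X c.
Proof.
move=> h; apply: contrapT => nc.
have [|x hx] := @exists_pole _ _ f; first by move=> c e; apply: nc; exists c.
have f0 : f != 0 by apply: contraTneq hx => ->; rewrite ord_zero.
by have := h x; rewrite vgeE //; lia.
Qed.

Lemma exists_point : exists x : point, True.
Proof.
have [t [n [tr _]]] := function_field_dep X.
by move/transcendental_not_cst: tr => /exists_pole[x _]; exists x.
Qed.

Lemma dim_neg x0 D : (forall x, D x <= 0) -> D x0 < 0 -> dim (L D) 0.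
Proof.
move=> Dn D0; apply: dim0 => f; split=> [h|-> x]; last exact: vge0.
have [|c hc] := @L0_cst f; first by move=> x; apply: vgeW (h x); rewrite oppr_ge0.
have := h x0; rewrite hc; have [->|c0] := eqVneq c 0; first by rewrite rmorph0.
by rewrite vgeE ?fmorph_eq0 // ord_cst; lia.
Qed.

(** Start from a divisor without functions and add points one at a time. *)
Lemma dim_exists D : fin D -> exists n, dim (L D) n.
Proof.
move=> fD; have [x0 _] := exists_point.
pose E x := Num.min (D x) 0 - pts [:: x0] x.
have fE : fin E.
  apply: finB; last exact: fin_pts.
  by move/finP: fD => [s [us hs]]; apply/finP; exists s; split=> // x /hs ->; rewrite minxx.
have E0 x : E x <= 0 by rewrite /E pts1 subr_le0; case: leP; lia.
have hE : dim (L E) 0.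
  by apply: (@dim_neg x0) => //; rewrite /E pts1 eqxx; case: leP; lia.
have [|s ->] := le_pts fE fD.
  by move=> x; rewrite /E pts1; case: leP; lia.
by have [m [hm _]] := dim_pts s hE; exists m.
Qed.

Definition ell D : nat := xget 0%N [set n | dim (L D) n]%classic.

Lemma ellP D : fin D -> dim (L D) (ell D).
Proof. by move=> /dim_exists[n hn]; rewrite /ell; case: xgetP => [m -> //|/(_ n)]. Qed.

Lemma ellE D n : dim (L D) n -> ell D = n.
Proof.
move=> hn; rewrite /ell; case: xgetP => [m _ hm|/(_ n)//].
exact: dim_uniq hm hn.
Qed.

Lemma ell_pts D s : fin D ->
  (ell D <= ell (fun x => (D x + pts s x)%R) <= ell D + size s)%N.
Proof.
by move=> fD; have [m [hm b]] := dim_pts s (ellP fD); rewrite (ellE hm).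
Qed.

(** Adding a point increases the dimension by at most one. *)
Lemma ell_mono D E : fin D -> fin E -> (forall x, D x <= E x) ->
  deg D - (ell D)%:Z <= deg E - (ell E)%:Z.
Proof.
move=> fD fE h; have [s ->] := le_pts fD fE h.
have := ell_pts s fD; rewrite degD ?deg_pts //; last exact: fin_pts.
lia.
Qed.

Lemma ell_effective D : fin D -> (forall x, 0 <= D x) -> (ell D)%:Z <= deg D + 1.
Proof.
move=> fD D0; have [x0 _] := exists_point.
pose E x := - pts [:: x0] x.
have fE : fin E by apply: finN; exact: fin_pts.
have hE : ell E = 0%N.
  by apply: ellE; apply: (@dim_neg x0) => [x|]; rewrite /E pts1 ?eqxx //; lia.
have := @ell_mono E D fE fD; rewrite hE degN; last exact: fin_pts.
rewrite deg_pts => /(_ _); have h x : E x <= D x by rewrite /E pts1; have := D0 x; lia.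
by move=> /(_ h) /=; lia.
Qed.

Lemma ell_principal D u : u != 0 -> fin D -> ell (fun x => D x + ord x u) = ell D.
Proof.
move=> u0 fD; apply: ellE; apply: dim_ext (dim_scale (invr_neq0 u0) (ellP fD)) => s.
rewrite invrK; split=> h x; have := h x.
  by rewrite -(vgeMl x _ s u0) opprD subrK.
by rewrite -(vgeMl x _ s u0) opprD subrK.
Qed.

Lemma ell_gt0 D : fin D -> (0 < ell D)%N -> exists f, f != 0 /\ L D f.
Proof. by move=> fD /(dim_gt0 (ellP fD))[f hf f0]; exists f. Qed.

(** * Principal divisors have degree zero *)

Definition zeros u : divisor := fun x => Num.max (ord x u) 0.

Lemma fin_zeros u : fin (zeros u).
Proof.
have /finP[s [us hs]] := fin_ord u; apply/finP; exists s; split=> // x /hs.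
by rewrite /zeros => ->; rewrite maxxx.
Qed.

Lemma zeros_ge0 u x : 0 <= zeros u x.
Proof. by rewrite /zeros le_max lexx orbT. Qed.

Lemma ord_zeros u x : ord x u = zeros u x - zeros u^-1 x.
Proof. by rewrite /zeros ordV; case: (leP (ord x u)); case: leP; lia. Qed.

Lemma deg_zeros_indep u : u != 0 -> exists (n : nat) (z : 'I_n -> F),
  n%:Z = deg (zeros u) /\ indep_over u z.
Proof.
move=> u0; have /finP[r [ur hr]] := fin_ord u.
pose s := [seq y <- r | 0 < ord y u].
have us : uniq s by rewrite filter_uniq.
have [|z hz] := @zeros_indep _ _ u s u0 us.
  by move=> y; rewrite mem_filter => /andP[].
eexists; exists z; split=> //.
rewrite (@deg_seq _ s) //; last first.
  move=> x; rewrite mem_filter negb_and => /orP[h|/hr h]; last by rewrite /zeros h maxxx.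
  by rewrite /zeros; apply/max_idPr; rewrite leNgt.
rewrite (big_morph Posz PoszD (erefl _)) big_seq [RHS]big_seq.
apply: eq_bigr => x; rewrite mem_filter => /andP[h _].
by rewrite /zeros gez0_abs ?ltW // max_l // ltW.
Qed.

Lemma common_denominator (n : nat) (z : 'I_n -> F) :
  exists D, [/\ fin D, forall x, 0 <= D x & forall i, L D (z i)].
Proof.
elim: n z => [|n IH] z.
  by exists (fun=> 0); split=> // [|[]//]; apply/finP; exists [::].
have [D [fD D0 hD]] := IH (fun i => z (lift ord0 i)).
exists (fun x => D x + zeros (z ord0)^-1 x); split.
- by apply: finD => //; exact: fin_zeros.
- by move=> x; rewrite addr_ge0 // zeros_ge0.
- move=> i; case: (unliftP ord0 i) => [j ->|->].
    by apply: L_sub (hD j) => x; rewrite lerDl zeros_ge0.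
  move=> x; apply: vgeW (vge_ord x _); rewrite [ord x _]ord_zeros.
  by have := D0 x; have := zeros_ge0 (z ord0) x; lia.
Qed.

(** Independence over [C(u)] makes the spaces of multiples of the pole divisor
of [u] grow linearly. *)
Lemma ell_growth u n (z : 'I_n -> F) D k : indep_over u z -> fin D ->
  (forall x, 0 <= D x) -> (forall i, L D (z i)) ->
  (n * k.+1 <= ell (fun x => (k%:Z * zeros u^-1 x + D x)%R))%N.
Proof.
move=> hz fD D0 zD; pose E x := k%:Z * zeros u^-1 x + D x.
have fE : fin E by apply: finD => //; apply: finMn; exact: fin_zeros.
have := @free_size (L E) _ ('I_n * 'I_k.+1)%type (fun p => z p.1 * u ^+ p.2) (ellP fE).
rewrite card_prod !card_ord; apply.
  move=> c h [i j]; pose q i := \poly_(l < k.+1) c (i, inord l).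
  have := hz q; have : \sum_i0 ev u (q i0) * z i0 = 0.
    transitivity (\sum_i0 \sum_(j < k.+1) cst X (c (i0, j)) * (z i0 * u ^+ j)); last first.
      by rewrite pair_bigA /= -[RHS]h; apply: eq_bigr => -[].
    apply: eq_bigr => l _; rewrite (@evE _ _ _ _ k.+1) ?size_poly // mulr_suml.
    by apply: eq_bigr => m _; rewrite coef_poly ltn_ord inord_val; ring.
  move=> e /(_ e i) /polyP /(_ j); rewrite coef_poly ltn_ord inord_val coef0.
  by [].
move=> [i j] x /=; rewrite opprD addrC; apply: vgeM; first exact: zD.
have [->|u0] := eqVneq u 0.
  rewrite expr0n; case: (nat_of_ord j) => [|?] /=; rewrite ?vge0 //.
  by rewrite invr0 /zeros ord_zero maxxx mulr0 oppr0 -(rmorph1 (cst X)) vge_cst.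
rewrite vgeE ?expf_neq0 // ordX -mulr_natr natz /zeros ordV.
have := ltn_ord j; rewrite ltnS => jk; case: leP => ?; nia.
Qed.

(** The space of multiples of [k] times the poles of [u] has dimension at least
[deg (zeros u) * k] by [ell_growth] and at most [deg (zeros u^-1) * k] by
[ell_effective], up to bounded terms. *)
Lemma deg_zeros_le u : u != 0 -> deg (zeros u) <= deg (zeros u^-1).
Proof.
move=> u0; have [n [z [hn hz]]] := deg_zeros_indep u0.
have [D [fD D0 zD]] := common_denominator z.
rewrite -hn leNgt; apply/negP => lt.
pose k := `|(deg D + 1)%R|%N.
have := ell_growth k hz fD D0 zD.
have fE : fin (fun x => k%:Z * zeros u^-1 x) by apply: finMn; exact: fin_zeros.
have := @ell_effective _ (finD fE fD); rewrite degD // degM; last exact: fin_zeros.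
have P0 : 0 <= deg (zeros u^-1) by apply: deg_ge0 => x; apply: zeros_ge0.
have dD : 0 <= deg D by apply: deg_ge0.
move=> /(_ _) h1 h2; have {}h1 := h1 (fun x => addr_ge0 (mulr_ge0 (le0z_nat k) (zeros_ge0 _ x)) (D0 x)).
have : (n * k.+1)%N%:Z <= k%:Z * deg (zeros u^-1) + deg D + 1.
  by apply: le_trans h1; rewrite lez_nat.
rewrite PoszM; have : k%:Z = deg D + 1 by rewrite /k gez0_abs; lia.
move: (k) (deg D) (deg (zeros u^-1)) dD P0 lt => {h1 h2 fE} k' d p; nia.
Qed.

Theorem deg_principal u : deg (fun x => ord x u) = 0.
Proof.
have [->|u0] := eqVneq u 0.
  by rewrite -[RHS]deg0; congr deg; apply/funext => x; rewrite ord_zero.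
have -> : (fun x => ord x u) = (fun x => zeros u x - zeros u^-1 x).
  by apply/funext => x; exact: ord_zeros.
rewrite degB; [|exact: fin_zeros|exact: fin_zeros].
apply/eqP; rewrite subr_eq0 eq_le deg_zeros_le //=.
by have := deg_zeros_le (invr_neq0 u0); rewrite invrK.
Qed.

(** * The inequality of Riemann *)

(** For large multiples of the pole divisor of [t] the difference is bounded by [ell_growth];
and every divisor is bounded by such a multiple up to the divisor of a polynomial in [t],
which changes neither side. *)
Lemma ell_deficiency_bounded : exists g : int, forall D, fin D ->
  deg D - (ell D)%:Z <= g.
Proof.
have [t [m [tr _]]] := function_field_dep X.
have t0 : t != 0 by rewrite -(evX t) tr ?polyX_eq0.
have [n [z [hn hz]]] := deg_zeros_indep t0.
have [D0 [fD0 D00 zD0]] := common_denominator z.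
pose P := zeros t^-1; have fP : fin P by exact: fin_zeros.
have dP : deg P = n%:Z.
  have := deg_principal t; have -> : (fun x => ord x t) = (fun x => zeros t x - P x).
    by apply/funext => x; exact: ord_zeros.
  rewrite degB // ?hn; [lia|exact: fin_zeros].
exists (deg D0) => D fD.
have /finP[s [us hs]] := fD; have /finP[r [ur hr]] := fP.
have /choice[a ha] x : exists a, 0 <= ord x t -> vge x 1 (t - cst X a).
  have [h|h] := leP 0 (ord x t); last by exists 0.
  by have [|c hc] := @residue _ _ x t; [rewrite vgeE | exists c].
have ta c : t - cst X c != 0 by rewrite -evXsubC tr // polyXsubC_eq0.
pose v := \prod_(y <- s) (t - cst X (a y)) ^+ `|D y|%N.
have v0 : v != 0 by rewrite prodf_seq_neq0; apply/allP => y _; rewrite /= expf_neq0.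
have ov x : 0 <= ord x t -> D x <= ord x v.
  move=> hx; have tc c : 0 <= ord x (t - cst X c).
    by have := vgeB (_ : vge x 0 t) (vge_cst x c); rewrite !vgeE //; apply.
  have pos w : 0 <= ord x (\prod_(y <- w) (t - cst X (a y)) ^+ `|D y|%N).
    elim: w => [|y w IH]; first by rewrite big_nil ord_one.
    rewrite big_cons ordM ?expf_neq0 ?addr_ge0 //; last first.
      by rewrite prodf_seq_neq0; apply/allP => ? _; rewrite /= expf_neq0.
    by rewrite ordX mulrn_wge0.
  have [xs|xs] := boolP (x \in s); last by rewrite hs // pos.
  rewrite /v (big_rem _ xs) /= ordM ?expf_neq0 //; last first.
    by rewrite prodf_seq_neq0; apply/allP => ? _; rewrite /= expf_neq0.
  have := ha x hx; rewrite vgeE // => h1; have := pos (rem x s).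
  rewrite ordX; move: (ord x _) h1 => b b1; move: (ord x _) => c c0.
  by rewrite -mulr_natr natz; nia.
pose k := (\sum_(y <- s ++ r) (`|D y| + `|ord y v|)).+1.
have hk y : y \in s ++ r -> (`|D y| + `|ord y v| < k)%N.
  by move=> hy; rewrite /k ltnS (big_rem _ hy) leq_addr.
pose E x := k%:Z * P x + D0 x.
have fE : fin E by apply: finD => //; exact: finMn.
have dle x : D x + ord x v^-1 <= E x.
  rewrite ordV /E; have [hx|hx] := leP 0 (ord x t).
    by have := ov x hx; have := zeros_ge0 t^-1 x; have := D00 x; rewrite -/P; nia.
  have Px : 1 <= P x by rewrite /P /zeros ordV; case: leP; lia.
  have : x \in s ++ r.
    rewrite mem_cat; apply/orP; right; apply: contraLR Px => /hr ->; by [].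
  by move=> /hk; have := D00 x; nia.
have fDv : fin (fun x => D x + ord x v^-1) by apply: finD => //; exact: fin_ord.
have := ell_mono fDv fE dle.
rewrite ell_principal ?invr_eq0 // degD //; last exact: fin_ord.
rewrite deg_principal addr0 => h; apply: le_trans h _.
have := ell_growth k hz fD0 D00 zD0; rewrite -/P -/E.
rewrite /E degD ?degM ?dP //; last exact: finMn.
by move: (ell _) => l; nia.
Qed.

(** If [g] is the maximal difference, attained for [D'], and the degree of [D] is large then
[D - D'] is equivalent to an effective divisor by the inequality itself; as the difference
is monotone, it is maximal for [D] too. *)
Theorem riemann : exists g d0 : int,
  (forall D, fin D -> deg D - g <= (ell D)%:Z) /\
  (forall D, fin D -> d0 <= deg D -> (ell D)%:Z = deg D - g).
Proof.
have [g0 hg0] := ell_deficiency_bounded.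
have fin0 : fin (fun=> 0) by apply/finP; exists [::].
pose d D := deg D - (ell D)%:Z.
have exP : exists n, `[< exists2 D, fin D & d D = g0 - n%:Z >].
  exists `|g0 - d (fun=> 0)|%N; apply/asboolP; exists (fun=> 0) => //.
  by rewrite gez0_abs ?subr_ge0 ?hg0 // opprB addrC subrK.
case: (ex_minnP exP) => n /asboolP[D' fD' hD'] nmin.
pose g := g0 - n%:Z.
have hg D : fin D -> deg D - (ell D)%:Z <= g.
  move=> fD; rewrite leNgt; apply/negP => lt; have le := hg0 D fD.
  have : (n <= `|g0 - d D|)%N.
    apply: nmin; apply/asboolP; exists D => //; rewrite gez0_abs /d; lia.
  by move: lt; rewrite /g /d; lia.
exists g, (deg D' + g + 1); split=> [D fD|D fD hD]; first by have := hg _ fD; lia.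
have fB : fin (fun x => D x - D' x) by apply: finB.
have [|f [f0 hf]] := ell_gt0 fB.
  by have := hg _ fB; rewrite degB //; lia.
have fDf : fin (fun x => D x + ord x f) by apply: finD => //; exact: fin_ord.
have := @ell_mono D' _ fD' fDf; rewrite ell_principal // degD //; last exact: fin_ord.
rewrite deg_principal addr0 -/(d D') hD' => /(_ _) h.
have {}h := h (fun x => _); have : forall x, D' x <= D x + ord x f.
  by move=> x; have := hf x; rewrite vgeE //; lia.
move/h; have := hg _ fD; rewrite -/g; lia.
Qed.

(** In the range where the inequality of Riemann is an equality, the dimension drops when the
point [y] is subtracted from [D]. *)
Theorem exact_order : exists d0 : int, forall D y, fin D -> d0 <= deg D ->
  exists f, [/\ f != 0, L D f & ord y f = - D y].
Proof.
have [g [d0 [_ hg]]] := riemann.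
exists (d0 + 1) => D y fD hD.
pose E x := D x - pts [:: y] x.
have fE : fin E by apply: finB => //; exact: fin_pts.
have dE : deg E = deg D - 1 by rewrite degB ?deg_pts //; exact: fin_pts.
have lE := hg E fE _; have lD := hg D fD _.
have eD : D = (fun x => E x + pts [:: y] x) by apply/funext => x; rewrite subrK.
have [f [Df nEf]] : exists f, L D f /\ ~ L E f.
  apply: contrapT => /forallNP h.
  have : dim (L D) (ell E).
    apply: dim_ext (ellP fE) => s; split=> [hs|hs].
      by rewrite eD; case: ((L_addpt E y s).1 hs).
    by apply: contrapT => nh; apply: (h s).
  by move/ellE; have := lE; have := lD; lia.
have f0 : f != 0 by apply: contra_notN nEf => /eqP-> x; exact: vge0.
exists f; split=> //.
have nv : ~~ vge y (- E y) f by apply/negP => h; apply: nEf; apply/(L_addpt E y); rewrite -eD.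
have := Df y; move: nv; rewrite !vgeE // /E pts1 eqxx; lia.
Qed.

End Divisors.

(** * Functions with poles at one point only *)

Section AffineRing.
Variables (R : realType) (X : curve R) (o : closed_point X).
Local Notation F := (funfield X).
Local Notation C := R[i].
Local Notation point := (closed_point X).
Implicit Types (y : point) (u z : F).

Definition affine z := forall y, y != o -> vge y 0 z.

Lemma affineD z w : affine z -> affine w -> affine (z + w).
Proof. by move=> hz hw y yo; rewrite vgeD ?hz ?hw. Qed.
Lemma affineM z w : affine z -> affine w -> affine (z * w).
Proof. by move=> hz hw y yo; rewrite -[0]addr0 vgeM ?hz ?hw. Qed.
Lemma affine_cst c : affine (cst X c).
Proof. by move=> y _; exact: vge_cst. Qed.
Lemma affine0 : affine 0.
Proof. by move=> y _; exact: vge0. Qed.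
Lemma affine1 : affine 1.
Proof. by rewrite -(rmorph1 (cst X)); exact: affine_cst. Qed.
Lemma affineN z : affine z -> affine (- z).
Proof. by move=> hz y yo; rewrite vgeN hz. Qed.
Lemma affine_sum (I : Type) (r : seq I) (P : pred I) (G : I -> F) :
  (forall i, P i -> affine (G i)) -> affine (\sum_(i <- r | P i) G i).
Proof. by move=> h; apply: big_ind => //; [exact: affine0 | exact: affineD]. Qed.
Lemma affine_ev u q : affine u -> affine (ev u q).
Proof. by move=> hu y yo; apply: ev_vge0; apply: hu. Qed.

Lemma affine_zero z : affine z -> vge o 1 z -> z = 0.
Proof.
move=> hz ho; have [|c hc] := @L0_cst _ _ z.
  by move=> y; have [->|/hz//] := eqVneq y o; apply: vgeW ho.
have [c0|c0] := eqVneq c 0; first by rewrite hc c0 rmorph0.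
by move: ho; rewrite hc vgeE ?fmorph_eq0 // ord_cst.
Qed.

Lemma affine_ord z : affine z -> z != 0 -> ord o z <= 0.
Proof.
move=> hz z0; rewrite leNgt; apply/negP => h; case/eqP: z0; apply: affine_zero => //.
by rewrite /vge -gtz0_ge1 h orbT.
Qed.

(** Allowing a pole of high order at [o] makes the degree large enough for [exact_order]. *)
Lemma strong_approx (D : point -> int) y0 : fin D -> y0 != o ->
  exists f, [/\ f != 0, ord y0 f = D y0 & forall y, y != o -> vge y (D y) f].
Proof.
move=> fD y0o; have [d0 hd] := exact_order X.
pose N : int := `|(d0 + deg D)%R|%N.
pose E y := N * pts [:: o] y - D y.
have fE : fin E by apply: finB => //; apply: finMn; exact: fin_pts.
have [|f [f0 Lf of_]] := hd E y0 fE.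
  rewrite degB //; last by apply: finMn; exact: fin_pts.
  by rewrite degM ?deg_pts //=; [rewrite /N; lia | exact: fin_pts].
have Ey y : y != o -> - E y = D y.
  by move=> yo; rewrite /E pts1 eq_sym (negbTE yo) mulr0 sub0r opprK.
exists f; split=> //; first by rewrite of_ Ey.
by move=> y yo; rewrite -Ey.
Qed.

(** The Weierstrass semigroup of the point [o]. *)
Definition semigroup (k : int) := exists f, [/\ f != 0, affine f & ord o f = - k].

Lemma semigroup0 : semigroup 0.
Proof.
by exists 1; split; rewrite ?oner_eq0 ?ord_one ?oppr0 //; exact: affine1.
Qed.

Lemma semigroup_large : exists k0 : nat, forall k : nat, (k0 <= k)%N -> semigroup k.
Proof.
have [d0 hd] := exact_order X; exists `|d0|%N => k hk.
have fE : fin (fun y => k%:Z * pts [:: o] y) by apply: finMn; exact: fin_pts.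
have [|f [f0 Lf of_]] := hd _ o fE.
  by rewrite degM ?deg_pts //=; [lia | exact: fin_pts].
exists f; split=> //; last by rewrite of_ pts1 eqxx mulr1.
by move=> y yo; have := Lf y; rewrite pts1 eq_sym (negbTE yo) mulr0 oppr0.
Qed.

Section AperyBasis.
Variables (n : nat) (t : F).
Hypotheses (n0 : (0 < n)%N) (t0 : t != 0) (At : affine t) (ot : ord o t = - n%:Z).

Lemma ord_ev q : q != 0 ->
  ev t q != 0 /\ ord o (ev t q) = - (n%:Z * (size q).-1%:Z).
Proof.
move=> q0; rewrite (evE t (leqnn _)).
have sq : (0 < size q)%N by rewrite size_poly_gt0.
have lq : ((size q).-1 < size q)%N by rewrite prednK.
pose G (j : 'I_(size q)) := cst X q`_j * t ^+ j.
have G0 j : (G j != 0) = (q`_j != 0).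
  by rewrite mulf_eq0 (negbTE (expf_neq0 _ t0)) orbF fmorph_eq0.
have oG j : G j != 0 -> ord o (G j) = - (n%:Z * j%:Z).
  rewrite G0 => h; rewrite ordM ?fmorph_eq0 ?expf_neq0 // ord_cst ordX ot; lia.
have Gl : G (Ordinal lq) != 0 by rewrite G0 -/(lead_coef q) lead_coef_eq0.
have [|i [Gi S0 oS mi]] := @ord_sum_distinct _ _ o _ G _ Gl.
  by move=> i j hi hj; rewrite !oG // => e; apply: ord_inj; move: n0 e; nia.
split=> //; rewrite oS oG //; have := mi (Ordinal lq).
rewrite vgeE // !oG //= => le; have := ltn_ord i.
have np : 0 < n%:Z by lia.
move=> lt; move: le; rewrite lerN2 ler_pM2l // => le.
have -> : nat_of_ord i = (size q).-1 by apply/eqP; rewrite eqn_leq -[(i <= _)%N]ltnS prednK // lt.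
by [].
Qed.

Lemma t_transcendental : transcendental t.
Proof. by move=> q /ord_ev[]. Qed.

(** Functions whose pole orders are the least elements of the semigroup in the classes modulo
the pole order [n] of [t]. *)
Lemma apery_exists : exists (f : 'I_n -> F) (m : 'I_n -> nat),
  [/\ forall i, f i != 0, forall i, affine (f i), forall i, ord o (f i) = - (m i)%:Z,
      forall i, (m i %% n = i)%N &
      forall (i : 'I_n) (k : nat), semigroup k -> (k %% n = i)%N -> (m i <= k)%N].
Proof.
have [k0 hk0] := semigroup_large.
have h (i : 'I_n) : exists p : F * nat, [/\ p.1 != 0, affine p.1,
    ord o p.1 = - (p.2)%:Z, (p.2 %% n = i)%N &
    forall k : nat, semigroup k -> (k %% n = i)%N -> (p.2 <= k)%N].
  have exP : exists k : nat, `[< semigroup k /\ (k %% n = i)%N >].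
    exists (k0 * n + i)%N; apply/asboolP; split; last by rewrite modnMDl modn_small.
    by apply: hk0; move: n0; nia.
  case: (ex_minnP exP) => m /asboolP[[f [f0 Af of_]] mi] mmin.
  by exists (f, m); split=> // k hk ki; apply: mmin; apply/asboolP.
have [p hp] := choice h.
exists (fun i => (p i).1), (fun i => (p i).2).
by split=> i; case: (hp i).
Qed.

Variables (f : 'I_n -> F) (m : 'I_n -> nat).
Hypotheses (f0 : forall i, f i != 0) (Af : forall i, affine (f i))
  (of_ : forall i, ord o (f i) = - (m i)%:Z) (mi : forall i, (m i %% n = i)%N)
  (mmin : forall (i : 'I_n) (k : nat), semigroup k -> (k %% n = i)%N -> (m i <= k)%N).

Definition comb (q : 'I_n -> {poly C}) := \sum_i ev t (q i) * f i.

Lemma comb_affine q : affine (comb q).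
Proof. by apply: affine_sum => i _; apply: affineM => //; apply: affine_ev. Qed.

Lemma mod_n_inj (i j : 'I_n) (a b : nat) :
  (n * a + m i = n * b + m j)%N -> i = j.
Proof.
move=> /(congr1 (fun k => k %% n)%N); rewrite ![(n * _)%N]mulnC !modnMDl.
by rewrite !mi => /ord_inj.
Qed.

(** The orders at [o] of the terms of a combination lie in different classes
modulo [n], so that no cancellation can occur. *)
Lemma ord_comb q i : q i != 0 -> comb q != 0 /\
  (n%:Z * (size (q i)).-1%:Z + (m i)%:Z <= - ord o (comb q)).
Proof.
move=> qi; pose G j := ev t (q j) * f j.
have G0 j : (G j != 0) = (q j != 0).
  rewrite mulf_eq0 (negbTE (f0 j)) orbF.
  by have [->|/ord_ev[->]//] := eqVneq (q j) 0; rewrite ev0 eqxx.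
have oG j : G j != 0 -> ord o (G j) = - (n%:Z * (size (q j)).-1%:Z + (m j)%:Z).
  rewrite G0 => /ord_ev[e0 oe]; rewrite ordM // oe of_; lia.
have Gi : G i != 0 by rewrite G0.
have [|k [Gk S0 oS mk]] := @ord_sum_distinct _ _ o _ G _ Gi.
  move=> j k hj hk; rewrite !oG // => e; apply: (@mod_n_inj j k (size (q j)).-1 (size (q k)).-1).
  by move: e; lia.
split=> //; have := mk i; rewrite vgeE // (oG i Gi) /comb oS => le; lia.
Qed.

Lemma comb_inj q q' : comb q = comb q' -> forall i, q i = q' i.
Proof.
move=> e i; apply/eqP; rewrite -subr_eq0; apply/eqP; apply: contrapT => /eqP h.
have [] := @ord_comb (fun i => q i - q' i) i h.
have -> : comb (fun i => q i - q' i) = comb q - comb q'.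
  by rewrite /comb -sumrB; apply: eq_bigr => j _; rewrite evB mulrBl.
by rewrite e subrr eqxx.
Qed.

(** The leading term at [o] of an affine function is that of a power of [t] times a basis
element; the remainder has a pole of lower order. *)
Lemma comb_surj z : affine z -> exists q, z = comb q.
Proof.
move=> Az.
have [k hk] : exists k : nat, vge o (1 - k%:Z) z.
  exists `|(1 - ord o z)%R|%N; apply: vgeW (vge_ord o z); lia.
elim: k z Az hk => [|k IH] z Az hz.
  exists (fun=> 0); rewrite /comb big1 => [|i _]; last by rewrite ev0 mul0r.
  by apply: affine_zero => //; rewrite subr0 in hz.
have [hz'|hz'] := boolP (vge o (1 - k%:Z) z); first exact: IH.
have z0 : z != 0 by apply: contraNneq hz' => ->; exact: vge0.
have oz : ord o z = - k%:Z by move: hz hz'; rewrite !vgeE //; lia.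
have im : (k %% n < n)%N by rewrite ltn_mod.
pose i := Ordinal im.
have mk : (m i <= k)%N by apply: mmin => //; exists z.
have /dvdnP[d hd] : (n %| k - m i)%N.
  by rewrite -eqn_mod_dvd // mi /= eqxx.
pose w := t ^+ d * f i.
have w0 : w != 0 by rewrite mulf_neq0 ?expf_neq0.
have ow : ord o w = ord o z.
  by rewrite ordM ?expf_neq0 // ordX ot of_ oz; move: hd mk; nia.
have Aw : affine w by apply: affineM => //; rewrite -(evX t) -evXn; apply: affine_ev.
have : vge o 0 (z / w) by rewrite -vge_div // add0r ow vge_ord.
case/residue => c hc.
have [||q hq] := IH (z - cst X c * w).
- by apply: affineD => //; apply: affineN; apply: affineM => //; exact: affine_cst.
- rewrite -(divfK w0 z) -mulrBl.
  have -> : 1 - k%:Z = 1 + ord o w by rewrite ow oz.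
  by rewrite vgeMl.
exists (fun j => q j + (if j == i then c%:P * 'X^d else 0)).
rewrite /comb -[z](subrK (cst X c * w)) hq.
under [RHS]eq_bigr => j _ do rewrite evD mulrDl.
rewrite big_split /=; congr (_ + _).
rewrite (bigD1 i) //= eqxx big1 => [|j /negbTE ->]; last by rewrite ev0 mul0r.
by rewrite addr0 evM evC evXn evX mulrA.
Qed.

Definition co z : 'I_n -> {poly C} := xget (fun=> 0) [set q | z = comb q]%classic.

Lemma coK z : affine z -> comb (co z) = z.
Proof.
by move=> /comb_surj[q hq]; rewrite /co; case: xgetP => [q' _ /= <-|/(_ q)].
Qed.

Lemma combK q : co (comb q) = q.
Proof. by apply/funext => i; apply: comb_inj; rewrite coK //; exact: comb_affine. Qed.

Lemma co_eq z q : z = comb q -> co z = q.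
Proof. by move=> ->; exact: combK. Qed.

Lemma coD z w i : affine z -> affine w -> co (z + w) i = co z i + co w i.
Proof.
move=> Az Aw; rewrite (@co_eq (z + w) (fun i => co z i + co w i)) //.
rewrite -{1}(coK Az) -{1}(coK Aw) /comb -big_split /=.
by apply: eq_bigr => j _; rewrite evD mulrDl.
Qed.

Lemma coZ p z i : affine z -> co (ev t p * z) i = p * co z i.
Proof.
move=> Az; rewrite (@co_eq (ev t p * z) (fun i => p * co z i)) //.
rewrite -{1}(coK Az) /comb mulr_sumr.
by apply: eq_bigr => j _; rewrite evM mulrA.
Qed.

Lemma co0 i : co 0 i = 0.
Proof. by have := @coZ 0 0 i affine0; rewrite mulr0 mul0r. Qed.

Lemma co_sum (I : Type) (r : seq I) (G : I -> F) i :
  (forall j, affine (G j)) -> co (\sum_(j <- r) G j) i = \sum_(j <- r) co (G j) i.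
Proof.
move=> AG; elim: r => [|j r IH]; first by rewrite !big_nil co0.
by rewrite !big_cons coD ?IH //; apply: affine_sum.
Qed.

Lemma co_basis i j : co (f i) j = (j == i)%:R.
Proof.
rewrite (@co_eq (f i) (fun j => (j == i)%:R)) // /comb (bigD1 i) //= eqxx ev1 mul1r.
by rewrite big1 ?addr0 // => k /negbTE ->; rewrite ev0 mul0r.
Qed.

Lemma comb_div q a : (forall i, (q i).[a] = 0) ->
  exists2 h, affine h & comb q = (t - cst X a) * h.
Proof.
move=> hq; have r i : root (q i) a by apply/eqP.
have [q' hq'] := choice (fun i => factor_theorem (q i) a (r i)).
exists (comb q'); first exact: comb_affine.
rewrite /comb mulr_sumr; apply: eq_bigr => i _.
by rewrite hq' evM evXsubC mulrCA mulrA.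
Qed.

(** * The trace *)

Definition mx z : 'M[{poly C}]_n := \matrix_(i, j) co (z * f i) j.
Definition tr z : {poly C} := \tr (mx z).

Lemma trD z w : affine z -> affine w -> tr (z + w) = tr z + tr w.
Proof.
move=> Az Aw; rewrite /tr /mxtrace -big_split /=; apply: eq_bigr => i _.
by rewrite !mxE mulrDl coD //; apply: affineM.
Qed.

Lemma trZ p z : affine z -> tr (ev t p * z) = p * tr z.
Proof.
move=> Az; rewrite /tr /mxtrace mulr_sumr; apply: eq_bigr => i _.
by rewrite !mxE -mulrA coZ //; apply: affineM.
Qed.

Lemma tr_ev p : tr (ev t p) = p *+ n.
Proof.
rewrite -[ev t p]mulr1 trZ; last exact: affine1.
rewrite /tr /mxtrace (eq_bigr (fun=> 1)) => [|i _].
  by rewrite sumr_const card_ord mulr_natr.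
by rewrite mxE mul1r co_basis eqxx.
Qed.

Lemma tr_comb q z : affine z -> tr (comb q * z) = \sum_i q i * tr (f i * z).
Proof.
move=> Az; rewrite /tr /mxtrace; under [RHS]eq_bigr => i _ do rewrite mulr_sumr.
rewrite [RHS]exchange_big /=; apply: eq_bigr => i _; rewrite mxE /comb -mulrA mulr_suml.
rewrite co_sum => [|j]; last by apply: affineM; [apply: affineM => //; apply: affine_ev|apply: affineM].
by apply: eq_bigr => j _; rewrite !mxE -mulrA coZ ?mulrA //; do ?apply: affineM.
Qed.

(** The trace of an element with a pole of order less than [n * k] at [o] has degree less
than [k], since the diagonal coordinates of [z * f i] do by [ord_comb]. *)
Lemma tr_size z (k : nat) : affine z -> vge o (1 - (n * k)%N%:Z) z -> (size (tr z) <= k)%N.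
Proof.
move=> Az hz; apply: (leq_trans (size_sum _ _ _)); apply/bigmax_leqP => i _.
rewrite mxE; have Azf : affine (z * f i) by apply: affineM.
have [->|ci] := eqVneq (co (z * f i) i) 0; first by rewrite size_poly0.
have [] := @ord_comb (co (z * f i)) i ci; rewrite coK // => zf0.
have z0 : z != 0 by apply: contraNneq zf0 => ->; rewrite mul0r.
rewrite ordM // of_; move: hz; rewrite vgeE //.
have : (0 < size (co (z * f i) i))%N by rewrite size_poly_gt0.
move: (size _) n0 => s' n0' s0'; nia.
Qed.

(** Subtract a multiple of [t ^+ k], whose trace is known. *)
Lemma tr_size_exact z (k : nat) : affine z -> z != 0 -> ord o z = - (n * k)%N%:Z ->
  size (tr z) = k.+1.
Proof.
move=> Az z0 oz; pose w := t ^+ k.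
have w0 : w != 0 by rewrite expf_neq0.
have ow : ord o w = ord o z by rewrite ordX ot oz; lia.
have : vge o 0 (z / w) by rewrite -vge_div // add0r ow vge_ord.
case/residue => c hc.
have we : w = ev t 'X^k by rewrite evXn evX.
have Aw : affine w by rewrite we; apply: affine_ev.
have c0 : c != 0.
  apply/eqP => c0; move: hc; rewrite c0 rmorph0 subr0 -vge_div // vgeE // ow; lia.
have e1 : cst X c * w = ev t (c%:P * 'X^k) by rewrite we evM evC.
have A2 : affine (z - cst X c * w).
  by apply: affineD => //; apply: affineN; rewrite e1; apply: affine_ev.
have -> : tr z = (c%:P * 'X^k) *+ n + tr (z - cst X c * w).
  by rewrite -tr_ev -e1 -trD ?subrKC // e1; apply: affine_ev.
have sz : size ((c%:P * 'X^k) *+ n) = k.+1.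
  rewrite -mulr_natr -polyCMn mulrAC -polyCM size_Cmul ?size_polyXn //.
  by rewrite mulf_neq0 // pnatr_eq0 -lt0n.
rewrite size_polyDl sz // ltnS; apply: tr_size => //.
rewrite -(divfK w0 z) -mulrBl.
have -> : 1 - (n * k)%N%:Z = 1 + ord o w by rewrite ow oz.
by rewrite vgeMl.
Qed.

Lemma trace_eigenvalues (M : 'M[C]_n) : exists r : seq C,
  (forall a, (a \in r) = eigenvalue M a) /\ \tr M = \sum_(a <- r) a.
Proof.
have [r hr] := closed_field_poly_normal (char_poly M).
rewrite (monicP (char_poly_monic M)) scale1r in hr.
have sr : size r = n.
  by have := size_char_poly M; rewrite hr size_prod_XsubC => -[].
exists r; split=> [a|]; first by rewrite eigenvalue_root_char hr root_prod_XsubC.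
have := char_poly_trace M n0; rewrite hr -{1}sr coefPn_prod_XsubC ?sr -?lt0n //.
by move/oppr_inj => ->.
Qed.

Definition lies_over y a := y != o /\ vge y 1 (t - cst X a).

Lemma t_sub_neq0 a : t - cst X a != 0.
Proof. by rewrite -evXsubC; apply: t_transcendental; rewrite polyXsubC_eq0. Qed.

Lemma over_ord y a : lies_over y a -> 1 <= ord y (t - cst X a).
Proof. by case=> _; rewrite vgeE // t_sub_neq0. Qed.

Lemma exists_over y : y != o -> exists a, lies_over y a.
Proof. by move=> yo; have [c hc] := residue (At yo); exists c. Qed.

Lemma vge1_cst y c : vge y 1 (cst X c) -> c = 0.
Proof.
have [//|c0] := eqVneq c 0; by rewrite vgeE ?fmorph_eq0 // ord_cst.
Qed.

Lemma over_inj y a b : lies_over y a -> lies_over y b -> a = b.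
Proof.
move=> [_ ha] [_ hb]; apply/eqP; rewrite -subr_eq0; apply/eqP.
apply: (@vge1_cst y); rewrite rmorphB.
have -> : cst X a - cst X b = (t - cst X b) - (t - cst X a) by ring.
exact: vgeB.
Qed.

Definition mxat a z : 'M[C]_n := map_mx (horner_eval a) (mx z).

Lemma tr_at a z : (tr z).[a] = \tr (mxat a z).
Proof. by rewrite /mxat trace_map_mx. Qed.

Lemma comb_mx (v : 'rV[C]_n) z : affine z ->
  z * comb (fun i => (v 0 i)%:P) = comb (fun j => \sum_i (v 0 i)%:P * mx z i j).
Proof.
move=> Az; rewrite /comb mulr_sumr.
under [RHS]eq_bigr => j _ do rewrite ev_sum mulr_suml.
rewrite exchange_big /=; apply: eq_bigr => i _.
rewrite mulrCA -[in LHS](coK (affineM Az (Af i))) /comb mulr_sumr.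
by apply: eq_bigr => j _; rewrite evM mxE mulrA.
Qed.

(** If no point over [a] has the value [c] then [z - c] is invertible modulo [t - a], so that
an eigenvector would be divisible by [t - a]. *)
Lemma eigenvalue_over a z c : affine z -> eigenvalue (mxat a z) c ->
  exists y, lies_over y a /\ vge y 1 (z - cst X c).
Proof.
move=> Az /eigenvalueP[v hv v0]; apply: contrapT => no.
pose g := comb (fun i => (v 0 i)%:P).
have Ag : affine g by exact: comb_affine.
have [h Ah hh] : exists2 h, affine h & (z - cst X c) * g = (t - cst X a) * h.
  have [|h Ah hh] := @comb_div (fun j => \sum_i (v 0 i)%:P * mx z i j - (c * v 0 j)%:P) a.
    move=> j; rewrite hornerD hornerN hornerC horner_sum.
    have := congr1 (fun N : 'rV_n => N 0 j) hv; rewrite !mxE => <-.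
    apply/eqP; rewrite subr_eq0; apply/eqP; apply: eq_bigr => i _.
    by rewrite hornerM hornerC /mxat !mxE.
  exists h => //; rewrite -hh mulrBl comb_mx // /g /comb mulr_sumr -sumrB.
  by apply: eq_bigr => j _; rewrite evB mulrBl polyCM evM !evC mulrA.
have [q hq] : exists q, g / (t - cst X a) = comb q.
  apply: comb_surj => y yo; have [hy|hy] := boolP (vge y 1 (t - cst X a)).
    have nz : ~~ vge y 1 (z - cst X c) by apply/negP => hz; apply: no; exists y.
    have z0 : z - cst X c != 0 by apply: contraNneq nz => ->; exact: vge0.
    have oz : ord y (z - cst X c) = 0.
      have := vgeB (Az y yo) (vge_cst y c); move: nz; rewrite !vgeE //; lia.
    have -> : g / (t - cst X a) = h / (z - cst X c).
      apply/eqP; rewrite eqr_div ?t_sub_neq0 // mulrC hh mulrC; exact/eqP.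
    by rewrite -vge_div // oz addr0; exact: Ah.
  have ta : ord y (t - cst X a) = 0.
    have := vgeB (At yo) (vge_cst y a); move: hy; rewrite !vgeE ?t_sub_neq0 //; lia.
  by rewrite -vge_div ?t_sub_neq0 // ta addr0; exact: Ag.
(* the constant coordinates of [g] are divisible by [t - a], hence zero *)
case/negP: v0; apply/eqP/rowP => i; rewrite mxE.
have e : g = comb (fun i => ('X - a%:P) * q i).
  rewrite -(divfK (t_sub_neq0 a) g) hq /comb mulr_suml; apply: eq_bigr => j _.
  by rewrite evM evXsubC mulrAC [X in X * _]mulrC.
have := comb_inj e i => /(congr1 (fun p : {poly C} => p.[a])).
by rewrite hornerC hornerM !hornerE subrr mul0r.
Qed.

(** All eigenvalues on the fibre are zero. *)
Lemma tr_vanish a z : affine z -> (forall y, lies_over y a -> vge y 1 z) -> (tr z).[a] = 0.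
Proof.
move=> Az hz; rewrite tr_at; have [r [hr ->]] := trace_eigenvalues (mxat a z).
rewrite big_seq big1 // => c; rewrite hr => /(eigenvalue_over Az)[y [ya hy]].
apply: (@vge1_cst y); rewrite -[cst X c](subKr z); exact: vgeB (hz _ ya) hy.
Qed.

(** The eigenvalues on the fibre are zero and the value of [z] at [y0], which does occur; the
field has characteristic zero. *)
Lemma tr_not_vanish a z y0 : affine z -> lies_over y0 a -> ~~ vge y0 1 z ->
  (forall y, y != y0 -> lies_over y a -> vge y 1 z) -> (tr z).[a] != 0.
Proof.
move=> Az ya nz hz; rewrite tr_at; have [r [hr ->]] := trace_eigenvalues (mxat a z).
have [c hc] := residue (Az y0 ya.1).
have c0 : c != 0 by apply: contraNneq nz => c0; move: hc; rewrite c0 rmorph0 subr0.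
have rc b : b \in r -> b = c \/ b = 0.
  rewrite hr => /(eigenvalue_over Az)[y [yb hy]].
  have [e|ne] := eqVneq y y0; [left|right].
    subst y; apply/eqP; rewrite -subr_eq0; apply/eqP; apply: (@vge1_cst y0).
    have -> : cst X (b - c) = (z - cst X c) - (z - cst X b) by rewrite rmorphB; ring.
    exact: vgeB.
  apply: (@vge1_cst y); rewrite -[cst X b](subKr z); exact: vgeB (hz _ ne yb) hy.
have cr : c \in r.
  rewrite hr; apply: contrapT => /negP; rewrite /eigenvalue negbK kermx_eq0 row_free_unit => uM.
  (* otherwise 1 is a multiple of [z - c] on the fibre *)
  pose e : 'rV[C]_n := \row_j (co 1 j).[a].
  pose w := e *m invmx (mxat a z - c%:M).
  pose g := comb (fun i => (w 0 i)%:P).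
  have hw : w *m mxat a z - c *: w = e.
    by rewrite -mul_mx_scalar -mulmxBr mulmxKV.
  have [|h Ah hh] := @comb_div (fun j => \sum_i (w 0 i)%:P * mx z i j - (c * w 0 j)%:P - co 1 j) a.
    move=> j; rewrite !hornerD !hornerN hornerC horner_sum.
    have := congr1 (fun N : 'rV_n => N 0 j) hw; rewrite !mxE => <-.
    apply/eqP; rewrite subr_eq0; apply/eqP; congr (_ - _); apply: eq_bigr => i _.
    by rewrite hornerM hornerC /mxat !mxE.
  have e1 : (z - cst X c) * g - 1 = (t - cst X a) * h.
    rewrite -hh mulrBl comb_mx // /g -{1}(coK affine1) /comb mulr_sumr -!sumrB.
    by apply: eq_bigr => j _; rewrite !evB !mulrBl polyCM evM !evC mulrA.
  have : vge y0 1 1.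
    have -> : 1 = (z - cst X c) * g - (t - cst X a) * h by rewrite -e1; ring.
    have y0o := ya.1; apply: vgeB; rewrite -[X in vge _ X _]addr0; apply: vgeM => //.
    - by apply: comb_affine.
    - by case: ya.
    - exact: Ah.
  by rewrite vgeE ?oner_eq0 // ord_one.
rewrite big_seq (eq_bigr (fun b => c * (b == c)%:R)) => [|b /rc[->|->]]; last first.
- by rewrite eq_sym (negbTE c0) mulr0.
- by rewrite eqxx mulr1.
rewrite -big_seq -mulr_sumr mulf_neq0 // -natr_sum pnatr_eq0 -lt0n.
by rewrite (big_rem c cr) /= eqxx.
Qed.

Lemma affine_multiple z : exists2 p : {poly C}, p != 0 & affine (ev t p * z).
Proof.
have /finP[s [us hs]] := @fin_ord _ X z.
have /choice[a ha] y : exists a, y != o -> lies_over y a.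
  by have [e|/exists_over[c hc]] := eqVneq y o; [exists 0 | exists c].
pose p := \prod_(y <- s) ('X - (a y)%:P) ^+ `|ord y z|%N.
have p0 : p != 0 by rewrite prodf_seq_neq0; apply/allP => y _; rewrite /= expf_neq0 ?polyXsubC_eq0.
exists p => // y yo; have [ys|ys] := boolP (y \in s); last first.
  by rewrite -[0]addr0 vgeM ?ev_vge0 ?At // -(hs y ys) vge_ord.
rewrite /p (big_rem _ ys) /= evM mulrAC -[0]addr0; apply: vgeM; last by apply/ev_vge0/At.
rewrite evXn evXsubC; have [->|z0] := eqVneq z 0; first by rewrite mulr0 vge0.
rewrite vgeE ?mulf_neq0 ?expf_neq0 ?t_sub_neq0 // ordM ?expf_neq0 ?t_sub_neq0 // ordX.
have := over_ord (ha y yo); move: (ord y _) (ord y z) => k l; rewrite -mulr_natr natz; nia.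
Qed.

(** * Duality *)

(** The functions [h] such that the differential [h dt] is regular away from
[o]: at a point of ramification index [e] the differential [dt] vanishes to the
order [e - 1]. *)
Definition regular_forms h := forall y a, lies_over y a ->
  vge y (1 - ord y (t - cst X a)) h.

Lemma regular_formsM h z : regular_forms h -> affine z -> regular_forms (h * z).
Proof.
move=> hh hz y a ya; rewrite -[1 - _]addr0; apply: vgeM; first exact: hh.
by apply: hz; case: ya.
Qed.

(** The residue theorem: a differential [h dt] cannot have a simple pole at [o] as its only
pole, which is what [ord o h = n] means.  Otherwise multiply [h] by a separable polynomial
[p] in [t] that makes it affine; the trace has degree one less than [p] by the order at
[o], but it vanishes at all roots of [p]. *)
Lemma regular_forms_ord_neq h : regular_forms h -> h != 0 -> ord o h <> n%:Z.
Proof.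
move=> hh h0 oh.
have /finP[s [us hs]] := @fin_ord _ X h.
have /choice[a ha] y : exists a, y != o -> lies_over y a.
  by have [e|/exists_over[c hc]] := eqVneq y o; [exists 0 | exists c].
pose r := undup (map a s); pose p := \prod_(c <- r) ('X - c%:P).
have p0 : p != 0 by rewrite monic_neq0 // monic_prod_XsubC.
have Az : affine (ev t p * h).
  move=> y yo; have [ys|ys] := boolP (y \in s); last first.
    by rewrite -[0]addr0 vgeM ?ev_vge0 ?At // -(hs y ys) vge_ord.
  have ar : a y \in r by rewrite mem_undup map_f.
  rewrite /p (big_rem _ ar) /= evM mulrAC -[0]addr0; apply: vgeM; last by apply/ev_vge0/At.
  rewrite evXsubC; apply: (@vgeW _ _ _ (ord y (t - cst X (a y)) + (1 - ord y (t - cst X (a y))))).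
    by lia.
  by apply: vgeM; [exact: vge_ord | apply/hh/ha].
have z0 : ev t p * h != 0 by rewrite mulf_neq0 // t_transcendental.
have oz : ord o (ev t p * h) = n%:Z - n%:Z * (size r)%:Z.
  have [e0 oe] := ord_ev p0; rewrite ordM // oe oh /p size_prod_XsubC /=; lia.
case er : (size r) => [|k].
  by have := affine_ord Az z0; rewrite oz er; lia.
have st : size (tr (ev t p * h)) = k.+1.
  by apply: tr_size_exact => //; rewrite oz er; lia.
have : (p %| tr (ev t p * h))%R.
  apply: uniq_roots_dvdp; last by rewrite uniq_rootsE undup_uniq.
  apply/allP => c cr; apply/rootP; apply: tr_vanish => // y yc.
  rewrite /p (big_rem _ cr) /= evM mulrAC -[1]addr0; apply: vgeM; last first.
    by apply/ev_vge0/At; case: yc.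
  rewrite evXsubC; apply: (@vgeW _ _ _ (ord y (t - cst X c) + (1 - ord y (t - cst X c)))).
    by lia.
  by apply: vgeM; [exact: vge_ord | exact: hh].
have tr0 : tr (ev t p * h) != 0 by rewrite -size_poly_gt0 st.
by move/(dvdp_leq tr0); rewrite st /p size_prod_XsubC er ltnn.
Qed.

Lemma regular_forms_gap h : regular_forms h -> h != 0 -> ~ semigroup (ord o h - n%:Z).
Proof.
move=> hh h0 [z [z0 Az oz]].
apply: (regular_forms_ord_neq (regular_formsM hh Az)); first by rewrite mulf_neq0.
by rewrite ordM // oz; lia.
Qed.

Definition trace_form : 'M[{poly C}]_n := \matrix_(i, j) tr (f i * f j).

(** A function orthogonal to all affine ones is orthogonal to a polynomial multiple of its
inverse. *)
Lemma trace_form_nondegenerate : \det trace_form != 0.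
Proof.
apply/negP => /det0P[v v0 hv]; pose w := comb (fun i => v 0 i).
have Aw : affine w by exact: comb_affine.
have w0 : w != 0.
  have [i vi] : exists i, v 0 i != 0.
    apply/existsP; rewrite -negb_forall; apply: contra v0 => /forallP h.
    by apply/eqP/rowP => i; rewrite (eqP (h i)) mxE.
  by have [] := @ord_comb (fun i => v 0 i) i vi.
have tw j : tr (w * f j) = 0.
  rewrite tr_comb //; have := congr1 (fun N : 'rV_n => N 0 j) hv; rewrite !mxE => e.
  by rewrite -[RHS]e; apply: eq_bigr => i _; rewrite mxE.
have twz z : affine z -> tr (z * w) = 0.
  move=> Az; rewrite -(coK Az) tr_comb // big1 // => i _.
  by rewrite mulrC mulrC [f i * w]mulrC tw mulr0.
have [p p0 Ap] := affine_multiple w^-1.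
have := twz _ Ap; rewrite divfK // tr_ev; apply/eqP.
by rewrite -mulr_natr -polyC_natr mulf_neq0 // polyC_eq0 pnatr_eq0 -lt0n.
Qed.

Definition dual_num j := comb (fun k => \adj trace_form j k).
(** The basis dual to [f] for the trace form; [dual_num] is its numerator. *)
Definition dual j := dual_num j / ev t (\det trace_form).

Lemma dual_num_affine j : affine (dual_num j). Proof. exact: comb_affine. Qed.

Lemma det_neq0 : ev t (\det trace_form) != 0.
Proof. exact: t_transcendental trace_form_nondegenerate. Qed.

Lemma tr_dual_num j i : tr (dual_num j * f i) = \det trace_form *+ (j == i).
Proof.
rewrite tr_comb //; have := congr1 (fun N : 'M_n => N j i) (mul_adj_mx trace_form).
rewrite !mxE => <-; apply: eq_bigr => k _; by rewrite [trace_form _ _]mxE.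
Qed.

Lemma tr_dual_num_co j z : affine z -> tr (dual_num j * z) = \det trace_form * co z j.
Proof.
move=> Az; rewrite mulrC -{1}(coK Az) tr_comb; last exact: dual_num_affine.
rewrite (bigD1 j) //= [f j * _]mulrC tr_dual_num eqxx mulr1n big1 ?addr0 => [|i ij].
  by rewrite mulrC.
by rewrite [f i * _]mulrC tr_dual_num eq_sym (negbTE ij) mulr0n mulr0.
Qed.

(** Otherwise some affine multiple of [(t - a) * dual j] is non-zero at [y0] and vanishes at
the other points over [a], so that its trace does not vanish at [a]; but it is a multiple
of ['X - a] because the traces of affine multiples of [dual j] are polynomials. *)
Lemma dual_regular j : regular_forms (dual j).
Proof.
move=> y0 a ya; apply/negPn/negP => nv.
have h0 : dual j != 0 by apply: contraNneq nv => ->; exact: vge0.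
have e1 := over_ord ya; have y0o := ya.1.
pose e := ord y0 (t - cst X a); pose l := - ord y0 (dual j).
have le : e <= l by move: nv; rewrite vgeE // /l /e; lia.
pose D y := if y == y0 then l - e else zeros (dual j)^-1 y + zeros (t - cst X a) y.
have fD : fin D.
  have := finD (fin_zeros (dual j)^-1) (fin_zeros (t - cst X a)) => /finP[s [us hs]].
  apply/finP; exists (undup (y0 :: s)); split=> [|y]; first exact: undup_uniq.
  by rewrite mem_undup inE negb_or /D => /andP[/negbTE -> /hs].
have [z [z0 oz hz]] := strong_approx fD y0o.
have {oz}oz : ord y0 z = l - e by rewrite oz /D eqxx.
pose w := (t - cst X a) * dual j * z.
have td0 : (t - cst X a) * dual j != 0 by rewrite mulf_neq0 ?t_sub_neq0.
have w0 : w != 0 by rewrite mulf_neq0.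
have ow : ord y0 w = 0.
  by rewrite (ordM y0 td0 z0) (ordM y0 (t_sub_neq0 a) h0) oz /l /e; lia.
have wy y : y != o -> y != y0 -> vge y (zeros (t - cst X a) y) w.
  move=> yo yy0; have := hz y yo; rewrite /D (negbTE yy0).
  rewrite !vgeE // (ordM y td0 z0) (ordM y (t_sub_neq0 a) h0) [ord y (dual j)]ord_zeros.
  have := zeros_ge0 (dual j) y; have : 0 <= ord y (t - cst X a).
    by have := vgeB (At yo) (vge_cst y a); rewrite vgeE ?t_sub_neq0.
  lia.
have Aw : affine w.
  move=> y yo; have [->|yy0] := eqVneq y y0; first by rewrite vgeE // ow.
  by apply: vgeW (wy y yo yy0); exact: zeros_ge0.
have Az : affine z.
  move=> y yo; apply: vgeW (hz y yo); rewrite /D; case: eqP => _; first by lia.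
  by rewrite addr_ge0 // zeros_ge0.
have : (tr w).[a] != 0.
  apply: (@tr_not_vanish a w y0) => //; first by rewrite vgeE // ow.
  move=> y yy0 yb; apply: vgeW (wy y yb.1 yy0).
  by rewrite /zeros le_max (over_ord yb).
have ew : ev t (\det trace_form) * w = ev t ('X - a%:P) * (dual_num j * z).
  rewrite evXsubC /w /dual; have d0 := det_neq0; by field.
have := congr1 tr ew; rewrite !trZ //; last by apply: affineM => //; exact: dual_num_affine.
rewrite tr_dual_num_co // mulrCA => /(mulfI trace_form_nondegenerate) ->.
by rewrite hornerM !hornerE subrr mul0r eqxx.
Qed.

(** Multiply by the basis element that makes the order divisible by [n].  The degree of the
trace is then known from the order at [o], and the trace vanishes unless this basis
element is the dual one. *)
Lemma ord_dual j : dual j != 0 /\ ord o (dual j) = (m j)%:Z.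
Proof.
have t1 := tr_dual_num j j; rewrite eqxx in t1.
have dn0 : dual_num j != 0.
  apply/eqP => d0; move: t1; rewrite d0 mul0r -[0](ev0 t) tr_ev mul0rn => /esym/eqP.
  by rewrite (negbTE trace_form_nondegenerate).
have h0 : dual j != 0 by rewrite mulf_neq0 ?invr_eq0 ?det_neq0.
split=> //.
have [_ od] := ord_ev trace_form_nondegenerate.
pose D := (size (\det trace_form)).-1.
have oh : ord o (dual j) = ord o (dual_num j) + n%:Z * D%:Z.
  by rewrite ordM ?invr_eq0 ?det_neq0 // ordV od opprK.
have on := affine_ord (@dual_num_affine j) dn0.
(* a non-negative representative of the class of the order of [dual_num j] *)
pose r := `|(n%:Z * `|ord o (dual_num j)|%N%:Z + ord o (dual_num j))%R|%N.
have im : (r %% n < n)%N by rewrite ltn_mod.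
pose i := Ordinal im.
have Az : affine (dual_num j * f i) by apply: affineM => //; exact: dual_num_affine.
have z0 : dual_num j * f i != 0 by rewrite mulf_neq0.
have oz : ord o (dual_num j * f i) = ord o (dual_num j) - (m i)%:Z by rewrite ordM // of_.
have /dvdnP[k hk] : (n %| `|ord o (dual_num j * f i)|)%N.
  have hr : r%:Z = n%:Z * `|ord o (dual_num j)|%N%:Z + ord o (dual_num j).
    by rewrite /r gez0_abs //; move: n0 on; nia.
  have e1 := divn_eq r n; have e2 := divn_eq (m i) n; rewrite mi /= in e2.
  have : `|ord o (dual_num j * f i)|%N%:Z =
      n%:Z * (`|ord o (dual_num j)|%N%:Z + (m i %/ n)%N%:Z - (r %/ n)%N%:Z).
    rewrite oz; move: on hr e1 e2; lia.
  set d := (X in n%:Z * X) => e.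
  have d0 : 0 <= d by rewrite -(pmulr_rge0 d (_ : 0 < n%:Z)) -?e //; lia.
  apply/dvdnP; exists `|d|%N; apply/eqP; rewrite -eqz_nat e PoszM gez0_abs //.
  by rewrite mulrC.
have sz : size (tr (dual_num j * f i)) = k.+1.
  by apply: tr_size_exact => //; have := affine_ord Az z0; lia.
have ji : j = i.
  apply/eqP; apply: contraT => nji; move: sz; rewrite tr_dual_num (negbTE nji) mulr0n.
  by rewrite size_poly0.
move: sz; rewrite tr_dual_num -ji eqxx mulr1n => sz.
have := affine_ord Az z0; rewrite oh; move: hk oz; rewrite -ji /D sz /=; lia.
Qed.

(** The functions [dual i], multiplied by powers of [t], have all orders up to [m i] in the
class of [m i] modulo [n]; and [r - n] is less than [m i] if it is not in the semigroup. *)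
Lemma regular_forms_exists r : ~ semigroup (r - n%:Z) ->
  exists h, [/\ h != 0, regular_forms h & ord o h = r].
Proof.
move=> ng.
pose r' := `|(n%:Z * `|r|%N%:Z + r)%R|%N.
have im : (r' %% n < n)%N by rewrite ltn_mod.
pose i := Ordinal im.
have hr : r'%:Z = n%:Z * `|r|%N%:Z + r by rewrite /r' gez0_abs //; move: n0; nia.
have e1 := divn_eq r' n; have e2 := divn_eq (m i) n; rewrite mi /= in e2.
pose d := (m i %/ n)%N%:Z + `|r|%N%:Z - (r' %/ n)%N%:Z.
have ed : (m i)%:Z - r = n%:Z * d by move: hr e1 e2; rewrite /d; lia.
have d0 : 0 <= d.
  rewrite leNgt; apply/negP => dneg; apply: ng.
  exists (t ^+ `|(- d - 1)%R|%N * f i); split.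
  - by rewrite mulf_neq0 ?expf_neq0.
  - by apply: affineM => //; rewrite -(evX t) -evXn; apply: affine_ev.
  - by rewrite ordM ?expf_neq0 // ordX ot of_; move: ed dneg; nia.
have [h0 oh] := ord_dual i.
exists (dual i * t ^+ `|d|%N); split.
- by rewrite mulf_neq0 ?expf_neq0.
- apply: regular_formsM; first exact: dual_regular.
  by rewrite -(evX t) -evXn; apply: affine_ev.
- by rewrite ordM ?expf_neq0 // ordX ot oh; move: ed d0; nia.
Qed.

(** At a point [y0] that is ramified over [a] there is an affine function, not divisible by
[t - a], which vanishes at all points over [a]; its products with the basis have traces
that vanish at [a], so that the discriminant of the trace form does. *)
Lemma ramification_finite : finite_set
  [set y | exists2 a, lies_over y a & 2 <= ord y (t - cst X a)]%classic.
Proof.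
apply: sub_finite_set (finite_zeros det_neq0) => y0 [a ya he] /=.
pose e := ord y0 (t - cst X a).
pose D y := if y == y0 then e - 1 else zeros (t - cst X a) y.
have fD : fin D.
  have /finP[s [us hs]] := fin_zeros (t - cst X a).
  apply/finP; exists (undup (y0 :: s)); split=> [|y]; first exact: undup_uniq.
  by rewrite mem_undup inE negb_or /D => /andP[/negbTE -> /hs].
have [z [z0 oz hz]] := strong_approx fD ya.1.
rewrite /D eqxx in oz.
have Az : affine z.
  move=> y yo; apply: vgeW (hz y yo); rewrite /D; case: eqP => _; first by rewrite /e; lia.
  exact: zeros_ge0.
have z1 y : lies_over y a -> vge y 1 z.
  move=> yb; apply: vgeW (hz y yb.1); rewrite /D; case: eqP => _; first by rewrite /e; lia.
  by rewrite /zeros le_max (over_ord yb).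
have tz j : (tr (z * f j)).[a] = 0.
  apply: tr_vanish => [|y yb]; first by apply: affineM.
  by rewrite -[1]addr0; apply: vgeM; [exact: z1 | apply: Af yb.1].
pose v : 'rV[C]_n := \row_i (co z i).[a].
have v0 : v != 0.
  apply/eqP => v0; have [|h Ah hh] := @comb_div (co z) a.
    by move=> i; have := congr1 (fun N : 'rV_n => N 0 i) v0; rewrite !mxE.
  have : vge y0 (e + 0) z.
    by rewrite -(coK Az) hh; apply: vgeM; [exact: vge_ord | apply: Ah ya.1].
  by rewrite vgeE // oz; lia.
have : \det (map_mx (horner_eval a) trace_form) == 0.
  apply/det0P; exists v => //; apply/rowP => j; rewrite !mxE.
  rewrite -[RHS](tz j) -[X in tr (X * _)](coK Az) tr_comb // horner_sum; apply: eq_bigr => i _.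
  by rewrite !mxE hornerM.
rewrite det_map_mx => /eqP hd.
have : vge y0 1 (ev t (\det trace_form)).
  have /factor_theorem[p ->] : root (\det trace_form) a by apply/eqP.
  rewrite evM evXsubC -[1]add0r; apply: vgeM; last by case: ya.
  by apply/ev_vge0/At; case: ya.
by rewrite vgeE ?det_neq0 // gtz0_ge1.
Qed.

End AperyBasis.
End AffineRing.

(** * The degree of the canonical divisor *)

Section CanonicalDegree.
Variables (R : realType) (X : curve R).
Local Notation F := (funfield X).
Local Notation C := R[i].
Local Notation point := (closed_point X).
Implicit Types (y : point) (u z : F) (D : point -> int).

Lemma ell_addpt D y : fin D ->
  ell (fun x => (D x + pts [:: y] x)%R) =
  (ell D + `[< exists f : F, [/\ (f != 0)%R, L (fun x => (D x + pts [:: y] x)%R) f &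
                             ord y f = (- D y - 1)%R] >])%N.
Proof.
move=> fD; have hn := ellP fD; case: asboolP => [[f [f0 Lf of_]]|no].
  rewrite addn1; apply: ellE; apply: (@dim_step _ _ (L D) _ y (- (D y + 1)) _ _ _ _ hn).
  - exact: L_subspace.
  - by move=> s /(_ y); rewrite pts1 eqxx.
  - by move=> s; rewrite opprD subrK; exact: L_addpt.
  - by exists f; split=> // /(_ y); rewrite vgeE // of_; lia.
rewrite addn0; apply: ellE; apply: dim_ext hn => s; split=> hs.
  by case: ((L_addpt D y s).1 hs).
apply/(L_addpt D y); split=> //; apply: contrapT => /negP nv; apply: no.
have s0 : s != 0 by apply: contraNneq nv => ->; exact: vge0.
exists s; split=> //; move: nv (hs y); rewrite !vgeE // pts1 eqxx; lia.
Qed.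

Lemma L_negative D f : fin D -> deg D < 0 -> L D f -> f = 0.
Proof.
move=> fD dD hf; apply/eqP; apply: contraLR dD => f0; rewrite -leNgt.
have -> : deg D = deg (fun x => D x + ord x f).
  by rewrite degD ?deg_principal ?addr0 //; exact: fin_ord.
by apply: deg_ge0 => x; have := hf x; rewrite vgeE //; lia.
Qed.

Lemma ell_negative D : fin D -> deg D < 0 -> ell D = 0%N.
Proof.
move=> fD dD; apply: ellE; apply: dim0 => f; split=> [|-> x]; last exact: vge0.
exact: L_negative.
Qed.

Lemma const_of_step (p : int -> int) : (forall k, p k = p (k - 1)) -> forall k l, p k = p l.
Proof.
move=> h; suff h0 k : p k = p 0 by move=> k l; rewrite !h0.
case: k => k; last first.
  by rewrite NegzE; elim: k => [|k IH]; rewrite -?IH [RHS]h; congr p; lia.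
by elim: k => [|k IH] //; rewrite -IH h; congr p; lia.
Qed.

(** The orders of [h] at [o] for [h dt] regular away from [o] are, shifted by [n], the gaps of
the semigroup, whereas the orders of affine functions are its elements.  Hence, when [k]
grows by one, either [ell (k o)] grows or [ell (kappa - k o)] drops, so that
[ell (kappa - k o) - ell (k o) + k] is constant.  Large and small [k] determine the
constant and the degree of [kappa].  Here [g] is one less than the genus. *)
Theorem canonical_divisor : exists (o : point) (n : nat) (t : F) (kappa : point -> int) (g : int),
  [/\ transcendental t /\ ord o t = - n%:Z, (0 < n)%N /\ affine o t,
      fin kappa /\ kappa o = - (n%:Z + 1),
      forall y a, y != o -> 1 <= ord y (t - cst X a) -> kappa y = ord y (t - cst X a) - 1 &
      [/\ forall D, fin D -> deg D - g <= (ell D)%:Z,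
          (ell kappa)%:Z = g + 1 & deg kappa = 2%:Z * g]].
Proof.
have [o _] := exists_point X.
have [k0 hk0] := semigroup_large o.
pose n := k0.+1; have n0 : (0 < n)%N by [].
have [t [t0 At ot]] : semigroup o n by apply: hk0; rewrite /n.
have [f [m [f0 Af of_ mi mmin]]] := apery_exists n0 t0 ot.
have trt := t_transcendental n0 t0 ot.
have /choice[a ha] y : exists a, y != o -> lies_over o t y a.
  by have [e|yo] := eqVneq y o; [exists 0|have [c hc] := exists_over At yo; exists c].
(* the divisor of the differential [dt]: it has order [e - 1] at a point of ramification
   index [e], and a pole of order [n + 1] at [o] *)
pose kappa y := if y == o then - (n%:Z + 1) else ord y (t - cst X (a y)) - 1.
have hk y b : lies_over o t y b -> kappa y = ord y (t - cst X b) - 1.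
  move=> yb; rewrite /kappa (negbTE yb.1).
  by rewrite (over_inj (ha y yb.1) yb).
have fk : fin kappa.
  have /finite_seqP[s hs] := ramification_finite n0 t0 At ot f0 Af of_ mi mmin.
  apply/finP; exists (undup (o :: s)); split=> [|y]; first exact: undup_uniq.
  rewrite mem_undup inE negb_or => /andP[yo ys]; rewrite (hk y (a y) (ha y yo)).
  have h1 := over_ord n0 t0 ot (ha y yo).
  apply/eqP; rewrite subr_eq0 eq_le h1 andbT leNgt; apply: contra ys => lt.
  suff : [set` s]%classic y by [].
  rewrite -hs; exists (a y); first exact: ha.
  by move: (ord y _) lt => e'; lia.
have [g [d0 [hg1 hg2]]] := riemann X.
exists o, n, t, kappa, g; split=> //.
- by rewrite /kappa eqxx.
- by move=> y b yo hb; apply: hk; split=> //; rewrite /vge hb orbT.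
pose pt (k : int) x : int := k * pts [:: o] x.
have fpt (k : int) : fin (pt k) by apply: finMn; exact: fin_pts.
have dpt (k : int) : deg (pt k) = k by rewrite degM ?deg_pts ?mulr1 //; exact: fin_pts.
have ptS (k : int) x : pt (k - 1) x + pts [:: o] x = pt k x by rewrite /pt; ring.
pose v (k : int) : int := (ell (fun x => kappa x - pt k x))%:Z.
pose l (k : int) : int := (ell (pt k))%:Z.
have vL (k : int) h : L (fun x => kappa x - pt k x) h <->
    regular_forms o t h /\ vge o (n%:Z + 1 + k) h.
  have e : - (kappa o - pt k o) = n%:Z + 1 + k.
    by rewrite /kappa /pt pts1 !eqxx; lia.
  split=> [Lh|[hh ho] y].
    split=> [y b yb|]; last by rewrite -e; exact: Lh.
    have := Lh y; rewrite (hk y b yb) /pt pts1 eq_sym (negbTE yb.1).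
    by rewrite mulr0 subr0 opprB.
  have [->|yo] := eqVneq y o; first by rewrite e.
  have := hh y (a y) (ha y yo); rewrite (hk y (a y) (ha y yo)).
  by rewrite /pt pts1 eq_sym (negbTE yo) mulr0 subr0 opprB.
have vS (k : int) : v (k - 1) = v k + (~~ `[< semigroup o k >])%:Z.
  rewrite /v; have -> : (fun x => kappa x - pt (k - 1) x) =
      (fun x => kappa x - pt k x + pts [:: o] x).
    by apply/funext => x; rewrite -(ptS k); ring.
  rewrite ell_addpt; last exact: finB.
  rewrite PoszD; congr (_ + _%:Z)%R; congr nat_of_bool; apply/asboolP/asboolPn.
    move=> [h [h0 + oh]].
    have -> : (fun x => kappa x - pt k x + pts [:: o] x) = (fun x => kappa x - pt (k - 1) x).
      by apply/funext => x; rewrite -(ptS k); ring.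
    case/vL => hh _; have := regular_forms_gap n0 t0 At ot f0 Af of_ mi mmin hh h0.
    have -> : ord o h - n%:Z = k; last by [].
    by move: oh; rewrite /kappa /pt pts1 !eqxx; lia.
  move=> ng; have [|h [h0 hh oh]] := regular_forms_exists n0 t0 At ot f0 Af of_ mi mmin (r := n%:Z + k).
    by rewrite addrAC subrr add0r.
  exists h; split=> //; last by rewrite oh /kappa /pt pts1 !eqxx; lia.
  have -> : (fun x => kappa x - pt k x + pts [:: o] x) = (fun x => kappa x - pt (k - 1) x).
    by apply/funext => x; rewrite -(ptS k); ring.
  by apply/vL; split=> //; rewrite vgeE // oh; lia.
have lS (k : int) : l k = l (k - 1) + (`[< semigroup o k >])%:Z.
  rewrite /l; have -> : pt k = (fun x => pt (k - 1) x + pts [:: o] x).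
    by apply/funext => x; rewrite ptS.
  rewrite ell_addpt // PoszD; congr (_ + _%:Z)%R; congr nat_of_bool; apply/asboolP/asboolP.
    move=> [h [h0 Lh oh]]; exists h; split=> //.
      move=> y yo; have := Lh y; rewrite ptS /pt pts1 eq_sym (negbTE yo).
      by rewrite mulr0 oppr0.
    by rewrite oh /pt pts1 eqxx; lia.
  move=> [h [h0 Ah oh]]; exists h; split=> //; last by rewrite oh /pt pts1 eqxx; lia.
  move=> y; rewrite ptS; have [->|yo] := eqVneq y o.
    by rewrite /pt pts1 eqxx vgeE // oh; lia.
  by rewrite /pt pts1 eq_sym (negbTE yo) mulr0 oppr0; exact: Ah.
have cst_p := @const_of_step (fun k => v k - l k + k).
have {}cst_p (k j : int) : v k - l k + k = v j - l j + j.
  by apply: cst_p => i; rewrite vS lS; case: asboolP => _ /=; lia.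
have dv (k : int) : deg (fun x => kappa x - pt k x) = deg kappa - k by rewrite degB ?dpt.
have p_pos : v 0 - l 0 = g.
  pose k : int := `|d0|%N%:Z + `|deg kappa|%N%:Z + 1.
  rewrite -[LHS]addr0 (cst_p 0 k) {1}/v ell_negative ?dv; [|exact: finB|rewrite /k; lia].
  by rewrite {1}/l (hg2 (pt k)) ?dpt // /k; lia.
have l0 : l 0 = 1.
  rewrite lS; have -> : `[< semigroup o 0 >] by apply/asboolP; exact: semigroup0.
  by rewrite {1}/l ell_negative // dpt.
have vk : v 0 = (ell kappa)%:Z.
  by rewrite /v; congr (ell _)%:Z; apply/funext => x; rewrite /pt mul0r subr0.
split=> //; first by rewrite -vk; lia.
pose k : int := - (`|d0|%N%:Z + `|deg kappa|%N%:Z + 1).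
have := cst_p 0 k; rewrite addr0 p_pos {1}/v hg2 ?dv; [|exact: finB|rewrite /k; lia].
by rewrite {1}/l ell_negative ?dpt // /k; lia.
Qed.

End CanonicalDegree.

(** * Differentials *)

Section Derivations.
Variables (R : realType) (X : curve R) (d : funfield X -> funfield X).
Local Notation F := (funfield X).
Local Notation C := R[i].
Local Notation point := (closed_point X).
Hypothesis hd : derivation d.
Implicit Types (y : point) (f h s u z : F).

Lemma der_add f h : d (f + h) = d f + d h. Proof. by case: hd => h1 h2 _; first [apply: h1 | apply: h2]. Qed.
Lemma der_mul f h : d (f * h) = d f * h + f * d h. Proof. by case: hd => h1 h2 _; first [apply: h1 | apply: h2]. Qed.
Lemma der_cst c : d (cst X c) = 0. Proof. by case: hd => _ _; apply. Qed.
Lemma der0 : d 0 = 0. Proof. by have := der_cst 0; rewrite rmorph0. Qed.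
Lemma der1 : d 1 = 0. Proof. by rewrite -(rmorph1 (cst X)) der_cst. Qed.

Lemma der_sum (I : Type) (r : seq I) (G : I -> F) :
  d (\sum_(i <- r) G i) = \sum_(i <- r) d (G i).
Proof.
by elim: r => [|i r IH]; rewrite ?big_nil ?der0 // !big_cons der_add IH.
Qed.

Lemma der_exp f k : d (f ^+ k.+1) = k.+1%:R * f ^+ k * d f.
Proof.
elim: k => [|k IH]; first by rewrite expr1 expr0 !mul1r.
by rewrite exprS der_mul IH -[in RHS]natr1 [in RHS]exprS exprS; ring.
Qed.

Lemma der_inv f : f != 0 -> d f = - f ^+ 2 * d f^-1.
Proof.
move=> f0; have := der_mul f f^-1; rewrite divff // der1 => /eqP.
rewrite eq_sym addr_eq0 => /eqP e.
rewrite -[LHS](mulfK (invr_neq0 f0)) e invrK; ring.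
Qed.

Lemma der_ev f (q : {poly C}) : exists p, d (ev f q) = ev f p * d f.
Proof.
elim/poly_ind: q => [|q c [p hp]]; first by exists 0; rewrite ev0 mul0r der0.
exists (p * 'X + q); rewrite !evD !evM evX evC der_add der_mul hp der_cst; ring.
Qed.

Lemma exists_other_point y : exists o, o != y.
Proof.
have [t [n [tr _]]] := function_field_dep X.
have t0 : t != 0 by rewrite -(evX t) tr ?polyX_eq0.
have /exists_pole[x hx] := (transcendental_not_cst t).1 tr.
have [//|xy] := eqVneq x y; last by exists x.
move=> xy; have [|x' hx'] := @exists_pole _ _ t^-1.
  move=> c e; have := (transcendental_not_cst t).1 tr c^-1; apply.
  by rewrite fmorphV -e invrK.
by exists x'; apply: contraTneq hx' => ->; rewrite -xy ordV -leNgt; lia.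
Qed.

(** The affine functions are finitely generated over the polynomials in [t], so that their
derivatives have bounded poles; and every function that is regular at [y] becomes affine
after multiplication by an affine function that does not vanish at [y]. *)
Lemma der_bounded y : exists M : int, forall f, vge y 0 f -> vge y M (d f).
Proof.
have [o oy] := exists_other_point y; have yo : y != o by rewrite eq_sym.
have [k0 hk0] := semigroup_large o.
pose n := k0.+1; have n0 : (0 < n)%N by [].
have [t [t0 At ot]] : semigroup o n by apply: hk0; rewrite /n.
have [f [m [f0 Af of_ mi mmin]]] := apery_exists n0 t0 ot.
pose N : int := (\sum_i (`|ord y (d t)| + `|ord y (d (f i))|))%N%:Z.
have hN i : vge y (- N) (d t) /\ vge y (- N) (d (f i)).
  have : (`|ord y (d t)| + `|ord y (d (f i))|)%N%:Z <= N.
    by rewrite /N (bigD1 i) //= lez_nat leq_addr.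
  by move=> h; split; apply: vgeW (vge_ord _ _); lia.
have dA z : affine o z -> vge y (- N) (d z).
  move=> /(comb_surj n0 t0 At ot f0 Af of_ mi mmin)[q ->].
  rewrite der_sum; apply: vge_sum => i _; rewrite der_mul.
  have [p ->] := der_ev t (q i); have [h1 h2] := hN i; apply: vgeD.
    rewrite -[- N]addr0; apply: vgeM; last by apply: Af.
    by rewrite -[- N]add0r; apply: vgeM => //; apply/ev_vge0/At.
  by rewrite -[- N]add0r; apply: vgeM => //; apply/ev_vge0/At.
exists (- N) => z hz.
pose D x := if x == y then 0 else zeros z^-1 x.
have fD : fin D.
  have /finP[s [us hs]] := fin_zeros z^-1; apply/finP; exists s; split=> // x /hs.
  by rewrite /D => ->; case: ifP.
have [b [b0 ob hb]] := strong_approx fD yo.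
have {}ob : ord y b = 0 by rewrite ob /D eqxx.
have Ab : affine o b.
  by move=> x xo; apply: vgeW (hb x xo); rewrite /D; case: ifP => // _; exact: zeros_ge0.
have Abz : affine o (b * z).
  move=> x xo; have [->|xy] := eqVneq x y; first by rewrite -[0]addr0 vgeM ?Ab.
  have [->|z0] := eqVneq z 0; first by rewrite mulr0 vge0.
  have := hb x xo; rewrite /D (negbTE xy) !vgeE ?mulf_neq0 // ordM // [ord x z]ord_zeros.
  by have := zeros_ge0 z x; lia.
have -> : d z = (d (b * z) - d b * z) / b by rewrite der_mul addrC addKr; field.
rewrite -vge_div // ob addr0; apply: vgeB; first exact: dA.
by rewrite -[- N]addr0; apply: vgeM => //; exact: dA.
Qed.

Section Local.
Variables (y : point) (s : F).
Hypotheses (s0 : s != 0) (os : ord y s = 1).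

Lemma taylor f (N : nat) : vge y 0 f -> exists q, vge y N (f - ev s q).
Proof.
move=> hf; elim: N => [|N [q hq]]; first by exists 0; rewrite ev0 subr0.
have [c hc] := leading_coef hq os s0.
exists (q + c%:P * 'X^N); rewrite evD evM evC evXn evX opprD addrA.
by rewrite -addn1 PoszD.
Qed.

Lemma vge_nat (k : nat) : vge y 0 (k%:R : F).
Proof. by rewrite -(rmorph_nat (cst X)) vge_cst. Qed.

(** Write [f] as a polynomial in [s] and a remainder divisible by a high power of [s], whose
derivative is harmless by [der_bounded]. *)
Lemma der_vge k f : vge y k (d s) -> vge y 0 f -> vge y k (d f).
Proof.
move=> hk hf; have [M hM] := der_bounded y.
pose N := (`|k| + `|M| + 1)%N.
have [q hq] := taylor N.+1 hf.
have sN : s ^+ N.+1 != 0 by rewrite expf_neq0.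
pose u := (f - ev s q) / s ^+ N.+1.
have hu : vge y 0 u by rewrite -vge_div // add0r ordX os natz.
have -> : f = ev s q + s ^+ N.+1 * u by rewrite /u mulrC divfK // addrC subrK.
have [p hp] := der_ev s q.
have hs : vge y 0 s by rewrite vgeE // os.
have hsX i : vge y i%:Z (s ^+ i) by rewrite vgeE ?expf_neq0 // ordX os natz.
rewrite der_add hp der_mul der_exp; apply: vgeD; last apply: vgeD.
- by rewrite -[k]add0r; apply: vgeM => //; apply: ev_vge0.
- rewrite -[k]addr0; apply: vgeM => //; rewrite -[k]add0r; apply: vgeM => //.
  by rewrite -[0]addr0; apply: vgeM; [exact: vge_nat | exact: vge_exp].
- apply: (@vgeW _ _ _ (N.+1%:Z + M)); first by rewrite /N; lia.
  by apply: vgeM; [exact: hsX | exact: hM].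
Qed.

Hypothesis hne : exists f, d f <> 0.

Lemma der_uniformizer : d s != 0.
Proof.
apply/eqP => ds0.
have reg0 f : vge y 0 f -> d f = 0.
  move=> hf; apply/eqP; apply: contraT => df0.
  have : vge y (ord y (d f) + 1) (d f) by apply: der_vge => //; rewrite ds0 vge0.
  by rewrite vgeE //; lia.
have [f hf] := hne; apply: hf.
have [->|f0] := eqVneq f 0; first exact: der0.
have [h|h] := leP 0 (ord y f); first by apply: reg0; rewrite vgeE.
by rewrite der_inv // reg0 ?mulr0 // vgeE ?invr_eq0 // ordV; lia.
Qed.

Lemma ord_der_pos f : 0 < ord y f ->
  d f != 0 /\ ord y (d f) = ord y (d s) + ord y f - 1.
Proof.
case ef : (ord y f) => [[//|K]|//] _.
have f0 : f != 0 by apply/eqP => f0; move: ef; rewrite f0 ord_zero.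
have sK i : s ^+ i != 0 by rewrite expf_neq0.
have oK i : ord y (s ^+ i) = i%:Z by rewrite ordX os natz.
pose u := f / s ^+ K.+1.
have u0 : u != 0 by rewrite mulf_neq0 ?invr_eq0.
have ou : ord y u = 0 by rewrite ordM ?invr_eq0 // ordV oK ef subrr.
have K0 : (K.+1%:R : F) != 0 by rewrite -(rmorph_nat (cst X)) fmorph_eq0 pnatr_eq0.
have oK0 : ord y (K.+1%:R : F) = 0 by rewrite -(rmorph_nat (cst X)) ord_cst.
have ds0 := der_uniformizer.
pose w := K.+1%:R * s ^+ K * d s * u.
have n1 : K.+1%:R * s ^+ K != 0 by rewrite mulf_neq0.
have n2 : K.+1%:R * s ^+ K * d s != 0 by rewrite mulf_neq0.
have w0 : w != 0 by rewrite mulf_neq0.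
have ow : ord y w = K%:Z + ord y (d s).
  by rewrite (ordM y n2 u0) (ordM y n1 ds0) (ordM y K0 (sK K)) oK0 oK ou add0r addr0.
have e : d f = w + s ^+ K.+1 * d u.
  by rewrite -[f in LHS](divfK (sK K.+1)) mulrC der_mul der_exp.
have [|h1 h2] := @ord_addl _ _ y w (s ^+ K.+1 * d u) w0.
  have -> : ord y w + 1 = K.+1%:Z + ord y (d s) by rewrite ow; lia.
  apply: vgeM; first by rewrite vgeE // oK.
  by apply: der_vge; [exact: vge_ord | rewrite vgeE // ou].
by rewrite e; split=> //; rewrite h2 ow; lia.
Qed.

Lemma ord_der f : ord y f != 0 ->
  d f != 0 /\ ord y (d f) = ord y (d s) + ord y f - 1.
Proof.
move=> of0; have f0 : f != 0 by apply: contraNneq of0 => ->; rewrite ord_zero.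
have [h|h] := ltP 0 (ord y f); first exact: ord_der_pos.
have [|n1 o1] := @ord_der_pos f^-1; first by rewrite ordV; lia.
rewrite der_inv // mulNr oppr_eq0 ordN mulf_neq0 ?expf_neq0 //; split=> //.
by rewrite ordM ?expf_neq0 // ordX o1 ordV; lia.
Qed.

End Local.
End Derivations.

(** The stalks of [K] are generated by the [d s] for uniformizers [s], and [k] is their order.
Since [ord y (d t) = k y + kappa y], division by [d t] carries the sections of [K] to
[L kappa] and the degree is that of [- kappa]. *)
Theorem canonical_riemann_roch (R : realType) (X : curve R) (K : sheaf X 1) (g : nat) :
  canonical_bundle K -> genus K g ->
  exists k : closed_point X -> int,
  [/\ fin k, forall y v, K y v <-> vge y (k y) (v 0 0), deg k = - (2%:Z * (g%:Z - 1)) &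
      forall D : closed_point X -> int, fin D -> deg D - (g%:Z - 1) <= (ell D)%:Z].
Proof.
move=> [d [hd hne hK]] [e he].
have [o [n [t [kappa [c [[trt ot] [n0 At] [fk ko] hk [hR hell hdeg]]]]]]] := canonical_divisor X.
have /choice[s hs] y : exists s : funfield X, s != 0 /\ ord y s = 1.
  by have [s [s0 os]] := uniformizer y; exists s.
pose k y := ord y (d (s y)).
have KE y v : K y v <-> vge y (k y) (v 0 0).
  have [s0 os] := hs y; have ds0 := der_uniformizer hd s0 os hne.
  rewrite hK; split=> [[m [a [w [ha hw ->]]]]|hv].
    rewrite summxE; apply: vge_sum => i _; rewrite mxE -[k y]add0r; apply: vgeM.
      exact/regularE.
    have [f /regularE hf <-] := hw i; rewrite mxE.
    exact: (der_vge hd s0 os (vge_ord y _) hf).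
  exists 1%N, (fun=> v 0 0 / d (s y)), (fun=> const_mx (d (s y))); split.
  - by move=> _; apply/regularE; rewrite -vge_div // add0r.
  - by move=> _; exists (s y) => //; apply/regularE; rewrite vgeE // os.
  - apply/matrixP => i j; rewrite !ord1 summxE big_ord1 !mxE divfK //.
have key y : d t != 0 /\ ord y (d t) = k y + kappa y.
  have [s0 os] := hs y; have [->|yo] := eqVneq y o.
    have [s0' os'] := hs o; have [|h1 h2] := ord_der hd s0' os' hne (f := t).
      by rewrite ot; lia.
    by split=> //; rewrite h2 ot ko /k; lia.
  have [a ha] := residue (At y yo).
  have ta : t - cst X a != 0 by rewrite -evXsubC; apply: trt; rewrite polyXsubC_eq0.
  have h1 : 1 <= ord y (t - cst X a) by move: ha; rewrite vgeE.
  have dt : d (t - cst X a) = d t.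
    by rewrite -rmorphN /= der_add // der_cst // addr0.
  have [|h2 h3] := ord_der hd s0 os hne (f := t - cst X a); first by lia.
  by rewrite -dt; split=> //; rewrite h3 (hk y a yo h1) /k; lia.
have dt0 : d t != 0 by case: (key o).
have kE : k = (fun y => ord y (d t) - kappa y).
  by apply/funext => y; rewrite (key y).2 addrK.
have fink : fin k by rewrite kE; apply: finB => //; exact: fin_ord.
have gc : g%:Z - 1 = c.
  suff -> : g = ell kappa by rewrite hell addrK.
  have free_e (a : 'I_g -> R[i]) : \sum_i cst X (a i) *: e i = 0 -> forall i, a i = 0.
    move=> ha; have /he[a0 [_ uniq]] : forall x, K x 0 by move=> x; apply/KE; rewrite mxE vge0.
    have e1 : a0 = [ffun=> 0].
      by apply: uniq; rewrite big1 // => i _; rewrite ffunE rmorph0 scale0r.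
    have e2 : a0 = [ffun i => a i].
      by apply: uniq; rewrite -[LHS]ha; apply: eq_bigr => i _; rewrite ffunE.
    by move=> i; have := congr1 (fun a : {ffun _} => a i) e2; rewrite e1 !ffunE.
  apply/esym/ellE; exists (fun i => e i 0 0 / d t); split.
    move=> a ha; apply: free_e; apply/matrixP => i j; rewrite !ord1 summxE mxE.
    transitivity ((\sum_i cst X (a i) * (e i 0 0 / d t)) * d t); last by rewrite ha mul0r.
    rewrite mulr_suml; apply: eq_bigr => l _.
    by rewrite !mxE mulrA divfK.
  have LK f : L kappa f <-> forall x, K x (const_mx (f * d t)).
    split=> [Lf x|h x].
      apply/KE; rewrite mxE.
      have -> : k x = - kappa x + ord x (d t) by rewrite kE addrC.
      by rewrite vgeMl.
    have /KE := h x; rewrite mxE.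
    have -> : k x = - kappa x + ord x (d t) by rewrite kE addrC.
    by rewrite vgeMl.
  move=> f; rewrite LK he; split=> [[a [ha _]]|[a ha]].
    exists a; have := congr1 (fun v : 'rV_1 => v 0 0) ha; rewrite mxE summxE => h.
    rewrite -[LHS](mulfK dt0) h mulr_suml; apply: eq_bigr => i _.
    by rewrite mxE mulrA.
  have ea : const_mx (f * d t) = \sum_i cst X (a i) *: e i :> 'rV_1.
    apply/matrixP => i j; rewrite !ord1 mxE summxE ha mulr_suml.
    by apply: eq_bigr => l _; rewrite mxE mulrA divfK.
  exists [ffun i => a i]; split=> [|a' ha'].
    by rewrite ea; apply: eq_bigr => i _; rewrite ffunE.
  apply/ffunP => i; rewrite ffunE; apply/eqP; rewrite -subr_eq0; apply/eqP.
  apply: (free_e (fun i => a i - a' i)).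
  rewrite -[RHS](subrr (const_mx (f * d t))) {1}ea ha' -sumrB.
  by apply: eq_bigr => l _; rewrite rmorphB scalerBl.
exists k; split=> //; last by move=> D fD; rewrite gc; exact: hR.
rewrite kE degB //; last exact: fin_ord.
by rewrite deg_principal hdeg sub0r gc.
Qed.

(** * Sheaves of rank one and two *)

Section Sheaves.
Variables (R : realType) (X : curve R).
Local Notation F := (funfield X).
Local Notation point := (closed_point X).
Implicit Types (x y : point) (n m a b : point -> int).

(** Describing a line bundle by the orders [n] of its local generators turns statements on
line bundles into statements on divisors; [n] is the negative of the usual divisor. *)
Definition is_lb (L : sheaf X 1) n := forall x v, L x v <-> vge x (n x) (v 0 0).

Lemma exists_ord x (k : int) : exists h : F, h != 0 /\ ord x h = k.
Proof.
have [s [s0 os]] := uniformizer x; exists (s ^ k).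
by rewrite expfz_neq0 // ordXz os mul1r.
Qed.

Lemma is_lb_uniq L n m : is_lb L n -> is_lb L m -> n = m.
Proof.
move=> hn hm; apply/funext => x; apply/eqP; rewrite eq_le.
have le a b : (forall v : 'rV[F]_1, vge x (a x) (v 0 0) -> vge x (b x) (v 0 0)) -> b x <= a x.
  move=> h; have [s [s0 os]] := exists_ord x (a x).
  by have := h (const_mx s); rewrite !mxE !vgeE // os lexx; apply.
by apply/andP; split; apply: le => v /=; [move/hm/hn | move/hn/hm].
Qed.

Lemma frame_mem r (E : sheaf X r) x A v : is_frame E x A ->
  (E x v <-> forall j, vge x 0 ((v *m invmx A) 0 j)).
Proof.
move=> [uA eE]; rewrite eE; split=> [[u hu <-] j|h].
  by rewrite mulmxK //; apply/regularE/hu.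
by exists (v *m invmx A); [move=> j; apply/regularE | rewrite mulmxKV].
Qed.

Lemma frameP r (E : sheaf X r) x A : A \in unitmx ->
  (forall v, E x v <-> forall j, vge x 0 ((v *m invmx A) 0 j)) -> is_frame E x A.
Proof.
move=> uA h; split=> //; apply/seteqP; split=> v.
  by move/h => hv; exists (v *m invmx A); [move=> j; apply/regularE | rewrite mulmxKV].
by move=> [u hu <-]; apply/h => j; rewrite mulmxK //; apply/regularE/hu.
Qed.

Lemma invmx_entry (A : 'M[F]_1) : A \in unitmx -> invmx A 0 0 = (A 0 0)^-1.
Proof.
move=> uA; have A0 : A 0 0 != 0 by move: uA; rewrite unitmxE det_mx11 unitfE.
apply: (mulfI A0); rewrite divff //.
have := congr1 (fun M : 'M[F]_1 => M 0 0) (mulmxV uA).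
by rewrite !mxE big_ord1 eqxx.
Qed.

Lemma unit11 (A : 'M[F]_1) : (A \in unitmx) = (A 0 0 != 0).
Proof. by rewrite unitmxE det_mx11 unitfE. Qed.

Lemma frame_lb (L : sheaf X 1) x A : is_frame L x A ->
  A 0 0 != 0 /\ forall v, L x v <-> vge x (ord x (A 0 0)) (v 0 0).
Proof.
move=> hA; have [uA _] := hA; have A0 : A 0 0 != 0 by rewrite -unit11.
split=> // v; rewrite (frame_mem v hA).
have e j : (v *m invmx A) 0 j = v 0 0 / A 0 0.
  by rewrite !ord1 mxE big_ord1 invmx_entry.
split=> [/(_ 0)|h j]; rewrite e -vge_div // add0r //.
Qed.

Lemma lb_frame (L : sheaf X 1) x (h : F) : h != 0 ->
  (forall v, L x v <-> vge x (ord x h) (v 0 0)) -> is_frame L x (const_mx h).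
Proof.
move=> h0 hL; have u : (const_mx h : 'M[F]_1) \in unitmx by rewrite unit11 mxE.
apply: frameP => // v; rewrite hL.
have e j : (v *m invmx (const_mx h)) 0 j = v 0 0 / h.
  by rewrite !ord1 mxE big_ord1 invmx_entry // mxE.
split=> [hv j|/(_ 0)]; rewrite e -vge_div // add0r //.
Qed.

Lemma line_bundle_lb (L : sheaf X 1) : line_bundle L -> exists n, fin n /\ is_lb L n.
Proof.
move=> hL.
have /choice[A hA] x : exists A : 'M[F]_1, is_frame L x A.
  by have [U [_ Ux [A hA]]] := hL x; exists A; apply: hA.
pose n x := ord x (A x 0 0).
have hn : is_lb L n by move=> x v; case: (frame_lb (hA x)).
exists n; split=> //; have [x0 _] := exists_point X.
have [U [fU Ux [A0 hA0]]] := hL x0.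
apply: (@sub_finite_set _ _ (~` U `|` [set y | ord y (A0 0 0) != 0])%classic).
  move=> y /= ny; have [Uy|Uy] := pselect (U y); [right|by left].
  have [h1 h2] := frame_lb (hA0 y Uy).
  suff <- : n y = ord y (A0 0 0) by [].
  apply/eqP; rewrite eq_le; apply/andP; split.
    have : L y (const_mx (A0 0 0)) by apply/h2; rewrite mxE vge_ord.
    by move/hn; rewrite mxE vgeE.
  have [k1 k2] := frame_lb (hA y).
  have : L y (const_mx (A y 0 0)) by apply/k2; rewrite mxE vge_ord.
  by move/h2; rewrite mxE vgeE.
by rewrite finite_setU; split=> //; exact: ord_finite_support.
Qed.

Lemma lb_line_bundle (L : sheaf X 1) n : fin n -> is_lb L n -> line_bundle L.
Proof.
move=> fn hn x; have [h [h0 oh]] := exists_ord x (n x).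
exists [set y | n y = ord y h]%classic; split.
- apply: (@sub_finite_set _ _ [set y | n y - ord y h != 0]%classic).
    by move=> y /= ne; apply/eqP => /subr0_eq.
  by apply: finB => //; exact: fin_ord.
- by rewrite /= oh.
- by exists (const_mx h) => y e; apply: lb_frame => // v; rewrite hn e.
Qed.

(** Frames at the same point differ by an invertible matrix of regular functions,
so that the order of the determinant depends on the stalk only. *)
Lemma frame_det r (E : sheaf X r) x A B : is_frame E x A -> is_frame E x B ->
  ord x (\det A) = ord x (\det B).
Proof.
have detreg (M : 'M[F]_r) : (forall i j, vge x 0 (M i j)) -> vge x 0 (\det M).
  move=> h; rewrite /determinant; apply: vge_sum => s _.
  rewrite -[0]add0r; apply: vgeM.
    by rewrite -signr_odd -(rmorph1 (cst X)) -rmorphN -rmorphXn /= vge_cst.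
  apply: (big_ind (fun z => vge x 0 z)) => //; first by rewrite -(rmorph1 (cst X)) vge_cst.
  by move=> u v hu hv; rewrite -[0]add0r vgeM.
have le A1 B1 : is_frame E x A1 -> is_frame E x B1 -> ord x (\det B1) <= ord x (\det A1).
  move=> hA hB; have [uA _] := hA; have [uB _] := hB.
  have : vge x 0 (\det (A1 *m invmx B1)).
    apply: detreg => i j.
    have EA : E x (row i A1).
      apply/(frame_mem _ hA) => k; rewrite -row_mul mulmxV // !mxE.
      by case: eqP => _; rewrite ?vge0 // -(rmorph1 (cst X)) vge_cst.
    have /(frame_mem _ hB)/(_ j) := EA; by rewrite -row_mul mxE.
  have dA : \det A1 != 0 by rewrite -unitfE -unitmxE.
  have dB : \det B1 != 0 by rewrite -unitfE -unitmxE.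
  by rewrite det_mulmx det_inv vgeE ?mulf_neq0 ?invr_eq0 // ordM ?invr_eq0 // ordV subr_ge0.
by move=> hA hB; apply/eqP; rewrite eq_le !le.
Qed.

Lemma degree_frames r (E : sheaf X r) (A : point -> 'M[F]_r) :
  (forall x, is_frame E x (A x)) -> degree E = deg (fun x => - ord x (\det (A x))).
Proof.
move=> hA; congr deg; apply/funext => x; case: xgetP => [B _ hB|/(_ (A x))].
  by rewrite (frame_det hB (hA x)).
by move/(_ (hA x)).
Qed.

Lemma degree_lb (L : sheaf X 1) n : fin n -> is_lb L n -> degree L = - deg n.
Proof.
move=> fn hn.
have /choice[h hh] x : exists h : F, h != 0 /\ ord x h = n x by exact: exists_ord.
rewrite (@degree_frames _ _ (fun x => const_mx (h x))); last first.
  by move=> x; have [h0 oh] := hh x; apply: lb_frame => // v; rewrite oh; exact: hn.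
rewrite -degN //; congr deg; apply/funext => x.
by rewrite det_mx11 mxE; case: (hh x) => _ ->.
Qed.

Lemma iso_lb L M n m : is_lb L n -> is_lb M m ->
  (iso L M <-> exists2 f : F, f != 0 & forall x, m x = n x + ord x f).
Proof.
move=> hn hm; split=> [[A [uA hA]]|[f f0 hf]].
  have A0 : A 0 0 != 0 by rewrite -unit11.
  exists (A 0 0) => //.
  have hn' : is_lb L (fun x => m x - ord x (A 0 0)).
    by move=> x v; rewrite hA hm mxE big_ord1 -(vgeMl x _ (v 0 0) A0) subrK.
  by move=> x; rewrite (is_lb_uniq hn hn') subrK.
exists (const_mx f); split=> [|x v]; first by rewrite unit11 mxE.
by rewrite hn hm mxE big_ord1 mxE hf vgeMl.
Qed.

(** * Tensor products *)

Definition omodule r (E : sheaf X r) x := [/\ E x 0,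
  forall u v, E x u -> E x v -> E x (u + v) &
  forall c v, vge x 0 c -> E x v -> E x (c *: v)].

Lemma frame_omodule r (E : sheaf X r) x A : is_frame E x A -> omodule E x.
Proof.
move=> hA; split=> [|u v|c v hc].
- by apply/(frame_mem _ hA) => j; rewrite mul0mx mxE vge0.
- move=> /(frame_mem _ hA) hu /(frame_mem _ hA) hv; apply/(frame_mem _ hA) => j.
  by rewrite mulmxDl mxE vgeD.
- move=> /(frame_mem _ hA) hv; apply/(frame_mem _ hA) => j.
  by rewrite -scalemxAl mxE -[0]add0r vgeM.
Qed.

Lemma bundle_frame r (E : sheaf X r) x : vector_bundle E -> exists A, is_frame E x A.
Proof. by move=> /(_ x)[U [_ Ux [A hA]]]; exists A; apply: hA. Qed.

Lemma omodule_sum r (E : sheaf X r) x (k : nat) (c : 'I_k -> F) (v : 'I_k -> 'rV[F]_r) :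
  omodule E x -> (forall i, vge x 0 (c i)) -> (forall i, E x (v i)) ->
  E x (\sum_i c i *: v i).
Proof.
move=> [E0 ED EZ] hc hv; apply: (big_ind (fun w => E x w)) => // i _.
exact: EZ.
Qed.

(** The rank 1 factor is generated by one function [h]. *)
Lemma tensor_mem r (E : sheaf X r) L n x h v : omodule E x -> is_lb L n ->
  h != 0 -> ord x h = n x -> (tensor E L x v <-> E x (h^-1 *: v)).
Proof.
move=> oE hL h0 oh; split=> [[k [c [s [hc hs ->]]]]|hv].
  rewrite scaler_sumr.
  under eq_bigr => i _ do rewrite scalerA mulrC -scalerA.
  apply: omodule_sum => // i; first exact/regularE.
  have [l Ll [e Ee ->]] := hs i; rewrite scalerA; case: oE => _ _; apply=> //.
  by rewrite mulrC -vge_div // add0r oh; apply/hL.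
exists 1%N, (fun=> 1), (fun=> v); split.
- by move=> _; apply/regularE; rewrite -(rmorph1 (cst X)) vge_cst.
- move=> _; exists (const_mx h); first by apply/hL; rewrite mxE -oh vge_ord.
  by exists (h^-1 *: v) => //; rewrite mxE scalerA mulfV // scale1r.
- by rewrite big_ord1 scale1r.
Qed.

Lemma lb_omodule L n x : is_lb L n -> omodule L x.
Proof.
move=> hL; split=> [|u v|c v hc]; rewrite ?hL ?mxE ?vge0 //.
  by move=> hu hv; apply: vgeD.
by move=> hv; rewrite -[n x]add0r vgeM.
Qed.

Lemma tensor_lb L M n m : is_lb L n -> is_lb M m -> is_lb (tensor L M) (fun x => n x + m x).
Proof.
move=> hL hM x v; have [h [h0 oh]] := exists_ord x (m x).
rewrite (tensor_mem v (lb_omodule x hL) hM h0 oh) hL mxE mulrC.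
by rewrite -vge_div // oh.
Qed.

Lemma O_of_lb (D : point -> int) : is_lb (O_of D) (fun x => - D x).
Proof.
move=> x v; rewrite /O_of /vge /=; split=> [[->|->]|/orP[/eqP|]]; rewrite ?eqxx ?orbT //.
  by left.
by right.
Qed.

Lemma O_plus_lb k (D : k.-tuple point) : is_lb (O_plus D) (fun x => - pts D x).
Proof. exact: O_of_lb. Qed.

Lemma O_minus_lb k (D : k.-tuple point) : is_lb (O_minus D) (pts D).
Proof.
have := @O_of_lb (fun x => - mult D x); rewrite /O_minus.
by have -> : (fun x => - - mult D x) = pts D by apply/funext => x; rewrite opprK.
Qed.

Lemma OX_lb : is_lb (@OX _ X) (fun=> 0).
Proof.
move=> x v; rewrite /OX /trivial_bundle /=; split=> [/(_ 0)/regularE//|h j].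
by rewrite !ord1; apply/regularE.
Qed.

(** * Extensions of line bundles *)

Definition row2 (u v : F) : 'rV[F]_2 := \row_j (if j == 0 then u else v).

Lemma row2_0 u v : row2 u v 0 0 = u. Proof. by rewrite mxE. Qed.
Lemma row2_1 u v : row2 u v 0 1 = v. Proof. by rewrite mxE. Qed.
Definition row2E := (row2_0, row2_1).

Lemma row2P (u v : 'rV[F]_2) : u 0 0 = v 0 0 -> u 0 1 = v 0 1 -> u = v.
Proof.
move=> h0 h1; apply/rowP => j; case: j => [[|[|//]] hj].
  by have -> : Ordinal hj = 0 by apply: ord_inj.
by have -> : Ordinal hj = 1 by apply: ord_inj.
Qed.

Lemma mul2 k (u : 'rV[F]_2) (M : 'M[F]_(2, k)) j :
  (u *m M) 0 j = u 0 0 * M 0 j + u 0 1 * M 1 j.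
Proof.
rewrite mxE big_ord_recl big_ord1; congr (_ + u _ _ * M _ _); by apply: ord_inj.
Qed.

(** The extension of the line bundle of order [b] by that of order [a] in which
[r x] is the first coordinate of a local lift of the generator. *)
Definition extension a b (r : point -> F) : sheaf X 2 := fun x =>
  [set v : 'rV[F]_2 | vge x (b x) (v 0 1) /\ vge x (a x) (v 0 0 - r x * v 0 1)]%classic.

(** A basis of the stalk at [x], if [h] and [k] have the orders [a x] and [b x]. *)
Definition ext_frame x (h k : F) (r : point -> F) : 'M[F]_2 :=
  \matrix_(i, j) (if i == 0 then row2 h 0 0 j else row2 (r x * k) k 0 j).

Lemma ext_frame_mul x h k r v :
  v *m ext_frame x h k r = row2 (v 0 0 * h + v 0 1 * (r x * k)) (v 0 1 * k).
Proof. by apply: row2P; rewrite mul2 !mxE //= mulr0 add0r. Qed.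

Lemma det2 (M : 'M[F]_2) : \det M = M 0 0 * M 1 1 - M 0 1 * M 1 0.
Proof.
rewrite (expand_det_row _ 0) big_ord_recl big_ord1 /cofactor !det_mx11 !mxE /=.
have -> : lift 0 0 = 1 :> 'I_2 by apply: ord_inj.
have -> : lift 1 0 = 0 :> 'I_2 by apply: ord_inj.
by rewrite /= addn0 add0n expr0 expr1; ring.
Qed.

Lemma ext_frame_unit x h k r : h != 0 -> k != 0 ->
  \det (ext_frame x h k r) = h * k /\ ext_frame x h k r \in unitmx.
Proof.
move=> h0 k0; have e : \det (ext_frame x h k r) = h * k.
  by rewrite det2 !mxE /= mul0r subr0.
by rewrite unitmxE e unitfE mulf_neq0.
Qed.

Lemma ext_frameP a b r x h k : h != 0 -> k != 0 -> ord x h = a x -> ord x k = b x ->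
  is_frame (extension a b r) x (ext_frame x h k r).
Proof.
move=> h0 k0 oh ok; have [_ u] := ext_frame_unit x r h0 k0; split=> //.
apply/seteqP; split=> v /=.
  move=> [hb ha]; exists (row2 ((v 0 0 - r x * v 0 1) / h) (v 0 1 / k)).
    move=> j; apply/regularE; rewrite mxE; case: ifP => _.
      by rewrite -vge_div // add0r oh.
    by rewrite -vge_div // add0r ok.
  rewrite ext_frame_mul !row2E; apply: row2P; rewrite row2E ?divfK //.
  by rewrite mulrCA !divfK // subrK.
move=> [w hw <-]; rewrite ext_frame_mul /extension /= !row2E; split.
  by rewrite -ok -[ord x k]add0r vgeMl //; apply/regularE/hw.
have -> : w 0 0 * h + w 0 1 * (r x * k) - r x * (w 0 1 * k) = w 0 0 * h by ring.
by rewrite -oh -[ord x h]add0r vgeMl //; apply/regularE/hw.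
Qed.

Lemma ext_frame_exists a b r x : exists h k, [/\ h != 0, k != 0, ord x h = a x,
  ord x k = b x & is_frame (extension a b r) x (ext_frame x h k r)].
Proof.
have [h [h0 oh]] := exists_ord x (a x); have [k [k0 ok]] := exists_ord x (b x).
by exists h, k; split=> //; apply: ext_frameP.
Qed.

Lemma ext_omodule a b r x : omodule (extension a b r) x.
Proof. by have [h [k [_ _ _ _]]] := ext_frame_exists a b r x; apply: frame_omodule. Qed.

Lemma ext_degree a b r : fin a -> fin b -> degree (extension a b r) = - (deg a + deg b).
Proof.
move=> fa fb; have /choice[h /choice[k hk]] x := ext_frame_exists a b r x.
rewrite (@degree_frames _ _ (fun x => ext_frame x (h x) (k x) r)); last first.
  by move=> x; case: (hk x).
rewrite -degD // -degN; last exact: finD.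
congr deg; apply/funext => x; have [h0 k0 oh ok _] := hk x.
by have [-> _] := ext_frame_unit x r h0 k0; rewrite ordM // oh ok.
Qed.

(** Away from the finitely many points where one of the data jumps or has a pole, the frame
at [x] differs by a regular unipotent matrix from the one at [y]. *)
Lemma ext_bundle a b r : fin a -> fin b -> finite_set [set x | r x != 0]%classic ->
  vector_bundle (extension a b r).
Proof.
move=> fa fb fr x; have [h [k [h0 k0 oh ok _]]] := ext_frame_exists a b r x.
exists [set y | [/\ a y = ord y h, b y = ord y k & y = x \/ (r y = 0 /\ vge y (ord y h - ord y k) (r x))]]%classic.
split; last 1 first.
- exists (ext_frame x h k r) => y /= [ea eb er].
  have [_ u] := ext_frame_unit x r h0 k0; split=> //.
  have [->|[ry hr]] := er.
    by case: (@ext_frameP a b r x h k).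
  have [_ ->] := @ext_frameP a b r y h k h0 k0 (esym ea) (esym eb).
  have reg w : vge y 0 w -> vge y 0 (w * (r x * k / h)).
    move=> hw; rewrite -[0]add0r; apply: vgeM => //.
    by rewrite -vge_div // add0r -(vgeMl y _ (r x) k0) subrK in hr *.
  apply/seteqP; split=> v [w hw <-].
    exists (row2 (w 0 0 - w 0 1 * (r x * k / h)) (w 0 1)).
      move=> j; apply/regularE; rewrite mxE; case: ifP => _; last exact/regularE/hw.
      by apply: vgeB; [apply/regularE/hw | apply/reg/regularE/hw].
    rewrite !ext_frame_mul !row2E ry; apply: row2P; rewrite !row2E //.
    by field.
  exists (row2 (w 0 0 + w 0 1 * (r x * k / h)) (w 0 1)).
    move=> j; apply/regularE; rewrite mxE; case: ifP => _; last exact/regularE/hw.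
    by apply: vgeD; [apply/regularE/hw | apply/reg/regularE/hw].
  rewrite !ext_frame_mul !row2E ry; apply: row2P; rewrite !row2E //.
  by field.
- pose Z : set point := ([set y | a y - ord y h != 0] `|` [set y | b y - ord y k != 0] `|`
    [set y | r y != 0%R] `|` [set y | ord y (r x) != 0] `|` [set y | ord y h - ord y k != 0])%classic.
  have fZ : finite_set Z.
    rewrite /Z !finite_setU; split; first split; first split; first split => //.
    + by apply: finB => //; exact: fin_ord.
    + by apply: finB => //; exact: fin_ord.
    + exact: fr.
    + exact: ord_finite_support.
    + by apply: finB; exact: fin_ord.
  apply: sub_finite_set fZ => y /=; apply: contra_notP => nZ.
  have nz (P : bool) : (P -> Z y) -> ~~ P by move=> h1; apply/negP => /h1.
  have e1 : a y - ord y h == 0 by rewrite -[_ == _]negbK; apply: nz => ?; do 4 left.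
  have e2 : b y - ord y k == 0 by rewrite -[_ == _]negbK; apply: nz => ?; do 3 left; right.
  have e3 : r y == 0 by rewrite -[_ == _]negbK; apply: nz => ?; do 2 left; right.
  have e4 : ord y (r x) == 0 by rewrite -[_ == _]negbK; apply: nz => ?; left; right.
  have e5 : ord y h - ord y k == 0 by rewrite -[_ == _]negbK; apply: nz => ?; right.
  split; try by apply/eqP; rewrite -subr_eq0.
  by right; split; [exact/eqP | rewrite (eqP e5) -(eqP e4) vge_ord].
- by split=> //; left.
Qed.

Lemma ext_exact a b r L M : is_lb L a -> is_lb M b ->
  short_exact L (extension a b r) M (row2 1 0) (\col_i (if i == 0 then 0 else 1)).
Proof.
move=> hL hM.
have mulA (u : 'rV[F]_1) : u *m row2 1 0 = row2 (u 0 0) 0.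
  by apply: row2P; rewrite !mxE big_ord1 !mxE /= ?mulr1 ?mulr0.
have mulB (v : 'rV[F]_2) : v *m \col_i (if i == 0 then 0 else 1) = const_mx (v 0 1).
  by apply/matrixP => i j; rewrite !ord1 mul2 !mxE /= mulr0 add0r mulr1.
split.
- move=> x u /hL hu; rewrite mulA /extension /= !row2E vge0 mulr0 subr0.
  by split.
- by move=> x v [hb _]; rewrite mulB; apply/hM; rewrite mxE.
- move=> x u _; rewrite mulA => h; apply/matrixP => i j; rewrite !ord1.
  by have := congr1 (fun w : 'rV_2 => w 0 0) h; rewrite !mxE.
- move=> x v [hb ha]; rewrite mulB; split=> [h|[u hu ->]]; last first.
    by apply/matrixP => i j; rewrite mulA row2E !mxE.
  have v1 : v 0 1 = 0 by have := congr1 (fun w : 'rV_1 => w 0 0) h; rewrite !mxE.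
  exists (const_mx (v 0 0)).
    by apply/hL; rewrite mxE; move: ha; rewrite v1 mulr0 subr0.
  by rewrite mulA mxE; apply: row2P; rewrite row2E.
- move=> x w /hM hw; exists (row2 (r x * w 0 0) (w 0 0)).
    by split; rewrite !row2E // subrr vge0.
  by rewrite mulB row2E; apply/matrixP => i j; rewrite !ord1 mxE.
Qed.

End Sheaves.

(** * Bundles isomorphic to their twist *)

Section Twist.
Variables (R : realType) (X : curve R) (T : sheaf X 1).
Local Notation F := (funfield X).
Local Notation C := R[i].
Local Notation point := (closed_point X).
Variables (tau : point -> int) (q : F).
Hypotheses (hT : is_lb T tau) (q0 : q != 0) (oq : forall x, ord x q = 2%:Z * tau x)
  (nT : ~ iso T (@OX _ X)).
Implicit Types (x y : point) (a b m : point -> int) (r : point -> F).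

(** A square root of [q] would trivialize [T]. *)
Lemma q_not_square c : q != c ^+ 2.
Proof.
apply/eqP => e; apply: nT; apply/(iso_lb hT (@OX_lb _ X)).
have c0 : c != 0 by apply: contraNneq q0 => c0; rewrite e c0 expr0n.
exists c^-1 => [|x]; first by rewrite invr_eq0.
by have := oq x; rewrite e ordX ordV; lia.
Qed.

Lemma norm_neq0 (x0 x1 : F) : x0 ^+ 2 = q * x1 ^+ 2 -> x0 = 0 /\ x1 = 0.
Proof.
move=> e; have [z1|z1] := eqVneq x1 0.
  by move: e; rewrite z1 expr0n mulr0 => /eqP; rewrite sqrf_eq0 => /eqP.
case/eqP: (q_not_square (x0 / x1)); rewrite expr_div_n e mulfK //.
by rewrite expf_neq0.
Qed.

Lemma complex_sqrt (c : C) : exists d : C, d ^+ 2 = c.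
Proof.
have [r hr] := closed_field_poly_normal ('X^2 - c%:P).
have sz : size ('X^2 - c%:P : {poly C}) = 3%N by rewrite size_XnsubC.
case: r hr => [|d r] hr.
  by move: sz; rewrite hr big_nil (monicP (monicXnsubC c (isT : (0 < 2)%N))) scale1r size_poly1.
exists d; apply/eqP; rewrite -subr_eq0.
have : root ('X^2 - c%:P) d by rewrite hr rootZ ?root_prod_XsubC ?inE ?eqxx // lead_coef_eq0 -size_poly_gt0 sz.
by rewrite /root !hornerE.
Qed.

(** The square of a section of [T], divided by [q], is a constant; then [q] is a square. *)
Lemma no_sections f : (forall x, vge x (tau x) f) -> f = 0.
Proof.
move=> hf; apply/eqP; apply: contraT => f0.
have [|c hc] := @L0_cst _ _ (f ^+ 2 / q).
  move=> x; rewrite -vge_div // oq add0r expr2.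
  have -> : 2%:Z * tau x = tau x + tau x by lia.
  exact: vgeM.
have [d hd] := complex_sqrt c.
have c0 : c != 0.
  apply: contraNneq f0 => c0; move/eqP: hc; rewrite c0 rmorph0.
  by rewrite mulf_eq0 invr_eq0 (negbTE q0) orbF sqrf_eq0.
have d0 : cst X d != 0 by rewrite fmorph_eq0 -sqrf_eq0 hd.
case/eqP: (q_not_square (f / cst X d)).
rewrite expr_div_n -rmorphXn hd -hc invf_div mulrC divfK //.
by rewrite expf_neq0.
Qed.

(** Multiplication by the root of [q] in the quadratic extension that it generates. *)
Definition twist_mx : 'M[F]_2 :=
  \matrix_(i, j) (if i == 0 then row2 0 1 0 j else row2 q 0 0 j).

Lemma twist_mxE v : v *m twist_mx = row2 (v 0 1 * q) (v 0 0).
Proof. by apply: row2P; rewrite mul2 !mxE /= ?mulr0 ?mulr1 ?add0r ?addr0. Qed.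

Lemma twist_mx_unit : twist_mx \in unitmx.
Proof. by rewrite unitmxE unitfE det2 !mxE /= mul0r sub0r oppr_eq0 mul1r. Qed.

(** As a section of [T], whose square is trivialized by [q], the function [r x] is a square
root of 1 modulo the divisor [m]. *)
Definition sqrt_mod m r := forall x, [/\ 0 <= m x, vge x (tau x) (r x) &
  vge x (m x + 2%:Z * tau x) (r x ^+ 2 - q)].

Section SqrtMod.
Variables (a m : point -> int) (r : point -> F).
Hypothesis hr : sqrt_mod m r.
Let b x := a x - m x - tau x.
Local Notation E := (extension a b r).

Lemma ext_twist x h v : h != 0 -> ord x h = tau x -> E x v -> E x (h^-1 *: (v *m twist_mx)).
Proof.
move=> h0 oh [hb ha]; have [m0 hr1 hr2] := hr x.
rewrite twist_mxE /extension /= !mxE /=.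
have h1 : vge x (b x + tau x) (v 0 0).
  rewrite -(subrK (r x * v 0 1) (v 0 0)); apply: vgeD.
    by apply: vgeW ha; rewrite /b; lia.
  by rewrite addrC vgeM.
split; first by rewrite mulrC -vge_div // oh.
have -> : h^-1 * (v 0 1 * q) - r x * (h^-1 * v 0 0) =
  (v 0 1 * (q - r x ^+ 2) - r x * (v 0 0 - r x * v 0 1)) / h by field.
rewrite -vge_div // oh; apply: vgeB; last by rewrite addrC vgeM.
rewrite -opprB mulrN vgeN; apply: (@vgeW _ _ _ (b x + (m x + 2%:Z * tau x))).
  by rewrite /b; lia.
exact: vgeM.
Qed.

(** The bundle is stable under multiplication by the square root of [q] up to the twist by
[T], and multiplication by it twice is an isomorphism. *)
Lemma ext_iso_tensor : iso E (tensor E T).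
Proof.
exists twist_mx; split=> [|x v]; first exact: twist_mx_unit.
have [h [h0 oh]] := exists_ord x (tau x).
rewrite (tensor_mem _ (ext_omodule a b r x) hT h0 oh); split; first exact: ext_twist.
move/(ext_twist h0 oh); rewrite -scalemxAl scalerA => hv.
have [_ _ EZ] := ext_omodule a b r x.
have -> : v = (h ^+ 2 / q) *: ((h^-1 * h^-1) *: (v *m twist_mx *m twist_mx)).
  rewrite !twist_mxE !row2E; apply: row2P; rewrite !mxE /= /row2 ?mxE /=; field; by rewrite h0 q0.
apply: EZ => //; rewrite -vge_div // vgeE ?expf_neq0 // ordX oh oq; lia.
Qed.

Lemma ext_norm x v : E x v -> vge x (2%:Z * a x - m x) (v 0 0 ^+ 2 - q * v 0 1 ^+ 2).
Proof.
move=> [hb ha]; have [m0 hr1 hr2] := hr x.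
have -> : v 0 0 ^+ 2 - q * v 0 1 ^+ 2 = (v 0 0 - r x * v 0 1) ^+ 2 +
  2%:R * ((v 0 0 - r x * v 0 1) * (r x * v 0 1)) + v 0 1 * v 0 1 * (r x ^+ 2 - q) by ring.
apply: vgeD; first apply: vgeD.
- apply: (@vgeW _ _ _ (a x + a x)); first by lia.
  by rewrite expr2 vgeM.
- rewrite -(rmorph_nat (cst X)); apply: vgeZ; apply: (@vgeW _ _ _ (a x + (tau x + b x))).
    by rewrite /b; lia.
  by apply: vgeM => //; apply: vgeM.
- apply: (@vgeW _ _ _ (b x + b x + (m x + 2%:Z * tau x))); first by rewrite /b; lia.
  by apply: vgeM => //; apply: vgeM.
Qed.

Hypotheses (fa : fin a) (fm : fin m) (dam : 2%:Z * deg a = deg m).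

Lemma fin_tau : fin tau.
Proof.
have /finP[s [us hs]] := @fin_ord _ X q; apply/finP; exists s; split=> // x /hs/eqP.
by rewrite oq mulf_eq0 => /eqP.
Qed.

Lemma deg_tau : deg tau = 0.
Proof.
have := deg_principal q; have -> : (fun x => ord x q) = (fun x => 2%:Z * tau x).
  by apply/funext.
by rewrite degM => [/eqP|]; [rewrite mulf_eq0 => /eqP | exact: fin_tau].
Qed.

Lemma fin_b : fin b. Proof. by apply: finB; [exact: finB | exact: fin_tau]. Qed.

Lemma deg_b : deg b = deg a - deg m.
Proof. by rewrite /b !degB ?deg_tau ?subr0 //; [exact: finB | exact: fin_tau]. Qed.

Lemma ext_degree0 : degree E = 0.
Proof. by rewrite ext_degree //; [rewrite deg_b -dam; ring | exact: fin_b]. Qed.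

(** The norm of the generator of a line subbundle is a non-zero function of order at least
[2 * a - m] relative to the square of the subbundle; and principal divisors have degree
zero. *)
Lemma ext_semistable : semistable E.
Proof.
move=> s L A hs; have {hs} s1 : s = 1%N by lia.
subst s => hL homA fA; rewrite ext_degree0 mul0r.
have [phi [fphi hphi]] := line_bundle_lb hL.
rewrite (degree_lb fphi hphi).
pose N := A 0 0 ^+ 2 - q * A 0 1 ^+ 2.
have N0 : N != 0.
  rewrite subr_eq0; apply/eqP => /norm_neq0[A0 A1]; move: fA.
  have -> : A = 0 by apply: row2P; rewrite ?A0 ?A1 mxE.
  by rewrite /row_free mxrank0.
suff : 2%:Z * deg a - deg m <= 2%:Z * deg phi + deg (fun x => ord x N).
  by rewrite deg_principal; lia.
rewrite -!degM // -degB //; last exact: finMn.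
rewrite -degD; [|exact: finMn|exact: fin_ord].
apply: deg_le => [||x].
- by apply: finB => //; exact: finMn.
- by apply: finD; [exact: finMn | exact: fin_ord].
have [h [h0 oh]] := exists_ord x (phi x).
have /homA/ext_norm : L x (const_mx h) by apply/hphi; rewrite mxE vgeE // oh.
have -> : ((const_mx h : 'M_1) *m A) 0 0 ^+ 2 - q * ((const_mx h : 'M_1) *m A) 0 1 ^+ 2 = h ^+ 2 * N.
  by rewrite !mxE !big_ord1 !mxE /N; ring.
by rewrite vgeE ?mulf_neq0 ?expf_neq0 // ordM ?expf_neq0 // ordX oh; lia.
Qed.

End SqrtMod.

(** Hensel's lemma for square roots. *)
Lemma sqrt_mod_exists x (k : nat) : exists r : F, ord x r = tau x /\ vge x (k%:Z + 2%:Z * tau x) (r ^+ 2 - q).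
Proof.
have [s [s0 os]] := exists_ord x (tau x).
have s20 : s ^+ 2 != 0 by rewrite expf_neq0.
have os2 : ord x (s ^+ 2) = 2%:Z * tau x by rewrite ordX os; lia.
suff [r [or hr]] : exists r : F, ord x r = tau x /\ vge x (k.+1%:Z + 2%:Z * tau x) (r ^+ 2 - q).
  by exists r; split=> //; apply: vgeW hr; lia.
elim: k => [|k [r [or hr]]].
  have : vge x 0 (q / s ^+ 2) by rewrite -vge_div // add0r os2 -oq vge_ord.
  case/residue => c hc; have [d hd] := complex_sqrt c.
  have c0 : c != 0.
    apply/eqP => c0; move: hc; rewrite c0 rmorph0 subr0 -vge_div // vgeE // os2 oq.
    by lia.
  have d0 : d != 0 by rewrite -sqrf_eq0 hd.
  have dX0 : cst X d != 0 by rewrite fmorph_eq0.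
  exists (cst X d * s); split; first by rewrite ordM // ord_cst add0r.
  rewrite exprMn -rmorphXn hd -os2 -[q](divfK s20) -mulrBl vgeMl //.
  by rewrite -opprB vgeN.
have r0 : r != 0.
  apply/eqP => r0; move: hr; rewrite r0 expr0n sub0r vgeN vgeE // oq; lia.
have n20 : (2%:R : F) != 0 by rewrite -(rmorph_nat (cst X)) fmorph_eq0 pnatr_eq0.
pose e := (q - r ^+ 2) / (2%:R * r).
have he : vge x (k.+1%:Z + tau x) e.
  rewrite -vge_div ?mulf_neq0 // ordM // or -(rmorph_nat (cst X)) ord_cst add0r.
  by rewrite -opprB vgeN; apply: vgeW hr; lia.
exists (r + e); split.
  by have [|_ ->//] := @ord_addl _ _ x r e r0; rewrite or; apply: vgeW he; lia.
have -> : (r + e) ^+ 2 - q = e * e by rewrite /e; field; rewrite n20 r0.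
apply: (@vgeW _ _ _ (k.+1%:Z + tau x + (k.+1%:Z + tau x))); first by lia.
exact: vgeM.
Qed.

End Twist.

Lemma twist_root (R : realType) (X : curve R) (T : sheaf X 1) :
  line_bundle T -> iso (tensor T T) (@OX _ X) ->
  exists tau q, [/\ is_lb T tau, q != 0 & forall x, ord x q = 2%:Z * tau x].
Proof.
move=> /line_bundle_lb[tau [ftau hT]] /(iso_lb (tensor_lb hT hT) (@OX_lb _ X))[f f0 hf].
exists tau, f^-1; split=> [//||x]; first by rewrite invr_eq0.
by have := hf x; rewrite ordV; lia.
Qed.

Lemma in_MT_of_iso (R : realType) (X : curve R) (K T : sheaf X 1) (E : sheaf X 2) :
  in_N E -> iso E (tensor E T) -> in_MT K T E 0.
Proof.
move=> [vE dE sE] [A hA]; split; last by exists A => //; rewrite mul0mx mulmx0.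
split=> //.
- move=> x v _; rewrite mulmx0; exists 0%N, (fun=> 0), (fun=> 0).
  by split=> [[]//|[]//|]; rewrite big_ord0.
- by move=> s F B psi hs vF hF fB _ _; apply: sE hF fB.
Qed.

(** By the inequality of Riemann there is an effective divisor in the class of [KT], and every
splitting of it into parts of degrees [delta] and [2 * g - 2 - delta] produces a bundle. *)
Lemma WT_nonempty (R : realType) (X : curve R) (K T : sheaf X 1) (g : nat) :
  canonical_bundle K -> genus K g -> (1 < g)%N ->
  line_bundle T -> iso (tensor T T) (@OX _ X) -> ~ iso T (@OX _ X) ->
  forall delta : nat, ~~ odd delta -> (delta <= 2 * g - 2)%N ->
  exists E : sheaf X 2, in_WT K T g delta E.
Proof.
move=> hK hg g1 lT T2 nT delta ev_delta led.
have [k [fk hk dk hR]] := canonical_riemann_roch hK hg.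
have [tau [q [hT q0 oq]]] := twist_root lT T2.
have ftau := fin_tau oq; have dtau := deg_tau oq.
have fkt : fin (fun x => - (k x + tau x)) by apply: finN; apply: finD.
have [|f [f0 hf]] := ell_gt0 fkt.
  by have := hR _ fkt; rewrite degN ?degD ?dk ?dtau //; [lia | exact: finD].
pose D0 x := ord x f - (k x + tau x).
have fD0 : fin D0 by apply: finB; [exact: fin_ord | exact: finD].
have [|s hs] := effective_pts fD0.
  by move=> x; have := hf x; rewrite opprK vgeE // /D0 subr_ge0.
have ss : size s = (2 * g - 2)%N.
  have := deg_pts s; rewrite -hs degB ?degD ?deg_principal ?dk ?dtau //;
    [lia | exact: fin_ord | exact: finD].
pose m := pts (drop delta s); pose dd := pts (take delta s).
have fm : fin m by exact: fin_pts.
have hD0 x : D0 x = dd x + m x.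
  by rewrite hs /dd /m /pts -[in LHS](cat_take_drop delta s) count_cat PoszD.
have dm : deg m = (2 * g - 2)%N%:Z - delta%:Z by rewrite deg_pts size_drop ss; lia.
have [x0 _] := exists_point X.
pose c : int := 1 - g%:Z + (delta./2)%:Z.
(* any line bundle of the right degree will do for [F0] *)
pose a x := - c * pts [:: x0] x.
have fa : fin a by apply: finMn; exact: fin_pts.
have da : deg a = - c by rewrite degM ?deg_pts ?mulr1 //; exact: fin_pts.
have dam : 2%:Z * deg a = deg m.
  by rewrite da dm /c; have := odd_double_half delta; rewrite (negbTE ev_delta); lia.
(* [r x] is 0 for almost all [x], as [ext_bundle] requires *)
have /choice[r hr] x : exists r : funfield X, [/\ 0 <= m x, vge x (tau x) r,
    vge x (m x + 2%:Z * tau x) (r ^+ 2 - q) & x \notin s -> r = 0].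
  have [xs|xs] := boolP (x \in s).
    have [r [or hr]] := sqrt_mod_exists q0 oq x `|m x|%N.
    exists r; split=> //; first by rewrite -or vge_ord.
  exists 0; rewrite vge0 expr0n sub0r vgeN vgeE // oq.
  have -> : m x = 0; last by rewrite add0r lexx.
  by rewrite /m /pts; apply/eqP; rewrite eqz_nat; apply/eqP/count_memPn; apply: contra xs; exact: mem_drop.
have hsq : sqrt_mod tau q m r by move=> x; case: (hr x).
have fr : finite_set [set x | r x != 0]%classic.
  apply: (@sub_finite_set _ _ [set` s]); last exact: finite_seq.
  by move=> x /=; apply: contraR => xs; case: (hr x) => _ _ _ ->.
pose b x := a x - m x - tau x.
have fb : fin b by apply: finB => //; apply: finB.
pose E := extension a b r.
have NE : in_N E.
  split; first exact: ext_bundle.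
    exact: (ext_degree0 oq).
  exact: (ext_semistable hT q0 oq nT hsq fa fm dam).
exists E; split; first by apply: in_MT_of_iso => //; apply: ext_iso_tensor hsq.
split=> //.
have std : size (take delta s) == delta by rewrite size_takel // ss.
pose F0 : sheaf X 1 := O_of (fun x => - a x).
pose F1 : sheaf X 1 := O_of (fun x => - b x).
have hF0 : is_lb F0 a.
  by have := @O_of_lb _ X (fun x => - a x); congr is_lb; apply/funext => x; rewrite opprK.
have hF1 : is_lb F1 b.
  by have := @O_of_lb _ X (fun x => - b x); congr is_lb; apply/funext => x; rewrite opprK.
exists F0, F1, (row2 1 0), (\col_i (if i == 0 then 0 else 1)), (Tuple std).
split.
- exact: lb_line_bundle hF0.
- exact: lb_line_bundle hF1.
- exact: ext_exact.
- apply/(iso_lb hF1 (tensor_lb (tensor_lb hF0 hk) (O_minus_lb (Tuple std)))).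
  exists f => // x; have := hD0 x; rewrite /D0 /b /dd /=; lia.
- by rewrite (degree_lb fa hF0) da opprK.
Qed.

(** * Etale double covers *)

Section Cover.
Variables (R : realType) (X Y : curve R) (p : morphism Y X) (sigma : morphism Y Y).
Local Notation iota := (comorph p).
Local Notation sg := (comorph sigma).
Local Notation sgp := (on_points sigma).
Hypotheses (et : etale p) (hs : exchanges_sheets p sigma).
Implicit Types (y : closed_point Y) (x : closed_point X) (f : funfield X) (z : funfield Y).

Lemma sg_iota f : sg (iota f) = iota f. Proof. by case: hs. Qed.
Lemma sgK z : sg (sg z) = z. Proof. by case: hs. Qed.

(** A local homomorphism preserves units, and an unramified one preserves uniformizers. *)
Lemma ord_pull y f : ord y (iota f) = ord (on_points p y) f.
Proof.
have [->|f0] := eqVneq f 0; first by rewrite rmorph0 !ord_zero.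
have unit u : u != 0 -> ord (on_points p y) u = 0 -> ord y (iota u) = 0.
  move=> u0 ou.
  have := @comorph_regular _ _ _ p y u; have := @comorph_regular _ _ _ p y u^-1.
  rewrite /regular ordV ou oppr0 fmorphV ordV => h1 h2.
  by apply/eqP; rewrite eq_le h2 // andbT -oppr_ge0 h1.
have [s [s0 os]] := uniformizer (on_points p y).
have := unit (f / s ^ ord (on_points p y) f).
rewrite mulf_neq0 ?invr_eq0 ?expfz_neq0 // ordM ?invr_eq0 ?expfz_neq0 // ordV ordXz os mul1r subrr.
rewrite rmorphM fmorphV ordM ?invr_eq0 ?fmorph_eq0 ?expfz_neq0 // ordV => /(_ isT erefl).
have -> : iota (s ^ ord (on_points p y) f) = iota s ^ ord (on_points p y) f.
  by rewrite rmorphXz // unitfE.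
by rewrite ordXz (et os) mul1r; lia.
Qed.

Lemma vge_pull y (k : int) f : vge y k (iota f) = vge (on_points p y) k f.
Proof. by rewrite /vge fmorph_eq0 ord_pull. Qed.

(** The involution multiplies orders by a positive integer, which is 1 because it is
invertible. *)
Lemma ord_sigma y z : ord (sgp y) z = ord y (sg z).
Proof.
have [->|z0] := eqVneq z 0; first by rewrite rmorph0 !ord_zero.
have unit u : u != 0 -> ord (sgp y) u = 0 -> ord y (sg u) = 0.
  move=> u0 ou.
  have := @comorph_regular _ _ _ sigma y u; have := @comorph_regular _ _ _ sigma y u^-1.
  rewrite /regular ordV ou oppr0 fmorphV ordV => h1 h2.
  by apply/eqP; rewrite eq_le h2 // andbT -oppr_ge0 h1.
have [s [s0 os]] := uniformizer (sgp y).
have key u : u != 0 -> ord y (sg u) = ord y (sg s) * ord (sgp y) u.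
  move=> u0; have := unit (u / s ^ ord (sgp y) u).
  rewrite mulf_neq0 ?invr_eq0 ?expfz_neq0 // ordM ?invr_eq0 ?expfz_neq0 // ordV ordXz os mul1r subrr.
  rewrite rmorphM fmorphV ordM ?invr_eq0 ?fmorph_eq0 ?expfz_neq0 // ordV => /(_ isT erefl).
  have -> : sg (s ^ ord (sgp y) u) = sg s ^ ord (sgp y) u by rewrite rmorphXz // unitfE.
  by rewrite ordXz; lia.
have pos : 0 < ord y (sg s) by apply: comorph_local; rewrite os.
have [t [t0 ot]] := uniformizer y.
have e1 : ord y (sg s) = 1.
  have := key (sg t); rewrite fmorph_eq0 sgK ot => /(_ t0).
  move: (ord y (sg s)) pos (ord _ (sg t)) => a a0 b e.
  have b1 : 0 < b by nia.
  by nia.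
by rewrite key // e1 mul1r.
Qed.

Lemma vge_sigma y (k : int) z : vge (sgp y) k z = vge y k (sg z).
Proof. by rewrite /vge fmorph_eq0 ord_sigma. Qed.

Lemma sgpK y : sgp (sgp y) = y.
Proof. by apply: point_ext => z; rewrite !ord_sigma sgK. Qed.

Lemma p_sigma y : on_points p (sgp y) = on_points p y.
Proof. by apply: point_ext => f; rewrite -!ord_pull ord_sigma sg_iota. Qed.

Lemma two_neq0 : (2%:R : funfield Y) != 0.
Proof. by rewrite -(rmorph_nat (cst Y)) fmorph_eq0 pnatr_eq0. Qed.

Lemma vge_half y (k : int) z : vge y k (2%:R * z) = vge y k z.
Proof.
rewrite -(rmorph_nat (cst Y)); apply/idP/idP; last exact: vgeZ.
by move/(vgeZ (2%:R)^-1); rewrite mulrA -rmorphM mulVf ?rmorph1 ?mul1r // pnatr_eq0.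
Qed.

Lemma antiinvariant_exists : exists z : funfield Y, z != 0 /\ sg z = - z.
Proof.
have [_ _ [z hz]] := hs; exists (z - sg z); rewrite subr_eq0 rmorphB sgK opprB.
by split=> //; apply/eqP => e; apply: hz.
Qed.

Section Basis.
Variables (b : 'rV[funfield Y]_2) (w : funfield Y).
Hypotheses (hb : is_basis p b) (w0 : w != 0) (sw : sg w = - w).

Definition from_coord (v : 'rV[funfield X]_2) : funfield Y := iota (v 0 0) + iota (v 0 1) * w.

(** Apply the involution and solve for [v 0 0] and [v 0 1] * [w]. *)
Lemma coord0 v : from_coord v = 0 -> v = 0.
Proof.
move=> e; have e' : iota (v 0 0) - iota (v 0 1) * w = 0.
  by have := congr1 sg e; rewrite rmorphD rmorphM !sg_iota sw rmorph0 mulrN.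
have h0 : iota (v 0 0) = 0.
  apply: (mulfI two_neq0); rewrite mulr0 -[RHS](addr0 0) -{1}e -e' /from_coord; ring.
have h1 : iota (v 0 1) * w = 0 by rewrite -[RHS]e /from_coord h0 add0r.
apply: row2P; rewrite mxE; first by apply/eqP; rewrite -(fmorph_eq0 iota) h0.
by move/eqP: h1; rewrite mulf_eq0 (negbTE w0) orbF fmorph_eq0 => /eqP.
Qed.

(** By [coord0] the matrix of [1, w] in the given basis is invertible. *)
Lemma basis_change : exists2 P : 'M[funfield X]_2, P \in unitmx &
  forall v : 'rV[funfield X]_2, \sum_j iota (v 0 j) * b 0 j = from_coord (v *m P).
Proof.
have [v1 [h1 _]] := hb 1; have [v2 [h2 _]] := hb w.
pose M : 'M[funfield X]_2 := \matrix_(i, j) (if i == 0 then v1 0 j else v2 0 j).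
have hM u : \sum_j iota ((u *m M) 0 j) * b 0 j = from_coord u.
  rewrite /from_coord -[iota (u 0 0)]mulr1 h1 h2 !mulr_sumr -big_split /=.
  by apply: eq_bigr => j _; rewrite mul2 !mxE /= rmorphD !rmorphM; ring.
have uM : M \in unitmx.
  rewrite unitmxE unitfE; apply/negP => /det0P[u u0 hu].
  case/eqP: u0; apply: coord0; rewrite -hM hu big1 // => j _.
  by rewrite mxE rmorph0 mul0r.
exists (invmx M) => [|v]; first by rewrite unitmx_inv.
by rewrite -hM mulmxKV.
Qed.

Lemma coord_surj z : exists v, z = from_coord v.
Proof.
have [P uP hP] := basis_change; have [v [hv _]] := hb z.
by exists (v *m P); rewrite -hP.
Qed.

Lemma invariant_pull z : sg z = z -> exists f, z = iota f.
Proof.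
move=> e; have [v hv] := coord_surj z; exists (v 0 0).
have h : iota (v 0 1) * w = - (iota (v 0 1) * w).
  apply: (addrI (iota (v 0 0))); rewrite -/(from_coord v) -hv -[LHS]e hv rmorphD rmorphM.
  by rewrite !sg_iota sw mulrN.
have h0 : iota (v 0 1) * w = 0.
  apply: (mulfI two_neq0); rewrite mulr0 mulr_natl mulr2n {1}h addNr //.
by rewrite hv /from_coord h0 addr0.
Qed.

Lemma square_pull : exists2 q : funfield X, q != 0 & w ^+ 2 = iota q.
Proof.
have [|q hq] := @invariant_pull (w ^+ 2); first by rewrite rmorphXn sw sqrrN.
by exists q => //; rewrite -(fmorph_eq0 iota) -hq expf_neq0.
Qed.

(** The residue field does not grow and uniformizers pull back to uniformizers, so that a
function on [Y] has the same expansions at a point as functions on [X]. *)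
Lemma approx_pull y z (k : int) : exists f, vge y k (z - iota f).
Proof.
have [s [s0 os]] := uniformizer (on_points p y).
have os' : ord y (iota s) = 1 by apply: et.
have s0' : iota s != 0 by rewrite fmorph_eq0.
suff h (n : nat) : exists f, vge y (ord y z + n%:Z) (z - iota f).
  by have [f hf] := h `|(k - ord y z)%R|%N; exists f; apply: vgeW hf; lia.
elim: n => [|n [f hf]].
  exists 0; rewrite (rmorph0 iota) [z - 0]subr0; apply: vgeW (vge_ord y z); lia.
have [c hc] := leading_coef hf os' s0'.
exists (f + cst X c * s ^ (ord y z + n%:Z)).
rewrite rmorphD rmorphM comorph_cst rmorphXz ?unitfE // opprD addrA.
by apply: vgeW hc; lia.
Qed.

(** Otherwise the unit [w / u], with [u] on [X], takes a value equal to its opposite. *)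
Lemma sigma_neq y : sgp y != y.
Proof.
have [q q0 hq] := square_pull; have oq : ord y w * 2%:Z = ord (on_points p y) q.
  by rewrite -ord_pull -hq ordX; lia.
have [u [u0 ou]] := exists_ord (on_points p y) (ord y w).
have iu0 : iota u != 0 by rewrite fmorph_eq0.
have : vge y 0 (w / iota u) by rewrite -vge_div // ord_pull ou add0r vge_ord.
case/residue => c hc; apply/eqP => e.
have := hc; rewrite -{1}e vge_sigma rmorphB rmorphM fmorphV sg_iota sw.
rewrite comorph_cst => hc'.
have h0 : vge y 1 (w / iota u).
  have := vgeB hc hc'.
  have -> : w / iota u - cst Y c - (- w / iota u - cst Y c) = 2%:R * (w / iota u) by ring.
  by rewrite vge_half.
by move: h0; rewrite -vge_div // ord_pull ou vgeE //; lia.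
Qed.

(** If [y'] were a third point then [z + sg z], for [z] non-zero at [y] and zero at the other
three points, would be a function on [X] that vanishes at [y'] but not at [y]. *)
Lemma fibre y y' : on_points p y' = on_points p y -> y' = y \/ y' = sgp y.
Proof.
move=> e; have [|n1] := eqVneq y' y; first by left.
have [|n2] := eqVneq y' (sgp y); first by right.
have ny : y \notin [:: sgp y; y'; sgp y'].
  have m1 : y != sgp y by rewrite eq_sym sigma_neq.
  have m2 : y != y' by rewrite eq_sym.
  have m3 : y != sgp y' by apply: contra n2 => /eqP ->; rewrite sgpK.
  apply/negP => /orP[/eqP e1|/orP[/eqP e1|/orP[/eqP e1|//]]].
  + by move/eqP: m1; apply.
  + by move/eqP: m2; apply.
  + by move/eqP: m3; apply.
have [z [z0 oz hz]] := weak_approx 0 1 ny.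
have [|f hf] := @invariant_pull (z + sg z); first by rewrite rmorphD sgK addrC.
have : vge y' 1 (z + sg z).
  apply: vgeD; first by apply: hz; rewrite !inE eqxx orbT.
  by rewrite -vge_sigma; apply: hz; rewrite !inE eqxx !orbT.
have [|n0 on] := @ord_addl _ _ y z (sg z) z0.
  by rewrite oz -vge_sigma; apply: hz; rewrite !inE eqxx.
rewrite hf vge_pull e -vge_pull -hf vgeE // on oz; lia.
Qed.

End Basis.
End Cover.

Section RootCover.
Variables (R : realType) (X Y : curve R) (T : sheaf X 1) (p : morphism Y X)
  (sigma : morphism Y Y) (b : 'rV[funfield Y]_2) (tau : closed_point X -> int)
  (q0 : funfield X).
Local Notation iota := (comorph p).
Local Notation sg := (comorph sigma).
Local Notation sgp := (on_points sigma).
Hypotheses (hcov : etale_double_cover T p b) (hs : exchanges_sheets p sigma)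
  (hT : is_lb T tau) (q00 : q0 != 0) (oq0 : forall x, ord x q0 = 2%:Z * tau x)
  (nT : ~ iso T (@OX _ X)).

Lemma sum_OX_T x u : direct_sum (@OX _ X) T x u <-> vge x 0 (u 0 0) /\ vge x (tau x) (u 0 1).
Proof.
rewrite /direct_sum /= (OX_lb x _) (hT x _) !mxE.
have -> : lshift 1 (0 : 'I_1) = 0 :> 'I_2 by apply: ord_inj.
by have -> : rshift 1 (0 : 'I_1) = 1 :> 'I_2 by apply: ord_inj.
Qed.

(** A stalk of a direct image at a point outside the image of [p] contains all functions,
unlike the stalks of a bundle. *)
Lemma point_over x : exists y, on_points p y = x.
Proof.
apply: contrapT => /forallNP no; have [et hb [A [uA hA]]] := hcov.
have [s [s0 os]] := exists_ord x (-1).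
have := (hA x (row2 s 0 *m invmx A)).1; rewrite mulmxKV // sum_OX_T row2E vgeE // os.
by case=> // y /no.
Qed.

(** An anti-invariant function [w] is a root of a function [q] on [X].  In the basis [1, w] the
direct image of the structure sheaf is the sum of the structure sheaf and of the line
bundle with orders [- ord w]; comparison with the sum of [O] and [T] shows that the latter
is isomorphic to [T], as there is no map from [O] to [T], and [w] is corrected by this
isomorphism. *)
Lemma cover_root : exists (w : funfield Y) (q : funfield X), [/\ w != 0, sg w = - w, q != 0, w ^+ 2 = iota q &
  (forall x, ord x q = 2%:Z * tau x) /\ forall y, ord y w = tau (on_points p y)].
Proof.
have [et hb [A [uA hA]]] := hcov.
have [w [w0 sw]] := antiinvariant_exists hs.
have [q qn0 hq] := square_pull hs hb w0 sw.
have [P uP hP] := basis_change hs hb w0 sw.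
pose om x := (ord x q %/ 2)%Z.
have ow y : ord y w = om (on_points p y) /\ ord (on_points p y) q = om (on_points p y) * 2%:Z.
  have e : ord (on_points p y) q = ord y w * 2%:Z.
    by rewrite -(ord_pull et) -hq ordX; lia.
  by rewrite /om e mulzK.
pose N := invmx P *m A.
have uN : N \in unitmx by rewrite unitmx_mul unitmx_inv uP.
  have hN x (u : 'rV[funfield X]_2) : (vge x 0 (u 0 0) /\ vge x (- om x) (u 0 1)) <->
    (vge x 0 ((u *m N) 0 0) /\ vge x (tau x) ((u *m N) 0 1)).
  rewrite -sum_OX_T /N mulmxA -hA /pushforward /=.
  have e y : on_points p y = x -> (OX Y y (const_mx (\sum_j iota ((u *m invmx P) 0 j) * b 0 j)) <->
      vge y 0 (iota (u 0 0) + iota (u 0 1) * w)).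
    by move=> _; rewrite (OX_lb y _) mxE hP mulmxKV.
  have [y0 hy0] := point_over x; split=> [[h1 h2] y yx|h].
    apply/(e y yx); apply: vgeD; first by rewrite vge_pull // yx.
    rewrite -[0](addNr (ord y w)); apply: vgeM; last exact: vge_ord.
    by rewrite vge_pull // (ow y).1 yx.
  have a1 := (e y0 hy0).1 (h y0 hy0).
  have a2 : vge y0 0 (iota (u 0 0) - iota (u 0 1) * w).
    have sx : on_points p (sgp y0) = x by rewrite (p_sigma et hs).
    have := (e _ sx).1 (h _ sx); rewrite (vge_sigma hs) rmorphD rmorphM !(sg_iota hs) sw.
    by rewrite mulrN.
  split.
    rewrite -hy0 -(vge_pull et) -vge_half.
    have -> : 2%:R * iota (u 0 0) = (iota (u 0 0) + iota (u 0 1) * w) +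
       (iota (u 0 0) - iota (u 0 1) * w) by ring.
    exact: vgeD.
  rewrite -hy0 -(vge_pull et) -(ow y0).1 -(vgeMl y0 _ _ w0) addNr -vge_half.
  have -> : 2%:R * (iota (u 0 1) * w) = (iota (u 0 0) + iota (u 0 1) * w) -
     (iota (u 0 0) - iota (u 0 1) * w) by ring.
  exact: vgeB.
have n01 : N 0 1 = 0.
  apply: (no_sections hT q00 oq0 nT) => x.
  have [|_] := (hN x (row2 1 0)).1; first by rewrite !row2E vge0 vgeE ?oner_eq0 // ord_one.
  by rewrite mul2 !row2E mul1r mul0r addr0.
have dN : N 0 0 != 0 /\ N 1 1 != 0.
  move: uN; rewrite unitmxE unitfE det2 n01 mul0r subr0 mulf_eq0 negb_or.
  by case/andP.
have [n00 n11] := dN.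
have key x c : vge x (- om x) c = vge x (tau x) (c * N 1 1).
  apply/idP/idP => h.
    have [|_] := (hN x (row2 0 c)).1; first by rewrite !row2E vge0.
    by rewrite mul2 !row2E mul0r add0r.
  have [|_] := (hN x (row2 (- (c * N 1 0) / N 0 0) c)).2; last by rewrite row2E.
  rewrite !mul2 !row2E divfK // addNr vge0 n01 mulr0 add0r; by split.
have tauE x : tau x = ord x (N 1 1) - om x.
  apply/eqP; rewrite eq_le; apply/andP; split.
    have [h [h0 oh]] := exists_ord x (- om x).
    have := key x h; rewrite !vgeE ?mulf_neq0 // oh lexx ordM // oh => /esym; lia.
  have [h [h0 oh]] := exists_ord x (tau x - ord x (N 1 1)).
  have := key x h; rewrite !vgeE ?mulf_neq0 // ordM // oh subrK lexx; lia.
have in11 : iota (N 1 1) != 0 by rewrite fmorph_eq0.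
have oy y : ord y (iota (N 1 1) / w) = tau (on_points p y).
  by rewrite ordM ?invr_eq0 // ordV (ord_pull et) tauE (ow y).1.
exists (iota (N 1 1) / w), (N 1 1 ^+ 2 / q); split.
- by rewrite mulf_neq0 ?invr_eq0.
- by rewrite rmorphM fmorphV (sg_iota hs) sw invrN mulrN.
- by rewrite mulf_neq0 ?expf_neq0 ?invr_eq0.
- by rewrite expr_div_n hq rmorphM fmorphV rmorphXn.
split=> // x; have [y <-] := point_over x.
rewrite ordM ?expf_neq0 ?invr_eq0 // ordV ordX (ow y).2 tauE; lia.
Qed.

End RootCover.

(** * Direct images from the double cover *)

Section DirectImage.
Variables (R : realType) (X Y : curve R) (p : morphism Y X) (sigma : morphism Y Y)
  (b : 'rV[funfield Y]_2) (w : funfield Y) (q : funfield X)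
  (tau : closed_point X -> int) (P : 'M[funfield X]_2).
Local Notation iota := (comorph p).
Local Notation sg := (comorph sigma).
Local Notation sgp := (on_points sigma).
Hypotheses (et : etale p) (hs : exchanges_sheets p sigma) (hb : is_basis p b)
  (w0 : w != 0) (sw : sg w = - w) (hq : w ^+ 2 = iota q)
  (ow : forall y, ord y w = tau (on_points p y))
  (hP : forall v : 'rV[funfield X]_2, \sum_j iota (v 0 j) * b 0 j = from_coord p w (v *m P)).
Implicit Types (y : closed_point Y) (x : closed_point X) (v : 'rV[funfield X]_2).

Lemma sg_coord v : sg (from_coord p w v) = iota (v 0 0) - iota (v 0 1) * w.
Proof. by rewrite rmorphD rmorphM !(sg_iota hs) sw mulrN. Qed.

(** With [r] in place of [w] up to order [m]: the conjugate [v0 - v1 w] is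
[(v0 - r v1) + v1 (r - w)], and [v0 + v1 w] differs from it by [2 v1 w], which may have
the order [a - m]. *)
Lemma coord_lattice y (a m : int) r v : 0 <= m ->
  vge y (m + tau (on_points p y)) (iota r - w) ->
  (vge y (a - m) (from_coord p w v) /\ vge (sgp y) a (from_coord p w v)) <->
  (vge (on_points p y) (a - m - tau (on_points p y)) (v 0 1) /\
   vge (on_points p y) a (v 0 0 - r * v 0 1)).
Proof.
move=> m0 hr; rewrite (vge_sigma hs) sg_coord -!(vge_pull et) rmorphB rmorphM /from_coord.
set t := tau _ in hr *; have oy : ord y w = t by rewrite ow.
move: (iota (v 0 0)) (iota (v 0 1)) (iota r) hr => v0 v1 s hr; split=> [[h1 h2]|[h1 h2]].
  have hv1 : vge y (a - m - t) v1.
    rewrite -(vgeMl y _ _ w0) oy subrK -vge_half.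
    have -> : 2%:R * (v1 * w) = (v0 + v1 * w) - (v0 - v1 * w) by ring.
    by apply: vgeB => //; apply: vgeW h2; lia.
  split=> //; have -> : v0 - s * v1 = (v0 - v1 * w) - v1 * (s - w) by ring.
  by apply: vgeB => //; apply: (@vgeW _ _ _ (a - m - t + (m + t))); [lia | apply: vgeM].
have h3 : vge y a (v0 - v1 * w).
  have -> : v0 - v1 * w = (v0 - s * v1) + v1 * (s - w) by ring.
  by apply: vgeD => //; apply: (@vgeW _ _ _ (a - m - t + (m + t))); [lia | apply: vgeM].
split=> //; have -> : v0 + v1 * w = (v0 - v1 * w) + 2%:R * (v1 * w) by ring.
apply: vgeD; first by apply: vgeW h3; lia.
by rewrite vge_half -[a - m](subrK t) -oy vgeMl // oy.
Qed.

Lemma root_mod y (m : int) r : 0 <= m -> vge y (m + tau (on_points p y)) (iota r - w) ->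
  vge (on_points p y) (tau (on_points p y)) r /\
  vge (on_points p y) (m + 2%:Z * tau (on_points p y)) (r ^+ 2 - q).
Proof.
move=> m0 hr; rewrite -!(vge_pull et) rmorphB rmorphXn -hq.
have h1 : vge y (tau (on_points p y)) (iota r - w) by apply: vgeW hr; lia.
have h2 : vge y (tau (on_points p y)) w by rewrite -ow vge_ord.
split; first by rewrite -(subrK w (iota r)) vgeD.
have -> : iota r ^+ 2 - w ^+ 2 = (iota r - w) * (iota r - w + (w + w)) by ring.
apply: (@vgeW _ _ _ (m + tau (on_points p y) + tau (on_points p y))); first by lia.
by apply: vgeM => //; apply: vgeD => //; apply: vgeD.
Qed.

(** In [r ^+ 2 - w ^+ 2 = (r - w) * (r + w)] the factors differ by [2 w], of order [tau], so
that one of them is not divisible by more than [tau]; and the involution exchanges them. *)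
Lemma mod_root y (m : int) r : 0 <= m -> vge (on_points p y) (tau (on_points p y)) r ->
  vge (on_points p y) (m + 2%:Z * tau (on_points p y)) (r ^+ 2 - q) ->
  vge y (m + tau (on_points p y)) (iota r - w) \/
  vge (sgp y) (m + tau (on_points p y)) (iota r - w).
Proof.
move=> m0; rewrite (vge_sigma hs) rmorphB (sg_iota hs) sw opprK -!(vge_pull et).
rewrite rmorphB rmorphXn -hq; set t := tau _; move: (iota r) => s h1 h2.
have oy : ord y w = t by rewrite ow.
have hw : vge y t w by rewrite -oy vge_ord.
have e : s ^+ 2 - w ^+ 2 = (s - w) * (s + w) by ring.
have [h3|h3] := boolP (vge y (t + 1) (s - w)).
  left; have n2 : 2%:R * w != 0 by rewrite mulf_neq0 // two_neq0.
  have o2 : ord y (2%:R * w) = t.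
    by rewrite ordM ?two_neq0 // -(rmorph_nat (cst Y)) ord_cst add0r.
  have [|n3 o3] := @ord_addl _ _ y (2%:R * w) (s - w) n2; first by rewrite o2.
  have e3 : 2%:R * w + (s - w) = s + w by ring.
  rewrite e3 in n3 o3; rewrite -(vgeMl y _ _ n3) o3 o2 -e.
  by apply: vgeW h2; lia.
right; have n3 : s - w != 0 by apply: contraNneq h3 => ->; rewrite vge0.
have o3 : ord y (s - w) <= t by move: h3; rewrite vgeE //; lia.
rewrite -(vgeMl y _ _ n3) mulrC -e; apply: vgeW h2; lia.
Qed.

Lemma pullback_lb (L : sheaf X 1) a : is_lb L a ->
  is_lb (pullback p L) (fun y => a (on_points p y)).
Proof.
move=> hL y v; split=> [[k [c [s [hc hS ->]]]]|hv].
  rewrite summxE; apply: vge_sum => i _; rewrite mxE -[a _]add0r.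
  apply: vgeM; first exact/regularE.
  by have [u /hL hu <-] := hS i; rewrite mxE (vge_pull et).
have [h [h0 oh]] := exists_ord (on_points p y) (a (on_points p y)).
have ih0 : iota h != 0 by rewrite fmorph_eq0.
exists 1%N, (fun=> v 0 0 / iota h), (fun=> map_mx iota (const_mx h)); split.
- by move=> _; apply/regularE; rewrite -vge_div // (ord_pull et) oh add0r.
- by move=> _; exists (const_mx h) => //; apply/hL; rewrite mxE -oh vge_ord.
- by apply/matrixP => i j; rewrite big_ord1 !ord1 !mxE divfK.
Qed.

(** The fibre consists of [y] and its conjugate. *)
Lemma pts_pull (s : seq (closed_point Y)) y :
  pts (map (on_points p) s) (on_points p y) = pts s y + pts s (sgp y).
Proof.
rewrite /pts; elim: s => //= y' s IH; rewrite !PoszD IH.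
suff -> : (on_points p y' == on_points p y)%:Z = (y' == y)%:Z + (y' == sgp y)%:Z by lia.
have n1 := sigma_neq et hs hb w0 sw y.
have [->|n2] := eqVneq y' y; first by rewrite eqxx eq_sym (negbTE n1).
have [->|n3] := eqVneq y' (sgp y); first by rewrite (p_sigma et hs) eqxx.
rewrite (introF eqP) // => e; case: (fibre et hs hb w0 sw e) => e'.
  by rewrite e' eqxx in n2.
by rewrite e' eqxx in n3.
Qed.

(** Above [x] lie the point [pt x], where poles of order [m x] are allowed, and its conjugate,
where none are; [coord_lattice] translates this into conditions on coordinates. *)
Lemma direct_image_extension (L : sheaf X 1) a k (D : k.-tuple (closed_point Y))
    (pt : closed_point X -> closed_point Y) m r :
  is_lb L a -> (forall x, on_points p (pt x) = x) ->
  (forall x, pts D (sgp (pt x)) = 0) -> (forall x, m x = pts D (pt x)) ->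
  (forall x, vge (pt x) (m x + tau x) (iota (r x) - w)) ->
  forall x v, pushforward p b (tensor (pullback p L) (O_plus D)) x v <->
    extension a (fun x => a x - m x - tau x) r x (v *m P).
Proof.
move=> hL hpt hD hm hr x v.
have m0 : 0 <= m x by rewrite hm.
have := hr x; rewrite -[tau x](congr1 tau (hpt x)) => hrx.
have := @coord_lattice (pt x) (a x) (m x) (r x) (v *m P) m0 hrx.
rewrite !hpt /extension /= => <-.
have hT := tensor_lb (pullback_lb hL) (O_plus_lb D).
have e y : on_points p y = x -> (tensor (pullback p L) (O_plus D) y
    (const_mx (\sum_j iota (v 0 j) * b 0 j)) <->
    vge y (a x - pts D y) (from_coord p w (v *m P))).
  by move=> yx; rewrite (hT y _) mxE hP yx.
split=> [h|[h1 h2] y yx].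
  split; first by rewrite hm; apply/(e _ (hpt x))/h.
  have sx : on_points p (sgp (pt x)) = x by rewrite (p_sigma et hs).
  by rewrite -[a x]subr0 -(hD x); apply/(e _ sx)/h.
apply/(e y yx); have := fibre et hs hb w0 sw (etrans yx (esym (hpt x))).
by case=> ->; rewrite -?hm // hD subr0.
Qed.

End DirectImage.

(** * Transport along isomorphisms *)

Section Transport.
Variables (R : realType) (X : curve R).
Local Notation F := (funfield X).
Implicit Types (x : closed_point X).

Lemma iso_by_inv r (E E' : sheaf X r) Q : iso_by E E' Q -> iso_by E' E (invmx Q).
Proof.
move=> [uQ hQ]; split=> [|x v]; first by rewrite unitmx_inv.
by rewrite hQ mulmxKV.
Qed.

Lemma iso_by_trans r (E E' E'' : sheaf X r) Q Q' :
  iso_by E E' Q -> iso_by E' E'' Q' -> iso_by E E'' (Q *m Q').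
Proof.
move=> [uQ hQ] [uQ' hQ']; split=> [|x v]; first by rewrite unitmx_mul uQ.
by rewrite hQ hQ' mulmxA.
Qed.

Lemma iso_by_frame r (E E' : sheaf X r) Q x A : iso_by E E' Q -> is_frame E x A ->
  is_frame E' x (A *m Q).
Proof.
move=> [uQ hQ] hA; have [uA _] := hA; have u : A *m Q \in unitmx by rewrite unitmx_mul uA.
apply: frameP => // v; rewrite -[v in E' x v](mulmxKV uQ) -hQ (frame_mem _ hA).
have -> // : v *m invmx (A *m Q) = v *m invmx Q *m invmx A.
by rewrite -[RHS](mulmxK u) mulmxA (mulmxKV uA) (mulmxKV uQ).
Qed.

Lemma iso_by_tensor r (E E' : sheaf X r) L n Q : vector_bundle E -> is_lb L n ->
  iso_by E E' Q -> iso_by (tensor E L) (tensor E' L) Q.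
Proof.
move=> vE hL hQ; have [uQ hQE] := hQ; split=> // x v.
have [h [h0 oh]] := exists_ord x (n x); have [A hA] := bundle_frame x vE.
rewrite (tensor_mem v (frame_omodule hA) hL h0 oh).
rewrite (tensor_mem _ (frame_omodule (iso_by_frame hQ hA)) hL h0 oh).
by rewrite hQE scalemxAl.
Qed.

Lemma iso_by_exact r s t (L : sheaf X r) (E E' : sheaf X s) (M : sheaf X t) A B Q :
  iso_by E E' Q -> short_exact L E' M A B -> short_exact L E M (A *m invmx Q) (Q *m B).
Proof.
move=> [uQ hQ] [h1 h2 h3 h4 h5]; split.
- by move=> x u /h1 hu; rewrite hQ -mulmxA mulmxKV.
- by move=> x v /hQ/h2; rewrite mulmxA.
- move=> x u Lu e; apply: h3 Lu _.
  by rewrite -(mulmxKV uQ A) mulmxA e mul0mx.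
- move=> x v /hQ/h4; rewrite mulmxA => ->; split=> -[u Lu e]; exists u => //.
    by rewrite mulmxA -e mulmxK.
  by rewrite e -mulmxA mulmxKV.
- move=> x y /h5[v Ev ->]; exists (v *m invmx Q); first by rewrite hQ mulmxKV.
  by rewrite -mulmxA mulKmx.
Qed.

Lemma degree_iso (E : sheaf X 2) a b r Q : fin a -> fin b ->
  iso_by E (extension a b r) Q -> degree E = - (deg a + deg b).
Proof.
move=> fa fb hQ; have /choice[h /choice[k hk]] x := ext_frame_exists a b r x.
rewrite (@degree_frames _ _ _ _ (fun x => ext_frame x (h x) (k x) r *m invmx Q)); last first.
  by move=> x; apply: iso_by_frame (iso_by_inv hQ) _; case: (hk x).
have dQ : \det Q != 0 by have [uQ _] := hQ; rewrite -unitfE -unitmxE.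
have fab : fin (fun x => a x + b x) by exact: finD.
rewrite -degD // -[RHS]addr0 -(deg_principal (\det Q)) -degN // -degD; last 2 first.
- exact: finN.
- exact: fin_ord.
congr deg; apply/funext => x; have [h0 k0 oh ok _] := hk x.
rewrite det_mulmx det_inv; have [-> _] := ext_frame_unit x r h0 k0.
by rewrite !ordM ?mulf_neq0 ?invr_eq0 // ordV oh ok opprB addrC.
Qed.

End Transport.

(** * Bundles isomorphic to their twist are extensions *)

Section Untwist.
Variables (R : realType) (X : curve R) (T : sheaf X 1).
Local Notation F := (funfield X).
Variables (tau : closed_point X -> int) (q : F).
Hypotheses (hT : is_lb T tau) (q0 : q != 0) (oq : forall x, ord x q = 2%:Z * tau x)
  (nT : ~ iso T (@OX _ X)).
Implicit Types (x : closed_point X) (v : 'rV[F]_2).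

Lemma cayley2 (M : 'M[F]_2) : M *m M = \tr M *: M - (\det M)%:M.
Proof.
have tr2 : \tr M = M 0 0 + M 1 1.
  by rewrite /mxtrace big_ord_recl big_ord1; congr (_ + M _ _); apply: ord_inj.
have c2 (i j : 'I_2) : (M *m M) i j = M i 0 * M 0 j + M i 1 * M 1 j.
  rewrite mxE big_ord_recl big_ord1; congr (_ + M _ _ * M _ _); by apply: ord_inj.
have o2 (i : 'I_2) : i = 0 \/ i = 1.
  by case: i => [[|[|//]] hi]; [left|right]; apply: ord_inj.
apply/matrixP => i j; rewrite c2 det2 tr2 !mxE.
by case: (o2 i) => ->; case: (o2 j) => -> /=; ring.
Qed.

(** The trace of an isomorphism onto the twist is a section of a non-trivial line
bundle of degree zero, and its determinant is one of a trivial line bundle. *)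
Lemma root_of_twist (E : sheaf X 2) Psi : vector_bundle E -> iso_by E (tensor E T) Psi ->
  exists2 Psi' : 'M[F]_2, Psi' *m Psi' = q%:M &
    forall x h v, h != 0 -> ord x h = tau x -> E x v -> E x (h^-1 *: (v *m Psi')).
Proof.
move=> vE [uP hPsi].
have tw x h v : h != 0 -> ord x h = tau x -> E x v -> E x (h^-1 *: (v *m Psi)).
  move=> h0 oh Ev; have [A hA] := bundle_frame x vE.
  by apply/(tensor_mem _ (frame_omodule hA) hT h0 oh)/hPsi.
have reg x h A : h != 0 -> ord x h = tau x -> is_frame E x A ->
    forall i j, vge x 0 (h^-1 * (A *m Psi *m invmx A) i j).
  move=> h0 oh hA i j; have [uA _] := hA.
  have EA : E x (row i A).
    apply/(frame_mem _ hA) => k; rewrite -row_mul mulmxV // !mxE.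
    by case: eqP => _; rewrite ?vge0 // -(rmorph1 (cst X)) vge_cst.
  have := (frame_mem _ hA).1 (tw _ _ _ h0 oh EA) j.
  by rewrite -scalemxAl mxE -!row_mul mxE.
have conj_tr (A : 'M[F]_2) : A \in unitmx -> \tr (A *m Psi *m invmx A) = \tr Psi.
  by move=> uA; rewrite mxtrace_mulC mulmxA mulVmx // mul1mx.
have conj_det (A : 'M[F]_2) : A \in unitmx -> \det (A *m Psi *m invmx A) = \det Psi.
  move=> uA; rewrite !det_mulmx det_inv mulrAC divff ?mul1r //.
  by rewrite -unitfE -unitmxE.
have tr0 : \tr Psi = 0.
  apply: (no_sections hT q0 oq nT) => x.
  have [h [h0 oh]] := exists_ord x (tau x); have [A hA] := bundle_frame x vE.
  have [uA _] := hA; rewrite -(conj_tr A uA) -oh -[ord x h]add0r vge_div //.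
  rewrite mulrC /mxtrace mulr_sumr; apply: vge_sum => i _; exact: reg.
have d0 : \det Psi != 0 by rewrite -unitfE -unitmxE.
have [|c hc] := @L0_cst _ _ (- \det Psi / q).
  move=> x; rewrite -vge_div // oq add0r vgeN.
  have [h [h0 oh]] := exists_ord x (tau x); have [A hA] := bundle_frame x vE.
  have [uA _] := hA; rewrite -(conj_det A uA).
  have -> : 2%:Z * tau x = 0 + ord x (h * h) by rewrite ordM // oh; lia.
  rewrite vge_div ?mulf_neq0 // det2; set M := _ *m _.
  have -> : (M 0 0 * M 1 1 - M 0 1 * M 1 0) / (h * h) =
    (h^-1 * M 0 0) * (h^-1 * M 1 1) - (h^-1 * M 0 1) * (h^-1 * M 1 0).
    by rewrite invfM; ring.
  by apply: vgeB; rewrite -[0]add0r; apply: vgeM; apply: reg.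
have [d hd] := complex_sqrt c.
have dX0 : cst X d != 0.
  rewrite -sqrf_eq0 -rmorphXn hd -hc mulf_eq0 invr_eq0 (negbTE q0) orbF.
  by rewrite oppr_eq0.
exists ((cst X d)^-1 *: Psi).
  rewrite -scalemxAl -scalemxAr cayley2 tr0 scale0r sub0r scalerA -scalemx1 -scalerN.
  rewrite scalerA scalerN -scaleNr scalemx1 -mulrN; congr (_ %:M).
  have -> : - \det Psi = cst X d ^+ 2 * q by rewrite -rmorphXn hd -hc divfK.
  by field.
move=> x h v h0 oh Ev; have [A hA] := bundle_frame x vE.
rewrite -scalemxAr scalerA mulrC -scalerA; case: (frame_omodule hA) => _ _; apply.
  by rewrite -fmorphV vge_cst.
exact: tw.
Qed.

(** A line subbundle, generated by [A], and its image [A Psi] generically span the bundle,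
because [Psi] has no eigenvector when [q] is not a square.  In the basis [A, A Psi] the
map [Psi] is [twist_mx], and the first coordinate of a local lift of a generator of the
quotient, relative to the second one, is [r].  Applying the twisted [Psi] to the generators
[(s, 0)] and [(r t, t)] of the stalk gives the three conditions of [sqrt_mod]. *)
Lemma untwist (E : sheaf X 2) (L M : sheaf X 1) a b' A B Psi :
  is_lb L a -> is_lb M b' -> short_exact L E M A B ->
  (forall x, omodule E x) -> Psi *m Psi = q%:M ->
  (forall x h v, h != 0 -> ord x h = tau x -> E x v -> E x (h^-1 *: (v *m Psi))) ->
  exists Q e r, [/\ e != 0, iso_by E (extension a (fun x => b' x - ord x e) r) Q &
     sqrt_mod tau q (fun x => a x - (b' x - ord x e) - tau x) r].
Proof.
move=> hL hM [s1 s2 s3 s4 s5] oE Psi2 tw.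
have [x0 _] := exists_point X.
have A0 (u : 'M[F]_1) : u *m A = 0 -> u = 0.
  move=> e; have [u0|u0] := eqVneq (u 0 0) 0.
    by apply/matrixP => i j; rewrite !ord1 u0 mxE.
  have [h [h0 oh]] := exists_ord x0 (a x0).
  have Lh : L x0 ((h / u 0 0) *: u) by apply/hL; rewrite mxE divfK // -oh vge_ord.
  have := s3 _ _ Lh; rewrite -scalemxAl e scaler0 => /(_ erefl) /(congr1 (fun w : 'M_1 => w 0 0)).
  by rewrite !mxE divfK // => h00; rewrite h00 eqxx in h0.
have AB : A *m B = 0.
  have [h [h0 oh]] := exists_ord x0 (a x0).
  have Lh : L x0 (const_mx h) by apply/hL; rewrite mxE -oh vge_ord.
  have /s4[_ s6] := s1 _ _ Lh; have := s6 (ex_intro2 _ _ (const_mx h) Lh erefl).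
  have -> : (const_mx h : 'M[F]_1) = h%:M by apply/matrixP => i j; rewrite !ord1 !mxE mulr1n.
  by rewrite mul_scalar_mx -scalemxAl => /eqP; rewrite scaler_eq0 (negbTE h0) => /eqP.
pose P : 'M[F]_2 := \matrix_(i, j) (if i == 0 then A 0 j else (A *m Psi) 0 j).
have vP v : v *m P = v 0 0 *: A + v 0 1 *: (A *m Psi).
  by apply: row2P; rewrite mul2 !mxE.
have twP v : v *m P *m Psi = v *m twist_mx q *m P.
  rewrite twist_mxE !vP !row2E mulmxDl -!scalemxAl -mulmxA Psi2 mul_mx_scalar scalerA.
  by rewrite addrC.
have uP : P \in unitmx.
  rewrite unitmxE unitfE; apply/negP => /det0P[v v0 ev].
  have ev' : v *m twist_mx q *m P = 0 by rewrite -twP ev mul0mx.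
  have nv : (v 0 0 ^+ 2 - q * v 0 1 ^+ 2) *: A = 0.
    have := congr1 (fun w => v 0 0 *: w) ev; have := congr1 (fun w => v 0 1 *: w) ev'.
    rewrite !vP twist_mxE !row2E !scaler0 => e1 e2; rewrite -[RHS]subr0 -{1}e2 -e1.
    rewrite !scalerDr !scalerA opprD addrACA [v 0 1 * v 0 0]mulrC subrr addr0 -scalerBl.
    by congr (_ *: _); ring.
  have : (v 0 0 ^+ 2 - q * v 0 1 ^+ 2)%:M = 0 :> 'M[F]_1 by apply: A0; rewrite mul_scalar_mx.
  move/(congr1 (fun w : 'M_1 => w 0 0)); rewrite !mxE mulr1n => /subr0_eq.
  case/(norm_neq0 hT q0 oq nT) => e0 e1; case/eqP: v0.
  by apply: row2P; rewrite mxE.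
(* the image of [A Psi] in the quotient *)
pose e := (A *m Psi *m B) 0 0.
have vPB v : v *m P *m B = const_mx (v 0 1 * e).
  rewrite vP mulmxDl -!scalemxAl AB scaler0 add0r.
  by apply/matrixP => i j; rewrite !ord1 [LHS]mxE [RHS]mxE.
have lift x : exists u, [/\ E x (u *m P), u 0 1 != 0, e != 0 & ord x (u 0 1) = b' x - ord x e].
  have [h [h0 oh]] := exists_ord x (b' x).
  have Mh : M x (const_mx h) by apply/hM; rewrite mxE -oh vge_ord.
  have [v Ev ev] := s5 _ _ Mh; exists (v *m invmx P).
  move: ev; rewrite -{1}(mulmxKV uP v) vPB => /(congr1 (fun w : 'M_1 => w 0 0)).
  rewrite [LHS]mxE [RHS]mxE; set u1 := (_ *m _) 0 1 => eh.
  have : u1 * e != 0 by rewrite -eh.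
  rewrite mulf_eq0 negb_or => /andP[n1 n2]; split=> //; first by rewrite mulmxKV.
  by rewrite -oh eh ordM // addrK.
have e0 : e != 0 by have [u []] := lift x0.
have /choice[u hu] := lift.
pose r x := u x 0 0 / u x 0 1; pose b x := b' x - ord x e.
have memE x v : E x (v *m P) <-> extension a b r x v.
  have [Eu u1 _ ou] := hu x; have [E0 ED EZ] := oE x.
  pose c := v 0 1 / u x 0 1.
  have dec : v *m P = c *: (u x *m P) + (v 0 0 - r x * v 0 1) *: A.
    rewrite !vP scalerDr !scalerA addrAC -scalerDl; congr (_ *: _ + _ *: _).
      by rewrite /c /r; field.
    by rewrite /c divfK.
  have regc : vge x 0 c = vge x (b x) (v 0 1) by rewrite -vge_div // ou add0r.
  have memA f : E x (f *: A) <-> vge x (a x) f.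
    split=> [Ef|hf].
      have /s4[h _] := Ef; have [|w Lw ew] := h; first by rewrite -scalemxAl AB scaler0.
      have /A0 : (w - f%:M) *m A = 0 by rewrite mulmxBl -ew mul_scalar_mx subrr.
      move/subr0_eq => ew'; move/hL: Lw; by rewrite ew' mxE mulr1n.
    by rewrite -mul_scalar_mx; apply: s1; apply/hL; rewrite mxE mulr1n.
  split=> [Ev|[hb ha]]; last by rewrite dec; apply: ED; [apply: EZ; rewrite ?regc | apply/memA].
  have hb : vge x (b x) (v 0 1).
    by have /s2/hM := Ev; rewrite vPB mxE -(vgeMl x _ (v 0 1) e0) /b subrK.
  split=> //; apply/memA.
  have -> : (v 0 0 - r x * v 0 1) *: A = v *m P + (- c) *: (u x *m P).
    by rewrite dec scaleNr [RHS]addrC addKr.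
  by apply: ED => //; apply: EZ => //; rewrite vgeN regc.
have twE x h v : h != 0 -> ord x h = tau x -> extension a b r x v ->
    extension a b r x (row2 (h^-1 * (v 0 1 * q)) (h^-1 * v 0 0)).
  move=> h0 oh /memE/(tw _ _ _ h0 oh); rewrite twP scalemxAl => /memE.
  rewrite twist_mxE; have -> // : h^-1 *: row2 (v 0 1 * q) (v 0 0) =
    row2 (h^-1 * (v 0 1 * q)) (h^-1 * v 0 0).
  by apply: row2P; rewrite !mxE.
exists (invmx P), e, r; split=> //.
  by split=> [|x v]; [rewrite unitmx_inv | rewrite -memE mulmxKV].
move=> x; have [h [h0 oh]] := exists_ord x (tau x).
have [s [s0 os]] := exists_ord x (a x); have [t [t0 ot]] := exists_ord x (b x).
have [k1 k2] : extension a b r x (row2 (h^-1 * (0 * q)) (h^-1 * s)).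
  have := twE x h (row2 s 0) h0 oh; rewrite !row2E; apply.
  by split; rewrite !row2E ?vge0 // mulr0 subr0 -os vge_ord.
have [k3 k4] : extension a b r x (row2 (h^-1 * (t * q)) (h^-1 * (r x * t))).
  have := twE x h (row2 (r x * t) t) h0 oh; rewrite !row2E; apply.
  by split; rewrite !row2E ?subrr ?vge0 // -ot vge_ord.
rewrite !row2E in k1 k2 k3 k4.
rewrite -/(b x); split.
- by move: k1; rewrite mulrC -vge_div // vgeE // os oh; lia.
- move: k2; rewrite mul0r mulr0 sub0r vgeN mulrA -os -[ord x s]add0r vgeMl //.
  by rewrite -vge_div // oh add0r.
- have -> : a x - b x - tau x + 2%:Z * tau x = a x - ord x t + ord x h by rewrite oh ot; lia.
  rewrite vge_div // -(vgeMl x _ _ t0) subrK -vgeN; apply: etrans k4; congr vge.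
  by field.
Qed.

End Untwist.

(** * Wobbly bundles isomorphic to their twist *)

Section Wobbly.
Variables (R : realType) (X XT : curve R) (K T : sheaf X 1) (g : nat)
  (p : morphism XT X) (b : 'rV[funfield XT]_2) (sigma : morphism XT XT).
Hypotheses (hK : canonical_bundle K) (hg : genus K g) (lT : line_bundle T)
  (T2 : iso (tensor T T) (@OX _ X)) (nT : ~ iso T (@OX _ X))
  (hcov : etale_double_cover T p b) (hs : exchanges_sheets p sigma).
Variables (delta : nat) (E : sheaf X 2).
Hypothesis NE : in_N E.
Local Notation deg_F0 := (1 - g%:Z + (delta./2)%:Z).

(** Choose above each [x] the point [pt x] whose conjugate is not in the support of [D'], which
is possible by disjointness, and approximate [w] there by a function [r x] on [X]. *)
Lemma direct_image_in_WT (F0 : sheaf X 1)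
    (D' : (2 * g - 2 - delta).-tuple (closed_point XT)) (D : delta.-tuple (closed_point X)) :
  line_bundle F0 -> degree F0 = deg_F0 ->
  iso E (pushforward p b (tensor (pullback p F0) (O_plus D'))) ->
  disjoint_from_pullback sigma D' ->
  iso (tensor (tensor K T) (O_minus (Nm p D'))) (O_plus D) ->
  in_WT K T g delta E.
Proof.
move=> lF0 dF0 [Q hQ] disj isoD; have [vE _ _] := NE.
have [k [_ hk _ _]] := canonical_riemann_roch hK hg.
have [tau [q' [hT q'0 oq']]] := twist_root lT T2.
have [w [q [w0 sw q0 hq [oq ow]]]] := cover_root hcov hs hT q'0 oq' nT.
have [a [fa hF0]] := line_bundle_lb lF0.
have [et hb _] := hcov; have [P uP hP] := basis_change hs hb w0 sw.
have /choice[pt hpt] x : exists y, on_points p y = x /\ pts D' (on_points sigma y) = 0.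
  have [y yx] := point_over hcov hT x.
  have [h|h] := boolP (on_points sigma y \in D'); last first.
    by exists y; split=> //; rewrite /pts; apply/eqP; rewrite eqz_nat; apply/eqP/count_memPn.
  exists (on_points sigma y); rewrite (p_sigma et hs) (sgpK hs); split=> //.
  rewrite /pts; apply/eqP; rewrite eqz_nat; apply/eqP/count_memPn/negP => h'.
  exact: (disj y).
pose m x := pts (Nm p D') x.
have mE x : m x = pts D' (pt x).
  have [yx h] := hpt x; rewrite /m -{1}yx.
  by rewrite -[RHS]addr0 -h (pts_pull et hs hb w0 sw).
have m0 x : 0 <= m x by rewrite mE.
have /choice[r hr] x : exists r, vge (pt x) (m x + tau x) (comorph p r - w).
  have [r hr] := approx_pull et w0 (pt x) w (m x + tau x).
  by exists r; rewrite -opprB vgeN.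
pose c x := a x - m x - tau x.
have isoE : iso_by E (extension a c r) (Q *m P).
  have [uQ hQE] := hQ; split=> [|x v]; first by rewrite unitmx_mul uQ.
  rewrite hQE mulmxA.
  apply: (direct_image_extension et hs hb w0 sw ow hP hF0 (fun x => (hpt x).1)) => //.
  by move=> y; case: (hpt y).
have sq : sqrt_mod tau q m r.
  move=> x; have := root_mod et w0 hq ow (y := pt x) (r := r x) (m0 x).
  by rewrite (hpt x).1 => /(_ (hr x))[].
split.
  apply: in_MT_of_iso => //.
  have [S hS] := ext_iso_tensor hT q0 oq a sq.
  eexists; apply: (iso_by_trans isoE); apply: (iso_by_trans hS).
  by apply: iso_by_inv; exact: iso_by_tensor vE hT isoE.
split=> //.
have ftau := fin_tau oq.
have fc : fin c by apply: finB => //; apply: finB => //; exact: fin_pts.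
pose F1 : sheaf X 1 := O_of (fun x => - c x).
have hF1 : is_lb F1 c.
  by have := @O_of_lb _ X (fun x => - c x); congr is_lb; apply/funext => x; rewrite opprK.
exists F0, F1; do 2 eexists; exists D; split; first exact: lF0.
- exact: lb_line_bundle hF1.
- by apply: (iso_by_exact isoE); exact: ext_exact.
- have [f f0 hf] := (iso_lb (tensor_lb (tensor_lb hk hT) (O_minus_lb (Nm p D'))) (O_plus_lb D)).1 isoD.
  apply/(iso_lb hF1 (tensor_lb (tensor_lb hF0 hk) (O_minus_lb D))).
  exists f^-1; first by rewrite invr_eq0.
  by move=> x; have := hf x; rewrite ordV /c /m; lia.
- exact: dF0.
Qed.

Hypotheses (g_gt1 : (1 < g)%N) (ev_delta : ~~ odd delta) (le_delta : (delta <= 2 * g - 2)%N).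

(** By [untwist] the bundle is an extension defined by local square roots [r] of [q] modulo
[m]; at one of the two points above [x] the function [r x] approximates [w], and this
point, with multiplicity [m x], is taken into the divisor. *)
Lemma in_WT_direct_image : in_WT K T g delta E ->
  exists (F0 : sheaf X 1) (D' : (2 * g - 2 - delta).-tuple (closed_point XT)),
    [/\ line_bundle F0, degree F0 = deg_F0,
        iso E (pushforward p b (tensor (pullback p F0) (O_plus D'))),
        disjoint_from_pullback sigma D' &
        exists D : delta.-tuple (closed_point X),
          iso (tensor (tensor K T) (O_minus (Nm p D'))) (O_plus D)].
Proof.
move=> [[_ [Psi hPsi _]] [_ [F0 [F1 [A [B [D [lF0 lF1 exE isoF1 dF0]]]]]]]].
have [vE dE _] := NE.
have [k [_ hk _ _]] := canonical_riemann_roch hK hg.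
have [tau [q' [hT q'0 oq']]] := twist_root lT T2.
have [w [q [w0 sw q0 hq [oq ow]]]] := cover_root hcov hs hT q'0 oq' nT.
have [a [fa hF0]] := line_bundle_lb lF0; have [b' [fb' hF1]] := line_bundle_lb lF1.
have [et hb _] := hcov; have [P uP hP] := basis_change hs hb w0 sw.
have [Psi' Psi2 tw] := root_of_twist hT q0 oq nT vE hPsi.
have oE x : omodule E x by have [? /frame_omodule] := bundle_frame x vE.
have [Q [e [r [e0 isoE sq]]]] := untwist hT q0 oq nT hF0 hF1 exE oE Psi2 tw.
set c := (fun x => b' x - ord x e) in isoE; pose m x := a x - c x - tau x.
have ftau := fin_tau oq.
have fc : fin c by apply: finB => //; exact: fin_ord.
have fm : fin m by apply: finB => //; exact: finB.
have dm : deg m = (2 * g - 2 - delta)%N%:Z.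
  have := degree_iso fa fc isoE; rewrite dE.
  have := degree_lb fa hF0; rewrite dF0.
  have dm u : fin u -> deg (fun x => a x - u x - tau x) = deg a - deg u.
    by move=> fu; rewrite !degB ?(deg_tau oq) ?subr0 //; exact: finB.
  have -> : deg m = deg a - deg c := dm c fc.
  have := odd_double_half delta; rewrite (negbTE ev_delta).
  by move: (deg a) (deg c); lia.
have m0 x : 0 <= m x by have [] := sq x.
have /choice[pt hpt] x : exists y, on_points p y = x /\ vge y (m x + tau x) (comorph p (r x) - w).
  have [y yx] := point_over hcov hT x; have [_ h1 h2] := sq x.
  have := @mod_root _ _ _ p sigma w q tau et hs w0 sw hq ow y (m x) (r x) (m0 x).
  rewrite yx => /(_ h1 h2)[h|h]; first by exists y.
  by exists (on_points sigma y); rewrite (p_sigma et hs).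
have neq y : on_points sigma y != y := sigma_neq et hs hb w0 sw y.
(* the divisor on the cover, as a function of its points *)
pose mY y := if y == pt (on_points p y) then m (on_points p y) else 0.
have fmY : fin mY.
  apply: (@sub_finite_set _ _ (pt @` [set x | m x != 0])%classic); last exact: finite_image.
  move=> y; rewrite /= /mY; case: ifP => [/eqP ey h|_]; last by rewrite eqxx.
  by exists (on_points p y).
have [|s hs'] := effective_pts fmY; first by move=> y; rewrite /mY; case: ifP.
have s1 x : pts s (pt x) = m x by rewrite -hs' /mY (hpt x).1 eqxx.
have s2 x : pts s (on_points sigma (pt x)) = 0.
  by rewrite -hs' /mY (p_sigma et hs) (hpt x).1 (negbTE (neq _)).
have ptsm x : pts (map (on_points p) s) x = m x.
  by rewrite -[x in LHS](hpt x).1 (pts_pull et hs hb w0 sw) s1 s2 addr0.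
have ss : size s == (2 * g - 2 - delta)%N.
  rewrite -eqz_nat -dm -(size_map (on_points p)) -deg_pts; apply/eqP; congr deg.
  by apply/funext.
exists F0, (Tuple ss); split=> //.
- exists (Q *m invmx P); have [uQ hQE] := isoE.
  split=> [|x v]; first by rewrite unitmx_mul uQ unitmx_inv.
  have hD := direct_image_extension et hs hb w0 sw ow hP hF0 (fun x => (hpt x).1) (D := Tuple ss)
    s2 (fun x => esym (s1 x)) (fun x => (hpt x).2).
  rewrite hD mulmxA mulmxKV // hQE.
  suff -> : c = (fun x => a x - m x - tau x) by [].
  by apply/funext => y; rewrite /m; ring.
- move=> y [h1 h2].
  have pos z : z \in s -> z = pt (on_points p z).
    move=> zs; apply: contrapT => /eqP ne; move: zs.
    rewrite -has_pred1 has_count; have : pts s z = 0 by rewrite -hs' /mY (negbTE ne).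
    by rewrite /pts => -[->].
  by case/eqP: (neq y); have := pos _ h2; rewrite (p_sigma et hs) -(pos _ h1).
- exists D.
  have [f f0 hf] := (iso_lb hF1 (tensor_lb (tensor_lb hF0 hk) (O_minus_lb D))).1 isoF1.
  apply/(iso_lb (tensor_lb (tensor_lb hk hT) (O_minus_lb _)) (O_plus_lb D)).
  exists (f * e)^-1; first by rewrite invr_eq0 mulf_neq0.
  by move=> x; have := hf x; rewrite ptsm ordV ordM // /m /c; lia.
Qed.

End Wobbly.

Theorem theorem4p2 (R : realType) (X : curve R) (K T : sheaf X 1) (g : nat)
    (hK : canonical_bundle K) (hg : genus K g) (g_gt1 : (1 < g)%N)
    (hT : line_bundle T) (hT2 : iso (tensor T T) (OX X))
    (hT1 : ~ iso T (OX X)) :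
  (forall (XT : curve R) (p : morphism XT X) (b : 'rV[funfield XT]_2)
          (sigma : morphism XT XT),
     etale_double_cover T p b -> exchanges_sheets p sigma ->
   forall delta : nat, ~~ odd delta -> (delta <= 2 * g - 2)%N ->
   forall E : sheaf X 2, in_N E ->
     (in_WT K T g delta E <->
      exists (F0 : sheaf X 1)
             (D' : (2 * g - 2 - delta).-tuple (closed_point XT)),
        [/\ line_bundle F0,
            degree F0 = 1 - g%:Z + (delta./2)%:Z,
            iso E (pushforward p b (tensor (pullback p F0) (O_plus D'))),
            disjoint_from_pullback sigma D' &
            exists D : delta.-tuple (closed_point X),
              iso (tensor (tensor K T) (O_minus (Nm p D'))) (O_plus D)]))
  /\
  (forall delta : nat, ~~ odd delta -> (delta <= 2 * g - 2)%N ->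
     exists E : sheaf X 2, in_WT K T g delta E).
Proof.
split; last exact: WT_nonempty.
move=> XT p b sigma hcov hs delta ev_delta le_delta E NE; split.
  by move=> hW; apply: in_WT_direct_image hW.
case=> F0 [D' [lF0 dF0 isoE disj [D isoD]]].
exact: (direct_image_in_WT hK hg hT hT2 hT1 hcov hs NE lF0 dF0 isoE disj isoD).
Qed.
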